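(* Let $\tau=T/N$ and $1\le n<N$. Let $\phi^n,\phi^{n-1}$ on $\Omega$ and $\psi^n,\psi^{n-1}$ on $\Gamma$ be given, with $\phi^n|_\Gamma=\psi^n$, $\Phi^n=(\phi^n-\phi^{n-1})/\tau$, $\Psi^n=(\psi^n-\psi^{n-1})/\tau$, $\int_\Omega\Phi^n\,d\mathbf x=0$ and $\int_\Gamma\Psi^n\,dS=0$. Let $(\phi^{n+1},\mu^{n+1},\Phi^{n+1},\psi^{n+1},\mu_\Gamma^{n+1},\Psi^{n+1})$ be a (sufficiently regular) solution of the scheme $$ \begin{aligned} &\beta_1\frac{\Phi^{n+1}-\Phi^n}{\tau}+\Phi^{n+1}=M_1\Delta\mu^{n+1}, && \text{in }\Omega,\\ &\mu^{n+1}=-\Delta\phi^{n+1}+f(\phi^n)+s_1(\phi^{n+1}-\phi^n), && \text{in }\Omega,\\ &\Phi^{n+1}=\frac{\phi^{n+1}-\phi^n}{\tau}, && \text{in }\Omega,\\ &\phi^{n+1}|_\Gamma=\psi^{n+1}, && \text{on }\Gamma,\\ &\beta_2\frac{\Psi^{n+1}-\Psi^n}{\tau}+\Psi^{n+1}=M_2\Delta_\Gamma\mu_\Gamma^{n+1}, && \text{on }\Gamma,\\ &\mu_\Gamma^{n+1}=-\Delta_\Gamma\psi^{n+1}+g(\psi^n)+\partial_{\mathbf n}\phi^{n+1}+s_2(\psi^{n+1}-\psi^n), && \text{on }\Gamma,\\ &\Psi^{n+1}=\frac{\psi^{n+1}-\psi^n}{\tau}, && \text{on }\Gamma,\\ &\partial_{\mathbf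 n}\mu^{n+1}=0, && \text{on }\Gamma. \end{aligned} $$ If $s_1\ge\frac12\max_{\xi\in\mathbb R}F''(\xi)$ and $s_2\ge\frac12\max_{\eta\in\mathbb R}G''(\eta)$, then the scheme is energy stable in the sense that $$ \frac{\mathcal E(\phi^{n+1},\psi^{n+1})-\mathcal E(\phi^n,\psi^n)}{\tau}\le-\frac1{M_1}\|\nabla p^{n+1}\|^2-\frac1{M_2}\|\nabla_\Gamma q^{n+1}\|_\Gamma^2, $$ where $p^k=\Delta^{-1}\Phi^k$, $q^k=\Delta_\Gamma^{-1}\Psi^k$ for $k=n,n+1$, and $$ \mathcal E(\phi^k,\psi^k)=\frac{\|\nabla\phi^k\|^2}{2}+(F(\phi^k),1)_\Omega+\frac{\beta_1}{2M_1}\|\nabla p^k\|^2+\frac{\|\nabla_\Gamma\psi^k\|_\Gamma^2}{2}+(G(\psi^k),1)_\Gamma+\frac{\beta_2}{2M_2}\|\nabla_\Gamma q^k\|_\Gamma^2 . $$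
   Context: $\Omega\subset\mathbb R^d$ ($d=2,3$) is a bounded domain with smooth connected boundary $\Gamma=\partial\Omega$ and outward unit normal $\mathbf n$; $T>0$ is finite and $N$ is the number of time steps. $\nabla_\Gamma$ is the tangential (surface) gradient and $\Delta_\Gamma$ the Laplace–Beltrami operator on $\Gamma$. $M_1,M_2>0$ and $\beta_1,\beta_2\ge0$ are constants; $s_1,s_2$ are real stabilization constants. $F,G:\mathbb R\to\mathbb R$ are $C^2$ potentials for which $\max_{\mathbb R}F''$ and $\max_{\mathbb R}G''$ are finite, and $f=F'$, $g=G'$. Norms: $(u,v)_\Omega=\int_\Omega uv\,d\mathbf x$, $(u,v)_\Gamma=\int_\Gamma uv\,dS$, $\|u\|^2=(u,u)_\Omega$, $\|u\|_\Gamma^2=(u,u)_\Gamma$ (also for vector fields). Inverse operators: for $\omega_1$ on $\Omega$ with $\int_\Omega\omega_1\,d\mathbf x=0$, $W_1=\Delta^{-1}\omega_1$ means $\Delta W_1=\omega_1$ in $\Omega$ with $\partial_{\mathbf n}W_1|_\Gamma=0$. For $\omega_2$ on $\Gamma$ with $\int_\Gamma\omega_2\,dS=0$, $W_2=\Delta_\Gamma^{-1}\omega_2$ means $\Delta_\Gamma W_2=\omega_2$ on $\Gamma$. These are determined up to an additive constant, which does not affect the gradients appearing in the statement. (The scheme implies that $\Phi^{n+1}$, $\Psi^{n+1}$ have zero mean when $\Phi^n$, $\Psi^n$ do.) *)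

(* Defs.v *)
From HB Require Import structures.
From mathcomp Require Import all_boot all_order all_algebra.
From mathcomp Require Import all_classical all_reals all_analysis.

Set Implicit Arguments.
Unset Strict Implicit.
Unset Printing Implicit Defensive.

Import Order.TTheory GRing.Theory Num.Theory.
Import numFieldNormedType.Exports.

Local Open Scope classical_set_scope.
Local Open Scope ring_scope.

(* Points of R^n are row vectors.  The library's sigma-algebra for R^n is the
   product one on n-tuples, so measures live on tuples and [vec] identifies
   the two presentations. *)

Notation Rtuple R n := (n.-tuple (measurableTypeR R)).

Lemma product_sigma_finite d1 d2 (T1 : measurableType d1)
    (T2 : measurableType d2) (R : realType)
    (m1 : {sigma_finite_measure set T1 -> \bar R})
    (m2 : {sigma_finite_measure set T2 -> \bar R}) :
  sigma_finite setT (m1 \x m2)%E.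
Proof.
have /sigma_finiteP[F [TF ndF Foo]] := sigma_finiteT m1.
have /sigma_finiteP[G [TG ndG Goo]] := sigma_finiteT m2.
exists (fun n => F n `*` G n).
  rewrite -setXTT TF TG predeqE => -[x y]; split.
    move=> [/= [n _ Fnx] [k _ Gky]]; exists (maxn n k) => //; split.
    - by move: x Fnx; exact/subsetPset/ndF/leq_maxl.
    - by move: y Gky; exact/subsetPset/ndG/leq_maxr.
  by move=> [n _ []/= ? ?]; split; exists n.
move=> k; have [? ?] := Foo k; have [? ?] := Goo k.
split; first exact: measurableX.
by rewrite product_measure1E// lte_mul_pinfty// ge0_fin_numE.
Qed.

Section LebesgueTuple.
Variables (R : realType) (n : nat).
Variable m : {sigma_finite_measure set (Rtuple R n) -> \bar R}.

Definition consp (p : measurableTypeR R * Rtuple R n) : Rtuple R n.+1 :=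
  [the n.+1.-tuple _ of p.1 :: p.2].

Let consp_measurable : measurable_fun setT consp.
Proof. exact: measurable_cons. Qed.

Definition leb_step : set (Rtuple R n.+1) -> \bar R :=
  pushforward (@lebesgue_measure R \x m)%E consp.

Let mconsp A : measurable A -> measurable (consp @^-1` A).
Proof. by move=> mA; rewrite -[X in measurable X]setTI; exact: consp_measurable. Qed.

Let leb_step0 : leb_step set0 = 0%E.
Proof. by rewrite /leb_step /pushforward preimage_set0 measure0. Qed.

Let leb_step_ge0 A : (0 <= leb_step A)%E.
Proof. exact: measure_ge0. Qed.

Let leb_step_sigma_additive : semi_sigma_additive leb_step.
Proof.
move=> F mF tF mUF; rewrite /leb_step /pushforward preimage_bigcup.
apply: measure_semi_sigma_additive.
- by move=> k; exact: mconsp.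
- apply/trivIsetP => /= i j _ _ ij; rewrite -preimage_setI.
  by move/trivIsetP : tF => /(_ _ _ _ _ ij) ->//; rewrite preimage_set0.
- by rewrite -preimage_bigcup; exact: mconsp.
Qed.

HB.instance Definition _ := isMeasure.Build _ _ _ leb_step
  leb_step0 leb_step_ge0 leb_step_sigma_additive.

Let leb_step_sigma_finite : sigma_finite setT leb_step.
Proof.
have [F TF Foo] := product_sigma_finite (@lebesgue_measure R) m.
pose split (t : Rtuple R n.+1) : measurableTypeR R * Rtuple R n :=
  (thead t, [tuple of behead t]).
have splitK p : split (consp p) = p.
  case: p => x t; rewrite /split /consp; congr pair; exact: val_inj.
have msplit : measurable_fun setT split.
  apply/measurable_fun_pairP; split; first exact: measurable_tnth.
  exact: measurable_behead.
exists (fun k => split @^-1` F k).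
  by rewrite -preimage_bigcup -TF preimage_setT.
move=> k; have [mF Fk] := Foo k; split.
  by rewrite -[X in measurable X]setTI; exact: msplit.
rewrite /leb_step /pushforward -comp_preimage.
by rewrite (_ : split \o consp = id) //; exact/funext.
Qed.

HB.instance Definition _ :=
  Measure_isSigmaFinite.Build _ _ _ leb_step leb_step_sigma_finite.

End LebesgueTuple.

Fixpoint leb (R : realType) (n : nat) :
    {sigma_finite_measure set (Rtuple R n) -> \bar R} :=
  match n with
  | 0 => [the {sigma_finite_measure set (Rtuple R 0) -> \bar R} of
            dirac [tuple of [::]]]
  | k.+1 => [the {sigma_finite_measure set (Rtuple R k.+1) -> \bar R} of
            leb_step (leb R k)]
  end.


Section Space.
Variable R : realType.

Definition vec n (t : Rtuple R n) : 'rV[R]_n := \row_(i < n) tnth t i.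
Definition unvec n (x : 'rV[R]_n) : Rtuple R n := [tuple (x 0 i : R) | i < n].

(* For a measure [m] on R^n, the integral over the region [A] of [u]. *)
Definition intg n (m : {measure set (Rtuple R n) -> \bar R}) (A : set 'rV[R]_n)
    (u : 'rV[R]_n -> R) : R :=
  Rintegral m (@vec n @^-1` A) (u \o @vec n).

Definition dotv n (v w : 'rV[R]_n) : R := \sum_(i < n) v 0 i * w 0 i.

Definition partial n (i : 'I_n) (u : 'rV[R]_n -> R) (x : 'rV[R]_n) : R :=
  'D_(delta_mx 0 i) u x.
Definition grad n (u : 'rV[R]_n -> R) (x : 'rV[R]_n) : 'rV[R]_n :=
  \row_(i < n) partial i u x.
Definition lap n (u : 'rV[R]_n -> R) (x : 'rV[R]_n) : R :=
  \sum_(i < n) partial i (partial i u) x.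

Fixpoint Ck n (k : nat) (u : 'rV[R]_n -> R) : Prop :=
  match k with
  | 0 => continuous u
  | k'.+1 => continuous u /\ forall i : 'I_n,
      (forall x, derivable u x (delta_mx 0 i)) /\ Ck k' (partial i u)
  end.
Definition smooth n (u : 'rV[R]_n -> R) : Prop := forall k, Ck k u.

(* [u] coincides on [A] with a C^k function on R^n.  For [A] the closure of a
   smooth bounded domain, or its boundary, this is C^k regularity on [A]; the
   values of [u] off [A] are irrelevant. *)
Definition Ck_on n (k : nat) (A : set 'rV[R]_n) (u : 'rV[R]_n -> R) : Prop :=
  exists2 v, Ck k v & forall x, A x -> u x = v x.

(* The point of R^d with i-th coordinate [t], the other coordinates, in order,
   being those of [y]: the inverse of x |-> (x 0 i, col' i x). *)
Definition ins d (i : 'I_d) (t : R) (y : 'rV[R]_d.-1) : 'rV[R]_d :=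
  \row_(j < d) if unlift i j is Some k then y 0 k else t.

Variable d : nat.
Implicit Types (Omega U : set 'rV[R]_d) (i : 'I_d) (b : bool)
  (gam : 'rV[R]_d.-1 -> R).

Definition bdry Omega : set 'rV[R]_d := closure Omega `\` interior Omega.

(* In the open set [U], [Omega] is the part strictly below ([b = false]) or
   strictly above ([b = true]) the graph x_i = gam (x_j)_{j != i}; hence in [U]
   the boundary of [Omega] is this graph. *)
Definition graph_chart Omega U i b gam : Prop :=
  [/\ open U, smooth gam &
     forall x, U x -> (Omega x <-> (-1) ^+ b * (x 0 i - gam (col' i x)) < 0)].

Record smooth_bounded_domain Omega : Prop := {
  domain_open : open Omega;
  domain_nonempty : Omega !=set0;
  domain_connected : connected Omega;
  domain_bounded : bounded_set Omega;
  domain_bdry_smooth : forall x, bdry Omega x ->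
    exists U i b gam, graph_chart Omega U i b gam /\ U x;
  domain_bdry_connected : connected (bdry Omega) }.

Definition area_density gam (y : 'rV[R]_d.-1) : R :=
  Num.sqrt (1 + dotv (grad gam y) (grad gam y)).

(* The normalized gradient of the local defining function
   (-1)^b (x_i - gam), which is negative exactly on [Omega]. *)
Definition graph_normal i b gam (x : 'rV[R]_d) : 'rV[R]_d :=
  ((-1) ^+ b / area_density gam (col' i x)) *:
    ins i 1 (- grad gam (col' i x)).

Definition outward_normal Omega (x : 'rV[R]_d) : 'rV[R]_d :=
  xget 0 [set v | exists U i b gam,
    [/\ graph_chart Omega U i b gam, U x & v = graph_normal i b gam x]].

(* Surface measure of the boundary of [Omega], determined by its values on
   Borel subsets of graph charts (area formula). *)
Definition is_surface_measure Omega
    (sigma : {measure set (Rtuple R d) -> \bar R}) : Prop :=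
  sigma (~` (@vec d @^-1` bdry Omega)) = 0%E /\
  forall U i b gam, graph_chart Omega U i b gam ->
  forall A : set (Rtuple R d), measurable A -> A `<=` @vec d @^-1` U ->
    sigma (A `&` @vec d @^-1` bdry Omega) =
    (\int[leb R d.-1]_(y in [set y | A (unvec (ins i (gam (vec y)) (vec y)))])
       (area_density gam (vec y))%:E)%E.

(* Derivative along the outward normal, computed from inside the domain. *)
Definition dnormal Omega (u : 'rV[R]_d -> R) (x : 'rV[R]_d) : R :=
  lim ((fun t : R => (u x - u (x - t *: outward_normal Omega x)) / t) @ 0^'+).

(* Tangential gradient of [w] on the boundary: the tangential projection of the
   ordinary gradient of any local extension of [w] differentiable at [x] (the
   result does not depend on the extension). *)
Definition tgrad Omega (w : 'rV[R]_d -> R) (x : 'rV[R]_d) : 'rV[R]_d :=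
  let W := xget (fun=> 0) [set W : 'rV[R]_d -> R | differentiable W x /\
             \forall y \near x, bdry Omega y -> W y = w y] in
  let nu := outward_normal Omega x in
  grad W x - dotv (grad W x) nu *: nu.

(* Laplace-Beltrami operator, as surface divergence of the surface gradient. *)
Definition lapB Omega (w : 'rV[R]_d -> R) (x : 'rV[R]_d) : R :=
  \sum_(i < d) tgrad Omega (fun y => tgrad Omega w y 0 i) x 0 i.

(* [W] is a representative of the inverse Neumann Laplacian of [w]. *)
Definition inv_lap Omega (w W : 'rV[R]_d -> R) : Prop :=
  [/\ Ck_on 2 (closure Omega) W,
      forall x, Omega x -> lap W x = w x &
      forall x, bdry Omega x -> dnormal Omega W x = 0].

(* [W] is a representative of the inverse Laplace-Beltrami operator of [w]. *)
Definition inv_lapB Omega (w W : 'rV[R]_d -> R) : Prop :=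
  Ck_on 2 (bdry Omega) W /\ forall x, bdry Omega x -> lapB Omega W x = w x.

Definition sqnorm_grad Omega (u : 'rV[R]_d -> R) : R :=
  intg (leb R d) Omega (fun x => dotv (grad u x) (grad u x)).
Definition sqnorm_tgrad Omega (sigma : {measure set (Rtuple R d) -> \bar R})
    (w : 'rV[R]_d -> R) : R :=
  intg sigma (bdry Omega) (fun x => dotv (tgrad Omega w x) (tgrad Omega w x)).

Definition energy Omega (sigma : {measure set (Rtuple R d) -> \bar R})
    (M1 M2 beta1 beta2 : R) (F G : R -> R) (phi psi p q : 'rV[R]_d -> R) : R :=
  sqnorm_grad Omega phi / 2 + intg (leb R d) Omega (F \o phi)
  + beta1 / (2 * M1) * sqnorm_grad Omega p
  + sqnorm_tgrad Omega sigma psi / 2 + intg sigma (bdry Omega) (G \o psi)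
  + beta2 / (2 * M2) * sqnorm_tgrad Omega sigma q.

(* One step of the scheme; the suffix 0 marks time level n, 1 level n + 1. *)
Record scheme_step Omega (M1 M2 beta1 beta2 s1 s2 tau : R) (f g : R -> R)
    (phi0 Phi0 psi0 Psi0 phi1 mu1 Phi1 psi1 muG1 Psi1 : 'rV[R]_d -> R) :
    Prop := {
  scheme_Phi : forall x, Omega x ->
    beta1 * ((Phi1 x - Phi0 x) / tau) + Phi1 x = M1 * lap mu1 x;
  scheme_mu : forall x, Omega x ->
    mu1 x = - lap phi1 x + f (phi0 x) + s1 * (phi1 x - phi0 x);
  scheme_dphi : forall x, Omega x -> Phi1 x = (phi1 x - phi0 x) / tau;
  scheme_trace : forall x, bdry Omega x -> phi1 x = psi1 x;
  scheme_Psi : forall x, bdry Omega x ->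
    beta2 * ((Psi1 x - Psi0 x) / tau) + Psi1 x = M2 * lapB Omega muG1 x;
  scheme_muG : forall x, bdry Omega x ->
    muG1 x = - lapB Omega psi1 x + g (psi0 x) + dnormal Omega phi1 x
             + s2 * (psi1 x - psi0 x);
  scheme_dpsi : forall x, bdry Omega x -> Psi1 x = (psi1 x - psi0 x) / tau;
  scheme_neumann : forall x, bdry Omega x -> dnormal Omega mu1 x = 0 }.

End Space.

(* A twice continuously differentiable potential with second derivative
   bounded above. *)
Definition admissible_potential (R : realType) (F : R -> R) : Prop :=
  [/\ forall x, derivable F x 1,
      forall x, derivable (derive1 F) x 1,
      continuous (derive1 (derive1 F)) &
      has_ubound (range (derive1 (derive1 F)))].

(* Main.v *)
Require Import Defs.
From HB Require Import structures.
From mathcomp Require Import all_boot all_order all_algebra.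
From mathcomp Require Import all_classical all_reals all_analysis.
From mathcomp Require Import measurable_realfun zify ring lra.

Set Implicit Arguments.
Unset Strict Implicit.
Unset Printing Implicit Defensive.

Import Order.TTheory GRing.Theory Num.Theory.
Import numFieldNormedType.Exports.

Local Open Scope classical_set_scope.
Local Open Scope ring_scope.

(** The energy decreases for the reason it does in the continuous problem: one
    tests the evolution equations with the inverse operators [p] and [q]. Two
    facts control what the time discretization adds. Since [F''] is bounded
    above by [2 * s], the stabilization term pays for the explicit treatment of the
    potential ([potential_increment]). The quadratic terms satisfy
    [a * a - b * b <= 2 * a * (a - b)], which handles the implicit Laplacian and
    the inertial energy. The flux of the phase through the boundary, left
    over by integration by parts in the domain, is cancelled by the same flux
    inside the chemical potential of the boundary. The lemma [energy_step] carries
    out this argument once, for an abstract integral and abstract gradients;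
    [domain_estimate] and [boundary_estimate] are its two instances, and the
    theorem is their sum.

    The instances rest on two Green identities, [green_domain] and
    [green_boundary], for a domain whose boundary is locally the graph of a smooth
    function and for a surface measure characterized by the area formula. Both are
    proved for functions supported in a chart and then globalized with C^1 bumps
    and compactness ([localization]).

    For the divergence theorem in a chart [x_i = gam], the derivation
    [partial j + gslope j * partial i] annihilates the defining function and is
    divergence free. Its integral against a smooth cut-off of the defining function
    is therefore zero, and by dominated convergence so is its integral over the
    domain ([Int_heaviside], [Int_tangential]). This reduces every derivative to
    the one along the [i]-th axis, for which Fubini and the fundamental theorem of
    calculus give the value on the graph ([Int_below]); [surface_integral_chart]
    recognizes the result as a surface integral ([divergence_local],
    [divergence_theorem]).

    For the surface identity, the area density times the tangential divergence is
    a sum of coordinate derivatives in the parameters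
    ([graph_divergence_product], which uses the symmetry of second derivatives), so
    its integral vanishes for compact support. *)

(** * C^1 functions on R^n *)

Section Calculus.
Variable R : realType.

Lemma coord_le_norm n (x : 'rV[R]_n) (j : 'I_n) : `|x 0 j| <= `|x|.
Proof.
rewrite [leRHS]/Num.Def.normr/= mx_normrE.
exact: (le_bigmax _ (fun ij : 'I_1 * 'I_n => `|x ij.1 ij.2|) (ord0, j)).
Qed.

Lemma norm_le_coord n (x : 'rV[R]_n) (r : R) : 0 <= r ->
  (forall j, `|x 0 j| <= r) -> `|x| <= r.
Proof.
move=> r0 H; rewrite [leLHS]/Num.Def.normr/= mx_normrE.
by apply: bigmax_le => // -[i j] _ /=; rewrite ord1.
Qed.

Lemma nbhs0_norm_lt n (r : R) : 0 < r -> \forall h \near (0 : 'rV[R]_n), `|h| < r.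
Proof.
move=> r0; apply/nbhs_ballP; exists r => //= y.
by rewrite -ball_normE /= sub0r normrN.
Qed.

Lemma derive_line n (u : 'rV[R]_n -> R) (x v : 'rV[R]_n) (t : R) : derivable u (x + t *: v) v ->
  is_derive t 1 (fun s : R => u (x + s *: v)) ('D_v u (x + t *: v)).
Proof.
move=> du.
have E : (fun h : R => h^-1 *: (((fun s : R => u (x + s *: v)) \o shift t)
     (h *: (1 : R)) - u (x + t *: v))) =
   (fun h : R => h^-1 *: ((u \o shift (x + t *: v)) (h *: v) - u (x + t *: v))).
  apply/funext => h /=; congr (_ *: (u _ - _)).
  by rewrite scalerDl addrCA; congr (_ *: _ + _); rewrite [h *: 1]mulr1.
by split; rewrite /derivable /derive E.
Qed.

Lemma MVT_line n (u : 'rV[R]_n -> R) (x v : 'rV[R]_n) (t : R) :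
  (forall y, derivable u y v) ->
  exists2 s, `|s| <= `|t| & u (x + t *: v) - u x = t * 'D_v u (x + s *: v).
Proof.
move=> du.
have D (s : R) : is_derive s (1 : R) (fun s : R => u (x + s *: v)) ('D_v u (x + s *: v)).
  exact: derive_line.
have C (A : set R) : {within A, continuous (fun s : R => u (x + s *: v))}.
  apply: continuous_subspaceT => s.
  by apply/differentiable_continuous/derivable1_diffP; have [] := D s.
have [t0|t0] := leP 0 t.
- have [s sI E] := @MVT_segment _ _ _ 0 t t0 (fun s _ => D s) (C _).
  exists s; last by move: E; rewrite scale0r addr0 subr0 mulrC.
  by move: sI; rewrite in_itv/= => /andP[s0 st]; rewrite !ger0_norm.
- have [s sI E] := @MVT_segment _ _ _ t 0 (ltW t0) (fun s _ => D s) (C _).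
  exists s; last first.
    move: E; rewrite scale0r addr0 sub0r mulrN => /eqP.
    by rewrite -eqr_oppLR opprB mulrC => /eqP.
  move: sI; rewrite in_itv/= => /andP[s0 st].
  by rewrite !ler0_norm ?lerN2 // ltW.
Qed.

(** The scalar product with the gradient on the right, so that it can be declared
    linear in its last argument and serve as a candidate differential. *)
Definition dotr n (w v : 'rV[R]_n) : R := dotv v w.

Lemma dotr_is_linear n (w : 'rV[R]_n) : linear (dotr w).
Proof.
move=> a x y; rewrite /dotr /dotv scaler_sumr -big_split; apply: eq_bigr => i _.
by rewrite !mxE mulrDl -mulrA.
Qed.

HB.instance Definition _ n (w : 'rV[R]_n) :=
  GRing.isLinear.Build R 'rV[R]_n R *:%R (dotr w) (@dotr_is_linear n w).

Lemma continuous_coord n (i : 'I_n) : continuous (fun x : 'rV[R]_n => x 0 i : R).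
Proof. exact: coord_continuous. Qed.

Lemma continuous_sum_ord (T : topologicalType) m (f : 'I_m -> T -> R) :
  (forall i, continuous (f i)) -> continuous (fun x => \sum_(i < m) f i x).
Proof.
by move=> H; apply: (@continuous_big _ _ +%R) => //; exact: add_continuous.
Qed.

Lemma continuous_mul (T : topologicalType) (f g : T -> R) :
  continuous f -> continuous g -> continuous (fun x => f x * g x).
Proof. by move=> cf cg x; apply: cvgM; [exact: cf|exact: cg]. Qed.

Lemma continuous_add (T : topologicalType) (f g : T -> R) :
  continuous f -> continuous g -> continuous (fun x => f x + g x).
Proof. by move=> cf cg x; apply: cvgD; [exact: cf|exact: cg]. Qed.

Lemma continuous_opp (T : topologicalType) (f : T -> R) :
  continuous f -> continuous (fun x => - f x).
Proof. by move=> cf x; apply: cvgN; exact: cf. Qed.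

Lemma continuous_cst (T : topologicalType) (c : R) : continuous (fun _ : T => c).
Proof. by move=> x; exact: cvg_cst. Qed.

Lemma dotr_continuous n (w : 'rV[R]_n) : continuous (dotr w).
Proof.
rewrite /dotr /dotv; apply: continuous_sum_ord => i; apply: continuous_mul.
  exact: continuous_coord.
exact: continuous_cst.
Qed.

(** Continuous partial derivatives give differentiability: going from [x] to
    [x + h] one coordinate at a time, each step is a mean value on a coordinate
    line, and all intermediate points stay within [`|h|] of [x]. *)
Lemma Ck1_diff n (u : 'rV[R]_n -> R) (x : 'rV[R]_n) : Ck 1 u ->
  differentiable u x /\ forall v, 'd u x v = dotv v (grad u x).
Proof.
move=> [_ H].
have du i : forall y, derivable u y (delta_mx 0 i) by case: (H i).
have cu i : continuous (partial i u) by case: (H i).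
(* [pv k h] keeps the first [k] coordinates of [h]: the staircase from 0 to [h]. *)
pose pv (k : nat) (h : 'rV[R]_n) : 'rV[R]_n :=
  \row_j (if (j < k)%N then h 0 j else 0).
have pv0 h : pv 0%N h = 0 by apply/rowP => j; rewrite !mxE.
have pvn h : pv n h = h by apply/rowP => j; rewrite !mxE ltn_ord.
have pvS h (k : 'I_n) : pv k.+1 h = pv k h + h 0 k *: delta_mx 0 k.
  apply/rowP => j; rewrite !mxE/= ltnS leq_eqVlt.
  case: (eqVneq j k) => [->|jk]; first by rewrite ltnn eqxx/= mulr1 add0r.
  by rewrite -val_eqE /= in jk; rewrite (negbTE jk) mulr0 addr0.
have pvle k h : `|pv k h| <= `|h|.
  apply: norm_le_coord => // j; rewrite mxE; case: ifP => _; last by rewrite normr0.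
  exact: coord_le_norm.
suff key : u \o shift (x : [the normedModType R of 'rV[R]_n]) =
    cst (u x) + dotr (grad u x) +o_ (0 : [the normedModType R of 'rV[R]_n]) id.
  have dE := diff_unique (@dotr_continuous n (grad u x)) key.
  split; last by move=> v; rewrite dE.
  apply/diff_locallyP; rewrite dE; split; [exact: dotr_continuous|exact: key].
apply/eqaddoP => _/posnumP[e].
(* The error is spread over [n] coordinates; [n.+1] also covers [n = 0]. *)
pose e' : R := e%:num / n.+1%:R.
have e'0 : 0 < e' by rewrite divr_gt0.
have : \forall y \near x, forall i, `|partial i u x - partial i u y| < e'.
  apply: (@filter_forall _ _ (fun i y => `|partial i u x - partial i u y| < e') _
    (nbhs_filter x)) => i.
  by move/cvgrPdist_lt : (cu i x) => /(_ _ e'0).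
move=> /nbhs_ballP[r /= r0 Hr].
suff : \forall h \near (0 : 'rV[R]_n),
    `|u (h + x) - (u x + dotv h (grad u x))| <= e%:num * `|h| by [].
near=> h.
have hr : `|h| < r by near: h; exact: nbhs0_norm_lt.
have -> : u (h + x) - (u x + dotv h (grad u x)) =
   \sum_(k < n) (u (x + pv k.+1 h) - u (x + pv k h) - h 0 k * partial k u x).
  rewrite sumrB -(big_mkord xpredT (fun k => u (x + pv k.+1 h) - u (x + pv k h))).
  rewrite telescope_sumr // pv0 addr0 pvn opprD addrA [x + h]addrC.
  by congr (_ - _); apply: eq_bigr => k _; rewrite mxE.
apply: (@le_trans _ _ (\sum_(k < n) (e' * `|h|))).
  apply: (le_trans (ler_norm_sum _ _ _)); apply: ler_sum => k _.
  have [s sle E] := MVT_line (x + pv k h) (h 0 k) (du k).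
  rewrite pvS addrA E -mulrBr normrM mulrC.
  apply: ler_pM => //; last exact: coord_le_norm.
  rewrite distrC; apply/ltW/Hr; rewrite -ball_normE /=.
  rewrite -addrA opprD addrA subrr add0r normrN.
  apply: (le_lt_trans _ hr); apply: norm_le_coord => // j; rewrite !mxE /=.
  case: (eqVneq j k) => [->|jk].
    rewrite ltnn add0r mulr1; apply: (le_trans sle); exact: coord_le_norm.
  by rewrite mulr0 addr0; case: ifP => _; rewrite ?normr0 ?coord_le_norm.
rewrite sumr_const card_ord -mulr_natr mulrAC ler_wpM2r //.
rewrite /e' -mulrA ler_piMr // mulrC ler_pdivrMr // mul1r ler_nat.
exact: leqnSn.
Unshelve. all: by end_near. Qed.

Lemma continuous_rV (T : topologicalType) n (S : T -> 'rV[R]_n) :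
  (forall j, continuous (fun x => S x 0 j)) -> continuous S.
Proof.
move=> cS x; apply/cvgrPdist_le => e e0.
have : \forall y \near x, forall j, `|S x 0 j - S y 0 j| <= e.
  apply: (@filter_forall _ _ (fun j y => `|S x 0 j - S y 0 j| <= e) _
    (nbhs_filter x)) => j.
  by move/cvgrPdist_le : (cS j x) => /(_ _ e0).
apply: filter_app; near=> y => H.
apply: norm_le_coord => [|j]; first exact: ltW.
by rewrite !mxE.
Unshelve. all: by end_near. Qed.

Lemma derive_along n (V : normedModType R) (f : 'rV[R]_n -> V) (x v : 'rV[R]_n) :
  'D_v f x = 'D_1 (fun h : R => f (h *: v + x)) 0.
Proof.
rewrite /derive; set g1 := fun h => h^-1 *: _; set g2 := fun h => h^-1 *: _.
suff -> : g1 = g2 by [].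
by apply/funext => h; rewrite /g1 /g2 /= addr0 scale0r add0r [_%:A]mulr1.
Qed.

(** Chain rule with a map [S] that is only differentiated in the direction [v]:
    restricting everything to the line through [x] makes [S] a curve, for which
    the existence of one directional derivative is differentiability. *)
Lemma is_derive_comp_rV m n (S : 'rV[R]_m -> 'rV[R]_n) (h : 'rV[R]_n -> R)
    (x v : 'rV[R]_m) :
  (forall j, derivable (fun y => S y 0 j) x v) -> differentiable h (S x) ->
  is_derive x v (h \o S) ('d h (S x) (\row_j 'D_v (fun y => S y 0 j) x)).
Proof.
move=> dS dh.
pose c (t : R) := S (t *: v + x).
have c0 : c 0 = S x by rewrite /c scale0r add0r.
have dc : derivable c 0 1.
  apply/derivable_mxP => i j; rewrite ord1.
  exact: ((derivable1P (fun y => S y 0 j) x v).1 (dS j)).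
have dhc : differentiable (h \o c) (0 : R).
  by apply: differentiable_comp; [exact/derivable1_diffP|rewrite c0].
split; first by apply/derivable1P/derivable1_diffP; exact: dhc.
rewrite derive_along -[fun _ => _]/(h \o c) deriveE // diff_comp; last 2 first.
- exact/derivable1_diffP.
- by rewrite c0.
rewrite /= c0 -(@deriveE _ _ _ c); last exact/derivable1_diffP.
congr ('d _ _ _).
rewrite derive_mx //; apply/rowP => j; rewrite !mxE.
by rewrite [RHS]derive_along.
Qed.

Lemma partial_comp m n (S : 'rV[R]_m -> 'rV[R]_n) (h : 'rV[R]_n -> R) k x :
  (forall j, Ck 1 (fun y => S y 0 j)) -> Ck 1 h ->
  derivable (h \o S) x (delta_mx 0 k) /\
  partial k (h \o S) x =
    \sum_(j < n) partial k (fun y => S y 0 j) x * partial j h (S x).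
Proof.
move=> CS Ch; have [dh E] := Ck1_diff (S x) Ch.
have [] := @is_derive_comp_rV _ _ S h x (delta_mx 0 k) _ dh.
  by move=> j; have [_ /(_ k)[+ _]] := CS j; exact.
move=> d1 d2; split => //; rewrite /partial d2 E /dotv.
by apply: eq_bigr => j _; rewrite !mxE.
Qed.

Lemma Ck1_comp m n (S : 'rV[R]_m -> 'rV[R]_n) (h : 'rV[R]_n -> R) :
  (forall j, Ck 1 (fun y => S y 0 j)) -> Ck 1 h -> Ck 1 (h \o S).
Proof.
move=> CS Ch.
have cS : continuous S by apply: continuous_rV => j; case: (CS j).
split.
  by move=> x; apply: continuous_comp; [exact: cS|case: Ch => + _; exact].
move=> k; split; first by move=> x; case: (partial_comp k x CS Ch).
have -> : partial k (h \o S) = fun x =>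
   \sum_(j < n) partial k (fun y => S y 0 j) x * partial j h (S x).
  by apply/funext => x; case: (partial_comp k x CS Ch).
apply: continuous_sum_ord => j; apply: continuous_mul.
  by case: (CS j) => _ /(_ k)[].
move=> x; apply: continuous_comp; first exact: cS.
by case: Ch => _ /(_ j)[_ +]; exact.
Qed.

Lemma partialD n (u v : 'rV[R]_n -> R) k x : Ck 1 u -> Ck 1 v ->
  partial k (fun y => u y + v y) x = partial k u x + partial k v x.
Proof. by move=> [_ /(_ k)[du _]] [_ /(_ k)[dv _]]; exact: deriveD. Qed.

Lemma partialM n (u v : 'rV[R]_n -> R) k x : Ck 1 u -> Ck 1 v ->
  partial k (fun y => u y * v y) x = u x * partial k v x + v x * partial k u x.
Proof. by move=> [_ /(_ k)[du _]] [_ /(_ k)[dv _]]; exact: deriveM. Qed.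

Lemma partialN n (u : 'rV[R]_n -> R) k x : Ck 1 u ->
  partial k (fun y => - u y) x = - partial k u x.
Proof. by move=> [_ /(_ k)[du _]]; exact: deriveN. Qed.

Lemma Ck1_cst n (c : R) : Ck 1 (fun _ : 'rV[R]_n => c).
Proof.
split=> [|k]; first exact: continuous_cst.
split=> [x|]; first exact: derivable_cst.
rewrite (_ : partial _ _ = fun=> 0); first exact: continuous_cst.
by apply/funext => x; exact: derive_cst.
Qed.

Lemma partial_cst n (c : R) k x : partial k (fun _ : 'rV[R]_n => c) x = 0.
Proof. exact: derive_cst. Qed.

Lemma Ck1_add n (u v : 'rV[R]_n -> R) :
  Ck 1 u -> Ck 1 v -> Ck 1 (fun x => u x + v x).
Proof.
move=> Cu Cv; have [cu du] := Cu; have [cv dv] := Cv.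
split=> [|k]; first exact: continuous_add.
split=> [x|]; first by apply: derivableD; [case: (du k)|case: (dv k)].
rewrite (_ : partial _ _ = fun x => partial k u x + partial k v x).
  by apply: continuous_add; [case: (du k)|case: (dv k)].
by apply/funext => x; exact: partialD.
Qed.

Lemma Ck1_mul n (u v : 'rV[R]_n -> R) :
  Ck 1 u -> Ck 1 v -> Ck 1 (fun x => u x * v x).
Proof.
move=> Cu Cv; have [cu du] := Cu; have [cv dv] := Cv.
split=> [|k]; first exact: continuous_mul.
split=> [x|]; first by apply: derivableM; [case: (du k)|case: (dv k)].
rewrite (_ : partial _ _ = fun x => u x * partial k v x + v x * partial k u x).
  by apply: continuous_add; apply: continuous_mul => //; [case: (dv k)|case: (du k)].
by apply/funext => x; exact: partialM.
Qed.

Lemma Ck1_opp n (u : 'rV[R]_n -> R) : Ck 1 u -> Ck 1 (fun x => - u x).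
Proof.
move=> Cu; have := Ck1_mul (@Ck1_cst n (-1)) Cu.
by rewrite (_ : (fun x => -1 * u x) = (fun x => - u x))//; apply/funext => x; rewrite mulN1r.
Qed.

Lemma Ck1_sub n (u v : 'rV[R]_n -> R) :
  Ck 1 u -> Ck 1 v -> Ck 1 (fun x => u x - v x).
Proof. by move=> Cu Cv; apply: Ck1_add => //; exact: Ck1_opp. Qed.

Lemma Ck1_sum n m (F : 'I_m -> 'rV[R]_n -> R) :
  (forall i, Ck 1 (F i)) -> Ck 1 (fun x => \sum_(i < m) F i x).
Proof.
elim: m F => [|m IH] F CF.
  rewrite (_ : (fun _ => _) = fun=> 0); first exact: Ck1_cst.
  by apply/funext => x; rewrite big_ord0.
rewrite (_ : (fun _ => _) = fun x => F ord0 x + \sum_(i < m) F (lift ord0 i) x).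
  by apply: Ck1_add => //; exact: IH.
by apply/funext => x; rewrite big_ord_recl.
Qed.

Lemma partial_sum n m (F : 'I_m -> 'rV[R]_n -> R) k x :
  (forall i, Ck 1 (F i)) ->
  partial k (fun x => \sum_(i < m) F i x) x = \sum_(i < m) partial k (F i) x.
Proof.
elim: m F => [|m IH] F CF.
  rewrite (_ : (fun _ => _) = fun=> 0) ?partial_cst ?big_ord0 //.
  by apply/funext => y; rewrite big_ord0.
rewrite (_ : (fun _ => _) = fun x => F ord0 x + \sum_(i < m) F (lift ord0 i) x).
  by rewrite partialD ?IH ?big_ord_recl //; exact: Ck1_sum.
by apply/funext => y; rewrite big_ord_recl.
Qed.

Lemma partial_coord n (j k : 'I_n) (x : 'rV[R]_n) :
  is_derive x (delta_mx 0 k) (fun y : 'rV[R]_n => y 0 j) (j == k)%:R.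
Proof.
have d : derivable (fun y : 'rV[R]_n => y 0 j) x (delta_mx 0 k).
  exact/diff_derivable/differentiable_coord.
split => //; apply: cvg_lim => //.
have E : {near 0^', (fun _ : R => (j == k)%:R : R) =1
    (fun h : R => h^-1 *: (((fun y : 'rV[R]_n => y 0 j) \o shift x)
       (h *: delta_mx 0 k) - x 0 j))}.
  near=> h; rewrite /= !mxE eqxx/= addrK [_ *: _]mulrA mulVf ?mul1r //.
  by near: h; exact: nbhs_dnbhs_neq.
apply: cvg_trans (near_eq_cvg E) _; exact: cvg_cst.
Unshelve. all: by end_near. Qed.

Lemma Ck1_coord n (j : 'I_n) : Ck 1 (fun x : 'rV[R]_n => x 0 j).
Proof.
split=> [|k]; first exact: continuous_coord.
split=> [x|]; first by case: (partial_coord j k x).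
rewrite (_ : partial _ _ = fun=> (j == k)%:R); first exact: continuous_cst.
by apply/funext => x; case: (partial_coord j k x).
Qed.

(** Only the values taken by [u] matter for [B], which lets this lemma cover the
    square root and the inverse on the positive half-line. *)
Lemma Ck1_comp1 n (B : R -> R) (u : 'rV[R]_n -> R) :
  (forall x, derivable B (u x) 1) ->
  (forall x, {for u x, continuous (derive1 B)}) -> Ck 1 u ->
  Ck 1 (fun x => B (u x)) /\
  forall k x, partial k (fun x => B (u x)) x = derive1 B (u x) * partial k u x.
Proof.
move=> dB cB Cu; have [cu du] := Cu.
have dB1 x : differentiable B (u x) by exact/derivable1_diffP.
have H k x : is_derive x (delta_mx 0 k) (B \o u) (derive1 B (u x) * partial k u x).
  pose c (t : R) := u (t *: delta_mx 0 k + x).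
  have c0 : c 0 = u x by rewrite /c scale0r add0r.
  have dc : derivable c 0 1.
    exact: ((derivable1P u x (delta_mx 0 k)).1 (proj1 (du k) x)).
  have dhc : differentiable (B \o c) (0 : R).
    by apply: differentiable_comp; [exact/derivable1_diffP|rewrite c0].
  split; first exact: ((derivable1P (B \o u) x (delta_mx 0 k)).2
    ((derivable1_diffP _ _).2 dhc)).
  rewrite derive_along -[fun _ => _]/(B \o c) -derive1E.
  have dBc : derivable B (c 0) 1 by rewrite c0; exact: dB.
  rewrite (derive1_comp dc dBc) c0 (derive1E c) /partial.
  by rewrite (derive_along u).
have E k : partial k (B \o u) = fun x => derive1 B (u x) * partial k u x.
  by apply/funext => x; have [] := H k x.
split; last by move=> k x; rewrite -[partial k _ x]/(partial k (B \o u) x) E.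
split=> [x|k].
  apply: (@continuous_comp _ _ _ u B); first exact: cu.
  exact: differentiable_continuous.
split=> [x|]; first by have [] := H k x.
rewrite -[partial k _]/(partial k (B \o u)) E; apply: continuous_mul; last by case: (du k).
by move=> x; apply: (@continuous_comp _ _ _ u (derive1 B)); [exact: cu|exact: cB].
Qed.

Lemma near_eq_continuous_at (f g : R -> R) (a : R) :
  (\forall t \near a, f t = g t) -> {for a, continuous g} -> {for a, continuous f}.
Proof.
move=> fg cg; have fa : f a = g a by exact: nbhs_singleton fg.
rewrite /prop_for /continuous_at fa; apply: cvg_trans cg.
by apply: near_eq_cvg; apply: filterS fg => t ->.
Qed.

Lemma Ck1_sqrt n (u : 'rV[R]_n -> R) : (forall x, 0 < u x) -> Ck 1 u ->
  Ck 1 (fun x => Num.sqrt (u x)) /\ forall k x,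
  partial k (fun x => Num.sqrt (u x)) x = (2 * Num.sqrt (u x))^-1 * partial k u x.
Proof.
move=> u0 Cu.
have D (t : R) : 0 < t -> derive1 Num.sqrt t = (2 * Num.sqrt t)^-1.
  by move=> t0; rewrite derive1E derive_sqrt.
have [//|x|C E] := @Ck1_comp1 _ Num.sqrt u _ _ Cu.
- by move=> x; have [] := is_derive1_sqrt (u0 x).
- apply: (@near_eq_continuous_at _ (fun t => (2 * Num.sqrt t)^-1)).
    near=> t; apply: D; near: t; exact: lt_nbhsr.
  apply: continuousV; first by rewrite mulf_neq0 // gt_eqF // sqrtr_gt0.
  have H : continuous (fun t : R => 2 * Num.sqrt t).
    by apply: continuous_mul; [exact: continuous_cst|exact: sqrt_continuous].
  exact: H.
- by split=> // k x; rewrite E D.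
Unshelve. all: by end_near. Qed.

Lemma Ck1_inv n (u : 'rV[R]_n -> R) : (forall x, 0 < u x) -> Ck 1 u ->
  Ck 1 (fun x => (u x)^-1) /\ forall k x,
  partial k (fun x => (u x)^-1) x = - (u x) ^- 2 * partial k u x.
Proof.
move=> u0 Cu.
have n0 (t : R) : 0 < t -> t != 0 by move=> /gt_eqF ->.
have D (t : R) : 0 < t -> derive1 (fun t : R => t^-1) t = - t ^- 2.
  move=> t0; rewrite derive1E.
  rewrite (@deriveV _ _ (id : R -> R) t 1 (n0 t t0) (@derivable_id _ _ _ _)).
  by rewrite derive_id [_ *: _]mulr1.
have [x|x|C E] := @Ck1_comp1 _ (fun t : R => t^-1) u _ _ Cu.
- exact: (@derivableV _ _ (id : R -> R) (u x) 1 (n0 _ (u0 x)) (@derivable_id _ _ _ _)).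
- apply: (@near_eq_continuous_at _ (fun t => - t ^- 2)).
    near=> t; apply: D; near: t; exact: lt_nbhsr.
  apply: cvgN; apply: (@continuousV _ _ (fun t : R => t ^+ 2)); first by rewrite expf_neq0 // n0.
  exact: exprn_continuous.
- by split=> // k x; rewrite E D.
Unshelve. all: by end_near. Qed.

End Calculus.

(** * Lebesgue measure on R^n *)

Section LebesgueRn.
Variable R : realType.

Lemma unvecK n : cancel (@unvec R n) (@vec R n).
Proof. by move=> x; apply/rowP => i; rewrite mxE tnth_mktuple. Qed.

Lemma ler_between (x y : R) : x < y -> exists q : rat, x < (ratr q : R) < y.
Proof. by move=> /rat_in_itvoo[q]; rewrite in_itv/= => ?; exists q. Qed.

(** The sigma-algebra on tuples is a product one; an open set is a countable
    union of boxes with rational centres and radii. *)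
Lemma open_measurable_vec n (O : set 'rV[R]_n) :
  open O -> measurable (@vec R n @^-1` O).
Proof.
move=> oO.
pose box (q : {ffun 'I_n -> rat} * rat) : set (Rtuple R n) :=
  [set t | forall i, `|tnth t i - ratr (q.1 i)| < ratr q.2].
pose D : set ({ffun 'I_n -> rat} * rat) :=
  [set q | box q `<=` @vec R n @^-1` O].
have mbox q : measurable (box q).
  rewrite (_ : box q = \bigcap_(i in [set: 'I_n])
     ((fun t : Rtuple R n => tnth t i) @^-1` [set x | `|x - ratr (q.1 i)| < ratr q.2])).
    apply: fin_bigcap_measurable => [|i _]; first exact: finite_finset.
    rewrite -[X in measurable X]setTI; apply: measurable_tnth => //.
    apply: open_measurable; rewrite (_ : [set x | _] = ball (ratr (q.1 i) : R) (ratr q.2)).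
      exact: ball_open.
    by rewrite -ball_normE; apply/seteqP; split=> x /=; rewrite distrC.
  by apply/seteqP; split => [t H i _|t H i]; [exact: H|exact: H].
rewrite (_ : _ @^-1` _ = \bigcup_(q in D) box q).
  rewrite bigcup_mkcond; apply: countable_bigcupT_measurable; first exact: countableP.
  by move=> q; case: ifP => _; [exact: mbox|exact: measurable0].
apply/seteqP; split=> [t /= tO|t [q Dq]]; last exact: Dq.
have := oO; rewrite openE => /(_ _ tO) /nbhs_ballP[e /= e0 He].
have [r /andP[r0 re]] : exists q : rat, 0 < (ratr q : R) < e / 2.
  by apply: ler_between; rewrite divr_gt0.
have H i : exists q : rat, tnth t i - ratr r < (ratr q : R) < tnth t i + ratr r.
  by apply: ler_between; rewrite ltrBlDr -addrA ltrDl addr_gt0.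
have [c Hc] := choice H.
exists ([ffun i => c i], r).
  move=> s /= Hs; apply: He; rewrite -ball_normE /=.
  apply: (@le_lt_trans _ _ (ratr r + ratr r)).
    apply: norm_le_coord => [|j]; first by rewrite addr_ge0 // ltW.
    rewrite !mxE -(subrKA (ratr (c j))).
    apply: (le_trans (ler_normD _ _)); apply: lerD.
      have /andP[h1 h2] := Hc j.
      by rewrite ler_norml; apply/andP; split; lra.
    by have := Hs j; rewrite ffunE distrC => /ltW.
  by move: re; lra.
move=> i /=; rewrite ffunE.
have /andP[h1 h2] := Hc i.
by rewrite ltr_norml; apply/andP; split; lra.
Qed.

Lemma closed_measurable_vec n (C : set 'rV[R]_n) :
  closed C -> measurable (@vec R n @^-1` C).
Proof.
move=> /closed_openC/open_measurable_vec/measurableC.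
by rewrite -preimage_setC setCK.
Qed.

Lemma within_continuous_measurable n (D : set 'rV[R]_n) (u : 'rV[R]_n -> R) :
  measurable (@vec R n @^-1` D) -> {within D, continuous u} ->
  measurable_fun (@vec R n @^-1` D) (u \o @vec R n).
Proof.
move=> mD cu; apply: (measurability _ (RGenOpens.measurableE R)).
move=> _ [_ [a [b ->] <-]].
have /continuousP/(_ _ (@interval_open _ (BRight a) (BLeft b) isT isT)) := cu.
move=> /open_subspaceP[V oV VD].
rewrite (_ : _ `&` _ = @vec R n @^-1` V `&` @vec R n @^-1` D).
  by apply: measurableI => //; exact: open_measurable_vec.
by rewrite -preimage_setI VD preimage_setI setIC.
Qed.

Lemma continuous_measurable n (u : 'rV[R]_n -> R) : continuous u ->
  measurable_fun setT (u \o @vec R n).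
Proof.
move=> cu; rewrite -(preimage_setT (@vec R n)).
apply: within_continuous_measurable; first by rewrite preimage_setT.
exact: continuous_subspaceT.
Qed.

(** Measurable, bounded, and vanishing outside a ball; one constant [M] serves as
    bound and as radius. This is the class of integrands for which integrability,
    Fubini and multiplication by a cut-off need no further discussion. *)
Definition nice n (f : 'rV[R]_n -> R) : Prop :=
  measurable_fun setT (f \o @vec R n) /\
  exists M : R, forall x, `|f x| <= M /\ (M < `|x| -> f x = 0).

Definition Int n (f : 'rV[R]_n -> R) : R := intg (leb R n) setT f.

Lemma measurable_vec_ball n (M : R) :
  measurable (@vec R n @^-1` [set x | `|x| <= M]).
Proof.
apply: closed_measurable_vec.
rewrite (_ : [set x : 'rV[R]_n | _] = (fun x : 'rV[R]_n => `|x|) @^-1` [set t | t <= M]) //.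
by apply: preimage_closed => [x _|]; [exact: norm_continuous|exact: closed_le].
Qed.

Lemma leb_ball_lty n (M : R) :
  (leb R n (@vec R n @^-1` [set x | (`|x| <= M)%R]) < +oo)%E.
Proof.
elim: n => [|n IH].
  by rewrite /= diracE ltry.
rewrite -[leb R n.+1 _]/((@lebesgue_measure R \x leb R n)%E
   (@consp R n @^-1` (@vec R n.+1 @^-1` [set x | (`|x| <= M)%R]))).
apply: (@le_lt_trans _ _ ((@lebesgue_measure R \x leb R n)%E
   (`[- M, M]%classic `*` (@vec R n @^-1` [set x | (`|x| <= M)%R])))).
  apply: le_measure; rewrite ?inE.
  - rewrite -[X in measurable X]setTI; apply: measurable_cons => //.
    exact: measurable_vec_ball.
  - by apply: measurableX => //; exact: measurable_vec_ball.
  - move=> [t y] /= H; have M0 : 0 <= M by exact: le_trans H.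
    have C j : `|tnth (consp (t, y)) j| <= M.
      have -> : tnth (consp (t, y)) j = @vec R n.+1 (consp (t, y)) 0 j by rewrite mxE.
      by apply: le_trans H; exact: coord_le_norm.
    split; first by have := C ord0; rewrite in_itv/= ler_norml.
    apply: norm_le_coord => // j; rewrite mxE.
    by have := C (lift ord0 j); rewrite tnthS.
rewrite product_measure1E //; last exact: measurable_vec_ball.
rewrite lte_mul_pinfty //= ?lebesgue_measure_itv //=.
by case: ifP => _ //; rewrite -EFinB fin_numE.
Qed.

Lemma nice_integrable n (f : 'rV[R]_n -> R) : nice f ->
  (leb R n).-integrable setT (EFin \o (f \o @vec R n)).
Proof.
move=> [mf [M HM]].
set B := @vec R n @^-1` [set x | `|x| <= M].
have mB : measurable B by exact: measurable_vec_ball.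
have fB : EFin \o (f \o @vec R n) = (EFin \o (f \o @vec R n)) \_ B.
  apply/funext => t; rewrite patchE; case: (boolP (t \in B)) => //.
  rewrite notin_setE /B /= => /negP; rewrite -ltNge => H.
  by have [_ /(_ H) ->] := HM (@vec R n t).
rewrite fB -integrable_mkcond //.
apply: measurable_bounded_integrable => //.
- exact: leb_ball_lty.
- exact: measurable_funS mf.
- exists M; split; first exact: num_real.
  by move=> N MN t _ /=; have [le0 _] := HM (@vec R n t); rewrite (le_trans le0) // ltW.
Qed.

Definition insT n (k : 'I_n.+1) (p : measurableTypeR R * Rtuple R n) : Rtuple R n.+1 :=
  unvec (ins k p.1 (@vec R n p.2)).

Lemma measurable_insT n (k : 'I_n.+1) : measurable_fun setT (insT k).
Proof.
apply/measurable_fun_tnthP => j.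
rewrite (_ : _ \o _ = if unlift k j is Some l then (fun p => tnth p.2 l) else fst).
  case: (unlift k j) => [l|]; last exact: measurable_fst.
  apply: (@measurableT_comp _ _ _ _ _ _ (fun x : Rtuple R n => tnth x l) _ snd) => //.
  exact: measurable_tnth.
apply/funext => p; rewrite /= /insT tnth_mktuple mxE.
by case: (unlift k j) => [l|] //; rewrite mxE.
Qed.

Lemma insT0 n (p : measurableTypeR R * Rtuple R n) : insT ord0 p = consp p.
Proof.
apply: eq_from_tnth => j; rewrite tnth_mktuple mxE.
case: (unliftP ord0 j) => [l ->|->]; last by [].
by rewrite mxE tnthS.
Qed.

Lemma insTS n (k : 'I_n.+1) (y0 t : R) (w : Rtuple R n) :
  insT (lift ord0 k) (t, consp (y0, w)) = consp (y0, insT k (t, w)).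
Proof.
apply: eq_from_tnth => j; rewrite tnth_mktuple mxE /=.
case: (unliftP ord0 j) => [l ->|->]; rewrite ?tnthS; last first.
  have -> : (ord0 : 'I_n.+2) = lift (lift ord0 k) ord0 by apply: val_inj.
  by rewrite liftK mxE.
rewrite [RHS]tnth_mktuple mxE.
case: (unliftP k l) => [m ->|->]; last by rewrite unlift_none.
have -> : lift ord0 (lift k m) = lift (lift ord0 k) (lift ord0 m).
  by apply: val_inj; rewrite /= /bump /= !add1n ltnS; lia.
by rewrite liftK !mxE tnthS.
Qed.

Lemma leb_consp n (f : Rtuple R n.+1 -> \bar R) :
  measurable_fun setT f -> (forall t, 0 <= f t)%E ->
  (\int[leb R n.+1]_t f t =
   \int[(@lebesgue_measure R \x leb R n)%E]_p f (consp p))%E.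
Proof.
move=> mf f0.
rewrite -[LHS]/(\int[pushforward (@lebesgue_measure R \x leb R n)%E (@consp R n)]_y f y)%E.
by rewrite ge0_integral_pushforward //; exact: measurable_cons.
Qed.

(** [leb] is built by adding coordinates at the front. By induction, any
    coordinate [k] can play that role: swap [k] with the first one by Tonelli. *)
Lemma leb_insT n (k : 'I_n.+1) (f : Rtuple R n.+1 -> \bar R) :
  measurable_fun setT f -> (forall t, 0 <= f t)%E ->
  (\int[leb R n.+1]_t f t =
   \int[(@lebesgue_measure R \x leb R n)%E]_p f (insT k p))%E.
Proof.
elim: n k f => [|n IH] k f mf f0.
  have -> : k = ord0 by rewrite ord1.
  rewrite leb_consp //; apply: eq_integral => p _; by rewrite insT0.
case: (unliftP ord0 k) => [j ->|->]; last first.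
  rewrite leb_consp //; apply: eq_integral => p _; by rewrite insT0.
have mcons : measurable_fun setT (@consp R n.+1) by exact: measurable_cons.
have mg : measurable_fun setT (f \o @consp R n.+1) by exact: measurableT_comp.
rewrite leb_consp //.
rewrite (fubini_tonelli1 _ mg); last by move=> p; exact: f0.
pose h (p : (measurableTypeR R * measurableTypeR R) * Rtuple R n) : \bar R := f (consp (p.1.1, insT j (p.1.2, p.2))).
have mh : measurable_fun setT h.
  apply: (measurableT_comp mg); apply: measurable_fun_pair => /=.
    by apply: measurableT_comp => //; exact: measurable_fst.
  apply: (measurableT_comp (measurable_insT j)).
  by apply: measurable_fun_pair => /=; [apply: measurableT_comp|].
transitivity (\int[lebesgue_measure]_y0 \int[lebesgue_measure]_t \int[leb R n]_w h ((y0, t), w))%E.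
  apply: eq_integral => y0 _; rewrite /fubini_F.
  rewrite (IH j (fun z => f (consp (y0, z)))) //; last first.
    by apply: (measurableT_comp mg); exact: measurable_fun_pair.
  rewrite (@fubini_tonelli1 _ _ _ _ _ _ _ (fun p => f (consp (y0, insT j p)))) //.
  apply: (measurableT_comp mg); apply: measurable_fun_pair => //.
  exact: measurable_insT.
pose H (p : measurableTypeR R * measurableTypeR R) := (\int[leb R n]_w h (p, w))%E.
have mH : measurable_fun setT H 
  by apply: (measurable_fun_fubini_tonelli_F h mh) => p; exact: f0.
rewrite (fubini_tonelli H) //; last by move=> x; apply: integral_ge0 => w _; exact: f0.
rewrite (fubini_tonelli1 (fun p => f (insT (lift ord0 j) p))) //; last first.
  by apply: measurableT_comp => //; exact: measurable_insT.
apply: eq_integral => t _; rewrite /fubini_F.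
rewrite leb_consp //; last first.
  apply: (measurableT_comp mf); apply: (measurableT_comp (measurable_insT _)).
  exact: measurable_fun_pair.
rewrite (@fubini_tonelli1 _ _ _ _ _ _ _
  (fun p => f (insT (lift ord0 j) (t, consp p)))) //=; last first.
  apply: (measurableT_comp mf); apply: (measurableT_comp (measurable_insT _)).
  apply: measurable_fun_pair => //; exact: measurable_cons.
apply: eq_integral => y0 _; rewrite /fubini_F; apply: eq_integral => w _ /=.
by rewrite insTS.
Qed.

End LebesgueRn.

(** * Slicing an integral along a coordinate *)

Section FubiniRn.
Variable R : realType.

HB.instance Definition _ n (k : 'I_n.+1) :=
  isMeasurableFun.Build _ _ _ _ (@insT R n k) (@measurable_insT R n k).

Lemma leb_insT_pushforward n (k : 'I_n.+1) (A : set (Rtuple R n.+1)) : measurable A ->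
  leb R n.+1 A = pushforward (@lebesgue_measure R \x leb R n)%E (insT k) A.
Proof.
move=> mA; rewrite /pushforward.
have := @leb_insT _ _ k (fun t => (\1_A t)%:E) _ _.
rewrite integral_indic // setIT => ->; last 2 first.
- exact/measurable_EFinP.
- by move=> t; rewrite lee_fin.
rewrite (eq_integral (fun p => (\1_(insT k @^-1` A) p)%:E)) //.
rewrite integral_indic // ?setIT //.
by rewrite -[X in measurable X]setTI; exact: measurable_insT.
Qed.

Lemma nice1_integrable (g : R -> R) (M : R) : measurable_fun setT g ->
  (forall t, `|g t| <= M /\ (M < `|t| -> g t = 0)) ->
  (@lebesgue_measure R).-integrable setT (EFin \o g).
Proof.
move=> mg HM.
have gB : EFin \o g = (EFin \o g) \_ `[- M, M].
  apply/funext => t; rewrite patchE; case: (boolP (t \in _)) => //.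
  rewrite notin_setE /= in_itv/= => /negP; rewrite -ler_norml -ltNge => H.
  by have [_ /(_ H) ->] := HM t.
rewrite gB -integrable_mkcond //.
apply: measurable_bounded_integrable => //.
- rewrite /= lebesgue_measure_itv /=; case: ifP => _ //.
  by rewrite -EFinB ltry.
- exact: measurable_funS mg.
- exists M; split; first exact: num_real.
  by move=> N MN t _ /=; have [le0 _] := HM t; rewrite (le_trans le0) // ltW.
Qed.

Lemma norm_ins n (k : 'I_n.+1) (t : R) (y : 'rV[R]_n) :
  `|t| <= `|ins k t y| /\ `|y| <= `|ins k t y|.
Proof.
split.
  have E : ins k t y 0 k = t by rewrite mxE unlift_none.
  by rewrite -{1}E; exact: coord_le_norm.
apply: norm_le_coord => // j.
have -> : y 0 j = ins k t y 0 (lift k j) by rewrite mxE liftK.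
exact: coord_le_norm.
Qed.

Lemma measurable_slice n (k : 'I_n.+1) (f : 'rV[R]_n.+1 -> R) (y : 'rV[R]_n) :
  measurable_fun setT (f \o @vec R n.+1) ->
  measurable_fun setT (fun t : R => f (ins k t y)).
Proof.
move=> mf.
rewrite (_ : (fun t => _) = (f \o @vec R n.+1) \o
    (fun t : R => insT k (t, unvec y))).
  apply: (measurableT_comp mf); apply: (measurableT_comp (measurable_insT k)).
  exact: measurable_fun_pair.
by apply/funext => t; rewrite /= /insT /= !unvecK.
Qed.

Lemma nice_slice n (k : 'I_n.+1) (f : 'rV[R]_n.+1 -> R) (y : 'rV[R]_n) : nice f ->
  (@lebesgue_measure R).-integrable setT (EFin \o (fun t : R => f (ins k t y))).
Proof.
move=> [mf [M HM]]; apply: (@nice1_integrable _ M); first exact: measurable_slice.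
move=> t; have [h1 h2] := HM (ins k t y); split => // Mt; apply: h2.
by apply: (lt_le_trans Mt); case: (norm_ins k t y).
Qed.

(** Fubini in the form used below: first integrate in the [k]-th coordinate. *)
Lemma Int_ins n (k : 'I_n.+1) (f : 'rV[R]_n.+1 -> R) : nice f ->
  Int f = Int (fun y => \int[@lebesgue_measure R]_t f (ins k t y)).
Proof.
move=> nf; have [mf _] := nf.
have fi := nice_integrable nf.
have mef : measurable_fun setT (EFin \o (f \o @vec R n.+1)) by exact/measurable_EFinP.
rewrite /Int /intg /Rintegral !preimage_setT.
congr fine.
rewrite (eq_measure_integral
   (pushforward (@lebesgue_measure R \x leb R n)%E (insT k))); last first.
  by move=> A mA _; exact: leb_insT_pushforward.
have gi : (@lebesgue_measure R \x leb R n)%E.-integrable setT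
    ((EFin \o (f \o @vec R n.+1)) \o insT k).
  apply/integrableP; split.
    by apply: (measurableT_comp mef); exact: measurable_insT.
  move/integrableP : fi => [_]; rewrite (leb_insT k) //.
  exact: measurableT_comp.
rewrite (@integral_pushforward _ _ _ _ _ _ (measurable_insT k) _ setT _ mef gi measurableT).
rewrite preimage_setT -integral21_prod_meas1 //.
apply: eq_integral => w _; rewrite /fubini_G /= /insT.
under eq_integral do rewrite /= unvecK.
rewrite fineK //; apply: integrable_fin_num => //.
exact: nice_slice.
Qed.

End FubiniRn.

(** * Compactly supported integrands *)

Section CompactlySupported.
Variable R : realType.

Lemma compact_norm_bound (T : topologicalType) (K : set T) (u : T -> R) :
  compact K -> {within K, continuous u} ->
  exists M : R, forall x, K x -> `|u x| <= M.
Proof.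
move=> cK cu; have cI : compact (u @` K) by exact: continuous_compact.
have [M [Mr H]] := compact_bounded cI.
exists (M + 1) => x Kx; apply: (H (M + 1)); first by rewrite ltrDl.
by exists x.
Qed.

Lemma compact_closed_ball_rV n (x : 'rV[R]_n) (r : R) :
  compact [set y : 'rV[R]_n | `|x - y| <= r].
Proof.
case: n x => [|n] x.
  rewrite (_ : [set y | _] = if `|x - x| <= r then [set x] else set0).
    by case: ifP => _; [exact: compact_set1|exact: compact0].
  have E (y : 'rV[R]_0) : y = x by apply/rowP => -[].
  by apply/seteqP; split => y /=; rewrite [y]E; case: ifP.
apply: bounded_closed_compact.
  exists (`|x| + r); split; first exact: num_real.
  move=> M rM y /= yr; rewrite (le_trans _ (ltW rM)) //.
  by rewrite -[y in leLHS](subKr x) (le_trans (ler_normB _ _)) // lerD2l.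
rewrite (_ : [set y | _] = (fun y : 'rV[R]_n.+1 => `|x - y|) @^-1` [set t | t <= r]) //.
apply: preimage_closed => [y _|]; last exact: closed_le.
apply: (@continuous_comp _ _ _ (fun y : 'rV[R]_n.+1 => x - y) (fun z => `|z|)).
  move: y; apply: continuous_rV => j.
  rewrite (_ : (fun y => _) = fun y : 'rV[R]_n.+1 => x 0 j + - y 0 j).
    apply: continuous_add; first exact: continuous_cst.
    by apply: continuous_opp; exact: continuous_coord.
  by apply/funext => y; rewrite !mxE.
exact: norm_continuous.
Qed.

Lemma continuous_bounded_ball n (u : 'rV[R]_n -> R) (M : R) : continuous u ->
  exists C : R, forall x, `|x| <= M -> `|u x| <= C.
Proof.
move=> cu.
have [C HC] := compact_norm_bound (@compact_closed_ball_rV n 0 M)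
  (continuous_subspaceT cu).
by exists C => x xM; apply: HC; rewrite /= sub0r normrN.
Qed.

(** Since [f] vanishes outside a ball, local boundedness of [g] suffices. *)
Lemma nice_mul n (f g : 'rV[R]_n -> R) : nice f ->
  measurable_fun setT (g \o @vec R n) ->
  (forall M, exists C : R, forall x, `|x| <= M -> `|g x| <= C) ->
  nice (fun x => f x * g x).
Proof.
move=> [mf [M HM]] mg bg; split; first exact: measurable_funM.
have [C HC] := bg M.
exists (Num.max M (M * C)) => x.
have M0 : 0 <= M by have [h _] := HM 0; exact: le_trans h.
have H : M < `|x| -> f x * g x = 0 by move=> Mx; have [_ ->] := HM x; rewrite ?mul0r.
split; last by rewrite gt_max => /andP[/H].
rewrite le_max; have [Mx|xM] := ltP M `|x|; first by rewrite H // normr0 M0.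
apply/orP; right; rewrite normrM; apply: ler_pM => //; last exact: HC.
by have [] := HM x.
Qed.

Lemma nice_mul_continuous n (f g : 'rV[R]_n -> R) : nice f -> continuous g ->
  nice (fun x => f x * g x).
Proof.
move=> nf cg; apply: nice_mul => //; first exact: continuous_measurable.
by move=> M; exact: continuous_bounded_ball.
Qed.

Lemma nice_mul_indic n (f : 'rV[R]_n -> R) (A : set 'rV[R]_n) : nice f ->
  measurable (@vec R n @^-1` A) -> nice (fun x => f x * \1_A x).
Proof.
move=> nf mA; apply: nice_mul => //.
  by rewrite (_ : _ \o _ = \1_(@vec R n @^-1` A)).
move=> M; exists 1 => x _; rewrite indicE.
by case: (x \in A); rewrite ?normr1 ?normr0.
Qed.

Lemma nice_continuous n (f : 'rV[R]_n -> R) (M : R) : continuous f ->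
  (forall x, M < `|x| -> f x = 0) -> nice f.
Proof.
move=> cf H; split; first exact: continuous_measurable.
have [C HC] := continuous_bounded_ball M cf.
exists (Num.max `|M| `|C|) => x; split; last first.
  by rewrite gt_max => /andP[Mx _]; apply: H; exact: le_lt_trans (ler_norm _) Mx.
have [Mx|xM] := ltP M `|x|; first by rewrite H // normr0 le_max normr_ge0.
by rewrite le_max; apply/orP; right; rewrite (le_trans (HC _ xM)) // ler_norm.
Qed.

Lemma nice_add n (f g : 'rV[R]_n -> R) : nice f -> nice g ->
  nice (fun x => f x + g x).
Proof.
move=> [mf [M HM]] [mg [N HN]]; split; first exact: measurable_funD.
exists (M + N) => x; have [f1 f2] := HM x; have [g1 g2] := HN x.
have M0 : 0 <= M by exact: le_trans f1.
have N0 : 0 <= N by exact: le_trans g1.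
split; first by rewrite (le_trans (ler_normD _ _)) // lerD.
move=> MN; rewrite f2 ?g2 ?addr0 //; apply: le_lt_trans MN.
  by rewrite lerDr.
by rewrite lerDl.
Qed.

Lemma Int_add n (f g : 'rV[R]_n -> R) : nice f -> nice g ->
  Int (fun x => f x + g x) = Int f + Int g.
Proof.
move=> nf ng; rewrite /Int /intg preimage_setT.
by apply: RintegralD => //; exact: nice_integrable.
Qed.

Lemma Int_cst_mul n (c : R) (f : 'rV[R]_n -> R) : nice f ->
  Int (fun x => c * f x) = c * Int f.
Proof.
move=> nf; rewrite /Int /intg preimage_setT.
by apply: RintegralZl => //; exact: nice_integrable.
Qed.

Lemma Int0 n : Int (fun _ : 'rV[R]_n => 0) = 0.
Proof.
by rewrite /Int /intg /Rintegral integral0_eq.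
Qed.

Lemma near_eq_partial n (u v : 'rV[R]_n -> R) k (x : 'rV[R]_n) :
  (\forall y \near x, u y = v y) -> partial k u x = partial k v x.
Proof. by move=> H; exact: near_eq_derive. Qed.

Lemma partial_eq0 n (u : 'rV[R]_n -> R) k (M : R) :
  (forall x, M < `|x| -> u x = 0) -> forall x, M < `|x| -> partial k u x = 0.
Proof.
move=> H x Mx.
rewrite (@near_eq_partial _ u (fun=> 0)) ?partial_cst //.
have /cvgrPdist_lt/(_ (`|x| - M)) := @norm_continuous _ _ x.
rewrite subr_gt0 => /(_ Mx); apply: filter_app; near=> y => Hy; apply: H.
by move: Hy => /ltr_distlBl; rewrite opprB addrCA subrr addr0.
Unshelve. all: by end_near. Qed.

(** Fundamental theorem of calculus on a half-line for a compactly supported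
    primitive, with the half-line encoded as a cut-off of the integrand. *)
Lemma FTC_lt (g g' : R -> R) (M c : R) :
  (forall t : R, is_derive t (1 : R) g (g' t)) -> continuous g' ->
  (forall t, M < `|t| -> g t = 0 /\ g' t = 0) ->
  \int[@lebesgue_measure R]_t (if t < c then g' t else 0) = g c.
Proof.
move=> dg cg' H.
have cg : continuous g.
  by move=> t; apply/differentiable_continuous/derivable1_diffP; case: (dg t).
(* A left endpoint that is below [c] and outside the support. *)
pose a : R := - (`|M| + `|c| + 1).
have ac : a < c.
  rewrite /a; have := ler_norm (- c); rewrite normrN.
  by have := normr_ge0 M; lra.
have aM : a < - M.
  rewrite /a; have := ler_norm M; have := normr_ge0 c; lra.
have big t : t <= a -> M < `|t|.
  by move=> ta; rewrite -normrN (lt_le_trans _ (ler_norm (- t))) //; lra.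
have -> : (fun t => if t < c then g' t else 0) = g' \_ `[a, c[.
  apply/funext => t; rewrite patchE mem_setE in_itv /=.
  case: (ltP t c) => tc; rewrite ?andbF ?andbT //.
  by have [//|ta] := leP a t; have [_ ->] := H t (big _ (ltW ta)).
have ci (A : set R) : {within A, continuous g'} by exact: continuous_subspaceT.
have ii : (@lebesgue_measure R).-integrable `[a, c] (EFin \o g').
  by apply: continuous_compact_integrable => //; exact: segment_compact.
rewrite -Rintegral_mkcond Rintegral_itv_bndo_bndc; last first.
  apply: integrableS ii => //.
  by apply: subset_itvl; rewrite bnd_simp.
rewrite /Rintegral (@continuous_FTC2 _ g' g) //.
- by have [-> _] := H a (big _ (lexx _)); rewrite sube0.
- split; [by move=> t _; case: (dg t)|apply: cvg_at_right_filter; exact: cg|apply: cvg_at_left_filter; exact: cg].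
- by move=> t _; rewrite derive1E; case: (dg t).
Qed.

Lemma FTC_gt (g g' : R -> R) (M c : R) :
  (forall t : R, is_derive t (1 : R) g (g' t)) -> continuous g' ->
  (forall t, M < `|t| -> g t = 0 /\ g' t = 0) ->
  \int[@lebesgue_measure R]_t (if c < t then g' t else 0) = - g c.
Proof.
move=> dg cg' H.
have cg : continuous g.
  by move=> t; apply/differentiable_continuous/derivable1_diffP; case: (dg t).
pose b : R := `|M| + `|c| + 1.
have cb : c < b.
  by rewrite /b; have := ler_norm c; have := normr_ge0 M; lra.
have big t : b <= t -> M < `|t|.
  move=> tb; rewrite (lt_le_trans _ (ler_norm t)) //.
  by move: tb; rewrite /b; have := ler_norm M; have := normr_ge0 c; lra.
have -> : (fun t => if c < t then g' t else 0) = g' \_ `]c, b].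
  apply/funext => t; rewrite patchE mem_setE in_itv /=.
  case: (ltP c t) => tc //=.
  by have [//|ta] := leP t b; have [_ ->] := H t (big _ (ltW ta)).
have ci (A : set R) : {within A, continuous g'} by exact: continuous_subspaceT.
have ii : (@lebesgue_measure R).-integrable `[c, b] (EFin \o g').
  by apply: continuous_compact_integrable => //; exact: segment_compact.
rewrite -Rintegral_mkcond Rintegral_itv_obnd_cbnd; last first.
  apply: integrableS ii => //.
  by apply: subset_itvr; rewrite bnd_simp.
rewrite /Rintegral (@continuous_FTC2 _ g' g) //.
- by have [-> _] := H b (big _ (lexx _)); rewrite sub0e.
- split; [by move=> t _; case: (dg t)|apply: cvg_at_right_filter; exact: cg|apply: cvg_at_left_filter; exact: cg].
- by move=> t _; rewrite derive1E; case: (dg t).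
Qed.

Lemma ins_line n (k : 'I_n.+1) (t : R) (y : 'rV[R]_n) :
  ins k t y = ins k 0 y + t *: delta_mx 0 k.
Proof.
apply/rowP => j; rewrite !mxE eqxx /=; case: (unliftP k j) => [l ->|->].
  by rewrite eq_sym (negbTE (neq_lift _ _)) mulr0 addr0.
by rewrite eqxx mulr1 add0r.
Qed.

Lemma continuous_ins n (k : 'I_n.+1) (y : 'rV[R]_n) :
  continuous (fun t : R => ins k t y).
Proof.
apply: continuous_rV => j.
rewrite (_ : (fun t => _) = if unlift k j is Some l then fun=> y 0 l else id).
  by case: (unlift k j) => [l|]; [exact: continuous_cst|move=> t; exact: cvg_id].
by apply/funext => t; rewrite mxE; case: (unlift k j).
Qed.

Lemma is_derive_ins n (h : 'rV[R]_n.+1 -> R) (k : 'I_n.+1) (y : 'rV[R]_n) (t : R) : Ck 1 h ->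
  is_derive t (1 : R) (fun s : R => h (ins k s y)) (partial k h (ins k t y)).
Proof.
move=> [_ /(_ k)[dh _]].
rewrite (_ : (fun s => _) = fun s => h (ins k 0 y + s *: delta_mx 0 k)); last first.
  by apply/funext => s; rewrite ins_line.
by rewrite (ins_line k t); apply: derive_line; exact: dh.
Qed.

Lemma continuous_comp_ins n (h : 'rV[R]_n.+1 -> R) (k : 'I_n.+1) (y : 'rV[R]_n) :
  continuous h -> continuous (fun t : R => h (ins k t y)).
Proof.
by move=> ch t; apply: continuous_comp; [exact: continuous_ins|exact: ch].
Qed.

Lemma slice_eq0 n (h : 'rV[R]_n.+1 -> R) (k : 'I_n.+1) (M : R) (y : 'rV[R]_n) :
  (forall x, M < `|x| -> h x = 0) ->
  forall t, M < `|t| -> h (ins k t y) = 0 /\ partial k h (ins k t y) = 0.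
Proof.
move=> H t Mt; have Mx : M < `|ins k t y|.
  by apply: (lt_le_trans Mt); case: (norm_ins k t y).
by split; [exact: H|exact: (@partial_eq0 _ _ _ M)].
Qed.

Lemma integral_slice_lt n (h : 'rV[R]_n.+1 -> R) (k : 'I_n.+1) (M c : R) (y : 'rV[R]_n) :
  Ck 1 h -> (forall x, M < `|x| -> h x = 0) ->
  \int[@lebesgue_measure R]_t (if t < c then partial k h (ins k t y) else 0)
  = h (ins k c y).
Proof.
move=> Ch H.
apply: (@FTC_lt (fun s : R => h (ins k s y)) (fun s => partial k h (ins k s y)) M).
- by move=> t; exact: is_derive_ins.
- by apply: continuous_comp_ins; case: Ch => _ /(_ k)[].
- exact: slice_eq0.
Qed.

Lemma integral_slice_gt n (h : 'rV[R]_n.+1 -> R) (k : 'I_n.+1) (M c : R) (y : 'rV[R]_n) :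
  Ck 1 h -> (forall x, M < `|x| -> h x = 0) ->
  \int[@lebesgue_measure R]_t (if c < t then partial k h (ins k t y) else 0)
  = - h (ins k c y).
Proof.
move=> Ch H.
apply: (@FTC_gt (fun s : R => h (ins k s y)) (fun s => partial k h (ins k s y)) M).
- by move=> t; exact: is_derive_ins.
- by apply: continuous_comp_ins; case: Ch => _ /(_ k)[].
- exact: slice_eq0.
Qed.

Lemma nice_partial n (h : 'rV[R]_n -> R) k (M : R) :
  Ck 1 h -> (forall x, M < `|x| -> h x = 0) -> nice (partial k h).
Proof.
move=> [_ /(_ k)[_ ch]] H; apply: (@nice_continuous _ _ M) => //.
exact: partial_eq0.
Qed.

(** Integrating first along the [k]-th coordinate, the fundamental theorem of
    calculus leaves only boundary values, and these vanish. *)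
Lemma Int_partial n (h : 'rV[R]_n -> R) k (M : R) :
  Ck 1 h -> (forall x, M < `|x| -> h x = 0) -> Int (partial k h) = 0.
Proof.
case: n h k => [|n] h k Ch H; first by case: k.
rewrite (Int_ins k (nice_partial k Ch H)).
rewrite (_ : (fun y => _) = fun=> 0) ?Int0 //.
apply/funext => y.
have big t : `|M| + 1 <= t -> M < `|t|.
  move=> Mt; rewrite (lt_le_trans _ (ler_norm t)) // (lt_le_trans _ Mt) //.
  by rewrite ltr_pwDr // ler_norm.
have [hc _] := slice_eq0 k y H (big _ (lexx _)).
rewrite -hc -(integral_slice_lt k _ y Ch H).
apply: eq_Rintegral => t _; case: ltP => // /big Mt.
by have [_ ->] := slice_eq0 k y H Mt.
Qed.

End CompactlySupported.

(** * Bumps, localization, and the smoothed Heaviside function *)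

Section Localization.
Variable R : realType.

(** The positive part squared: the simplest C^1 function that is flat on a
    half-line, hence a building block for cut-offs. *)
Definition sqpos (t : R) : R := Num.max t 0 ^+ 2.

Lemma is_derive_sqpos (t : R) : is_derive t (1 : R) sqpos (2 * Num.max t 0).
Proof.
have key : h^-1 *: ((sqpos \o shift t) (h *: (1 : R)) - sqpos t) @[h --> 0^'] -->
    (2 * Num.max t 0 : R).
  apply/cvgrPdist_le => e e0; near=> h.
  have h0 : h != 0 by near: h; exact: nbhs_dnbhs_neq.
  have he : `|h| <= e by near: h; exact: dnbhs0_le.
  apply: le_trans he.
  rewrite /= [h *: 1]mulr1 [_ *: _]mulrC.
  rewrite -(ler_pM2r (x := `|h|)) ?normr_gt0 // -normrM mulrBl divfK //.
  rewrite -expr2 real_normK ?num_real // /sqpos ler_norml.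
  by rewrite !maxEle; case: ifP => H1; case: ifP => H2; apply/andP; split; nra.
by split; [apply/cvg_ex; eexists; exact: key|exact: cvg_lim key].
Unshelve. all: by end_near. Qed.

Lemma sqpos_C1 : (forall t, derivable sqpos t 1) /\ continuous (derive1 sqpos).
Proof.
split=> [t|]; first by have [] := is_derive_sqpos t.
have -> : derive1 sqpos = fun t => 2 * Num.max t 0.
  by apply/funext => t; rewrite derive1E; have [] := is_derive_sqpos t.
apply: continuous_mul; first exact: continuous_cst.
by move=> t; apply: continuous_max; [exact: cvg_id|exact: cvg_cst].
Qed.

(** A C^1 transition from 1 on the negative half-line to 0 beyond 1. *)
Definition smoothstep (s : R) : R := sqpos (1 - sqpos s).

Lemma smoothstep_le0 s : s <= 0 -> smoothstep s = 1.
Proof.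
by move=> s0; rewrite /smoothstep /sqpos (max_r s0) expr0n subr0 max_l ?ler01 // expr1n.
Qed.

Lemma smoothstep_ge1 s : 1 <= s -> smoothstep s = 0.
Proof.
move=> s1; rewrite /smoothstep /sqpos (max_l (le_trans ler01 s1)) max_r ?expr0n //.
by rewrite subr_le0 -(expr1n _ 2) lerXn2r // nnegrE ?ler01 // (le_trans ler01 s1).
Qed.

Lemma smoothstep_itv s : 0 <= smoothstep s <= 1.
Proof.
rewrite /smoothstep /sqpos sqr_ge0 /= expr_le1 ?le_max ?lexx ?orbT //.
by rewrite ge_max ler01 andbT gerBl sqr_ge0.
Qed.

Lemma Ck1_smoothstep n (u : 'rV[R]_n -> R) : Ck 1 u -> Ck 1 (fun x => smoothstep (u x)).
Proof.
move=> Cu; have [d c] := sqpos_C1.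
have [C1 _] := Ck1_comp1 (fun x => d (u x)) (fun x => c (u x)) Cu.
have [C2 _] := Ck1_comp1 (fun x => d _) (fun x => c _) (Ck1_sub (Ck1_cst _ (1 : R)) C1).
exact: C2.
Qed.

(** The radial quantity is the squared Euclidean distance, which is C^1, while
    neighbourhoods are measured in the maximum norm; [4 / r ^+ 2] and the shift by
    1 are chosen so that the transition fits between the two estimates below. *)
Definition bump n (c : 'rV[R]_n) (r : R) (x : 'rV[R]_n) : R :=
  smoothstep ((4 / r ^+ 2) * \sum_(i < n) (x 0 i - c 0 i) ^+ 2 - 1).

Lemma Ck1_bump n (c : 'rV[R]_n) (r : R) : Ck 1 (bump c r).
Proof.
apply: Ck1_smoothstep; apply: Ck1_sub; last exact: Ck1_cst.
apply: Ck1_mul; first exact: Ck1_cst.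
have C i : Ck 1 (fun x : 'rV[R]_n => x 0 i - c 0 i).
  by apply: Ck1_sub; [exact: Ck1_coord|exact: Ck1_cst].
by apply: Ck1_sum => i; apply: Ck1_mul.
Qed.

Lemma bump_far n (c : 'rV[R]_n) (r : R) x : 0 < r -> r <= `|c - x| -> bump c r x = 0.
Proof.
move=> r0 rx; apply: smoothstep_ge1.
suff H : r ^+ 2 <= \sum_(i < n) (x 0 i - c 0 i) ^+ 2.
  have r2 : 0 < r ^+ 2 by rewrite exprn_gt0.
  rewrite lerBrDr mulrAC ler_pdivlMr //; lra.
apply: contraPP rx => /negP; rewrite -ltNge => H; apply/negP; rewrite -ltNge.
case: n c x H => [|n] c x H.
  rewrite (_ : c - x = 0) ?normr0 //; by apply/rowP => -[].
have : `|c - x| < r.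
  rewrite [ltLHS]/Num.Def.normr/= mx_normrE bigmax_lt // => -[i j] _ /=; rewrite ord1 !mxE.
  rewrite -(ltr_pXn2r (n := 2)) ?nnegrE ?(ltW r0) // real_normK ?num_real //.
  apply: le_lt_trans H; rewrite (bigD1 j) //= -[leLHS]addr0; apply: lerD.
    by rewrite -sqrrN opprB.
  by apply: sumr_ge0 => k _; exact: sqr_ge0.
by [].
Qed.

(** The radius accounts for the factor [n] between the Euclidean and maximum
    norms. *)
Lemma bump_near n (c : 'rV[R]_n) (r : R) x : 0 < r ->
  `|c - x| <= r / (2 * n.+1%:R) -> bump c r x = 1.
Proof.
move=> r0 rx; apply: smoothstep_le0.
rewrite subr_le0 mulrAC ler_pdivrMr ?exprn_gt0 // mul1r.
apply: (@le_trans _ _ (4 * \sum_(i < n) (r / (2 * n.+1%:R)) ^+ 2)).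
  rewrite ler_pM2l //; apply: ler_sum => i _.
  rewrite -[leLHS]real_normK ?num_real // lerXn2r ?nnegrE //.
    by rewrite divr_ge0 ?(ltW r0).
  apply: le_trans rx; have := coord_le_norm (c - x) i.
  by rewrite !mxE distrC.
rewrite sumr_const card_ord -[X in 4 * X]mulr_natr expr_div_n exprMn.
rewrite (_ : 4 * (r ^+ 2 / (2 ^+ 2 * n.+1%:R ^+ 2) * n%:R) = r ^+ 2 * (n%:R / n.+1%:R ^+ 2)); last by field; rewrite nat1r pnatr_eq0.
rewrite ler_piMr ?sqr_ge0 // ler_pdivrMr ?exprn_gt0 // mul1r -natrX ler_nat.
by rewrite (leq_trans (leqnSn n)) // expnS leq_pmulr // expn_gt0.
Qed.

(** Replaces a partition of unity. Cover [K] by finitely many balls on which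
    bumps are 1, and peel the balls off one at a time with
    [h = bump * h + (1 - bump) * h]: the first part is local, the second one
    vanishes on one more ball. *)
Lemma localization n (K : set 'rV[R]_n) (L : ('rV[R]_n -> R) -> Prop) :
  compact K ->
  (forall g h, Ck 1 g -> Ck 1 h -> L g -> L h -> L (fun x => g x + h x)) ->
  (forall h, Ck 1 h -> (forall x, K x -> \forall y \near x, h y = 0) -> L h) ->
  (forall x, K x -> exists2 r : R, 0 < r & forall h, Ck 1 h ->
     (forall y, r <= `|x - y| -> h y = 0) -> L h) ->
  forall h, Ck 1 h -> L h.
Proof.
move=> cK Ladd L0 Lloc.
have /choice[r Hr] : forall x, exists r : R, K x -> 0 < r /\ forall h, Ck 1 h ->
     (forall y, r <= `|x - y| -> h y = 0) -> L h.
  move=> x; have [Kx|nKx] := pselect (K x); last by exists 0.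
  by have [r r0 H] := Lloc x Kx; exists r.
pose s (x : 'rV[R]_n) : R := r x / (2 * n.+1%:R).
have [D DK Dcov] : finite_subset_cover K (fun x => ball x (s x)) K.
  move: cK; rewrite compact_cover; apply => [x _|x Kx]; first exact: ball_open.
  exists x => //; apply: ballxx; have [r0 _] := Hr x Kx.
  by rewrite divr_gt0.
suff P (e : seq 'rV[R]_n) : {subset e <= K} -> forall h, Ck 1 h ->
    (forall x, K x -> (exists2 c, c \in e & ball c (s c) x) \/
       \forall y \near x, h y = 0) -> L h.
  move=> h Ch; apply: (P (finmap.enum_fset D)) => // x Kx; left.
  by have [c Dc Hc] := Dcov x Kx; exists c.
elim: e => [|c e IH] eK h Ch H.
  by apply: L0 => // x Kx; have [[]|] := H x Kx.
have Kc : K c by have := eK c (mem_head _ _); rewrite inE.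
have [r0 Hc] := Hr c Kc.
have Cb := Ck1_bump c (r c).
rewrite (_ : h = fun x => bump c (r c) x * h x + (1 - bump c (r c) x) * h x); last first.
  by apply/funext => x; ring.
have C2 : Ck 1 (fun x => (1 - bump c (r c) x) * h x).
  by apply: Ck1_mul => //; apply: Ck1_sub => //; exact: Ck1_cst.
apply: Ladd => //; first exact: Ck1_mul.
  apply: Hc => [|y ry]; first exact: Ck1_mul.
  by rewrite bump_far // mul0r.
apply: IH => // [x xe|x Kx]; first by apply: eK; rewrite inE xe orbT.
have [[c' c'e Hc']|nh] := H x Kx; last first.
  by right; apply: filterS nh => y ->; rewrite mulr0.
move: c'e Hc'; rewrite inE => /orP[/eqP -> Hcx|c'e Hc']; last by left; exists c'.
right; have := @ball_open _ _ c (s c); rewrite openE => /(_ _ Hcx).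
apply: filterS => y; rewrite -ball_normE /= => /ltW Hy.
by rewrite bump_near // subrr mul0r.
Qed.

(** The cut-offs [smoothstep (1 + k * rho)] converge boundedly to the indicator
    of [rho < 0], so an integral that vanishes against all of them vanishes on that
    set. *)
Lemma Int_heaviside n (rho g : 'rV[R]_n -> R) : continuous rho -> nice g ->
  (forall k : nat, Int (fun x => smoothstep (1 + k%:R * rho x) * g x) = 0) ->
  Int (fun x => (if rho x < 0 then 1 else 0) * g x) = 0.
Proof.
move=> crho ng H.
have cst k : continuous (fun x => smoothstep (1 + k%:R * rho x)).
  move=> x; apply: (@continuous_comp _ _ _ (fun x => 1 + k%:R * rho x) smoothstep).
    move: x; apply: continuous_add; first exact: continuous_cst.
    by apply: continuous_mul => //; exact: continuous_cst.
  have [d _] := sqpos_C1.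
  have cs : continuous sqpos by move=> t; exact/differentiable_continuous/derivable1_diffP.
  apply: (@continuous_comp _ _ _ (fun t => 1 - sqpos t) sqpos); last exact: cs.
  by apply: continuous_add; [exact: continuous_cst|exact: continuous_opp].
have [mg _] := ng.
have mrho := continuous_measurable crho.
pose f_ (k : nat) (t : Rtuple R n) : \bar R :=
  (smoothstep (1 + k%:R * rho (@vec R n t)) * g (@vec R n t))%:E.
pose f (t : Rtuple R n) : \bar R :=
  ((if rho (@vec R n t) < 0 then 1 else 0) * g (@vec R n t))%:E.
have mf_ k : measurable_fun setT (f_ k).
  apply/measurable_EFinP; apply: measurable_funM => //.
  exact: (continuous_measurable (cst k)).
have f_f t : f_ ^~ t @ \oo --> f t.
  apply: cvg_near_cst; rewrite /f_ /f.
  have [r0|r0] := ltP (rho (@vec R n t)) 0; last first.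
    near=> k; rewrite smoothstep_ge1 // lerDl mulr_ge0 //.
  near=> k; rewrite smoothstep_le0 //.
  have : - (rho (@vec R n t))^-1 <= k%:R by near: k; exact: nbhs_infty_ger.
  rewrite -(ler_nM2r r0) mulNr mulVf ?lt_eqF //; lra.
have f_g t k : (`|f_ k t| <= `|(g (@vec R n t))%:E|)%E.
  rewrite /f_ /= lee_fin normrM ler_piMl //.
  by have /andP[h0 h1] := smoothstep_itv (1 + k%:R * rho (@vec R n t)); rewrite ger0_norm.
have mf : measurable_fun setT f.
  exact: (emeasurable_fun_cvg f_ f mf_ (fun x _ => f_f x)).
have ig : (leb R n).-integrable setT (fun t => `|(g (@vec R n t))%:E|%E).
  by apply: integrable_abse; exact: nice_integrable.
have [_ _] := @dominated_convergence _ _ _ (leb R n) setT measurableT f_ f _ mf_ mf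
  (aeW _ (fun x _ => f_f x)) ig (aeW _ (fun x k _ => f_g x k)).
have If k : (\int[leb R n]_t f_ k t = 0)%E.
  have := H k; rewrite /Int /intg /Rintegral preimage_setT => H0.
  rewrite -[LHS]fineK ?H0 //; apply: integrable_fin_num => //.
  by apply: (le_integrable _ (mf_ k) _ ig) => // t _; rewrite abse_id; exact: f_g.
rewrite (_ : [sequence _]_n = fun=> 0%E); last by apply/funext => k; rewrite -[RHS](If k).
move=> /(cvg_unique _ (cvg_cst _)) E.
rewrite /Int /intg /Rintegral preimage_setT.
by rewrite -[X in fine X]/(\int[leb R n]_t f t)%E -E.
Unshelve. all: by end_near. Qed.

End Localization.

(** * Graph charts of the boundary *)

Section Charts.
Variables (R : realType) (n : nat).
Implicit Types (Omega U : set 'rV[R]_n.+1) (i : 'I_n.+1) (b : bool)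
  (gam : 'rV[R]_n -> R).

Lemma dotvC m (v w : 'rV[R]_m) : dotv v w = dotv w v.
Proof. by apply: eq_bigr => j _; rewrite mulrC. Qed.

Lemma dotvDl m (u v w : 'rV[R]_m) : dotv (u + v) w = dotv u w + dotv v w.
Proof. by rewrite /dotv -big_split; apply: eq_bigr => j _; rewrite !mxE mulrDl. Qed.

Lemma dotvZl m (c : R) (v w : 'rV[R]_m) : dotv (c *: v) w = c * dotv v w.
Proof. by rewrite /dotv mulr_sumr; apply: eq_bigr => j _; rewrite !mxE mulrA. Qed.

Lemma dotvNl m (v w : 'rV[R]_m) : dotv (- v) w = - dotv v w.
Proof. by rewrite -scaleN1r dotvZl mulN1r. Qed.

Lemma dotvBl m (u v w : 'rV[R]_m) : dotv (u - v) w = dotv u w - dotv v w.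
Proof. by rewrite dotvDl dotvNl. Qed.

Lemma dotvDr m (u v w : 'rV[R]_m) : dotv w (u + v) = dotv w u + dotv w v.
Proof. by rewrite dotvC dotvDl !(dotvC w). Qed.

Lemma dotvZr m (c : R) (v w : 'rV[R]_m) : dotv v (c *: w) = c * dotv v w.
Proof. by rewrite dotvC dotvZl dotvC. Qed.

Lemma dotvNr m (v w : 'rV[R]_m) : dotv v (- w) = - dotv v w.
Proof. by rewrite dotvC dotvNl dotvC. Qed.

Lemma dotvBr m (u v w : 'rV[R]_m) : dotv w (u - v) = dotv w u - dotv w v.
Proof. by rewrite dotvDr dotvNr. Qed.

Lemma dotv_ge0 m (v : 'rV[R]_m) : 0 <= dotv v v.
Proof. by apply: sumr_ge0 => j _; rewrite -expr2 sqr_ge0. Qed.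

Lemma dotv_eq0 m (v : 'rV[R]_m) : dotv v v <= 0 -> v = 0.
Proof.
move=> v0; apply/rowP => j; rewrite mxE; apply/eqP; rewrite -sqrf_eq0.
have : dotv v v == 0 by rewrite eq_le v0 dotv_ge0.
rewrite psumr_eq0 => [/allP/(_ j)|k _]; last by rewrite -expr2 sqr_ge0.
by rewrite mem_index_enum -expr2 => /(_ isT).
Qed.

(** Splits off the distinguished coordinate, matching the shape of [ins]. *)
Lemma sum_ins (i : 'I_n.+1) (F : 'I_n.+1 -> R) :
  \sum_j F j = F i + \sum_(k < n) F (lift i k).
Proof.
rewrite (bigD1 i) //=; congr (_ + _).
rewrite (reindex_omap (lift i) (unlift i)) /=; last first.
  by move=> j ji; case: unliftP ji => [k ->|->] //; rewrite eqxx.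
by apply: eq_bigl => k; rewrite eq_sym neq_lift liftK eqxx.
Qed.

Lemma ins_at i t (y : 'rV[R]_n) : ins i t y 0 i = t.
Proof. by rewrite mxE unlift_none. Qed.

Lemma ins_lift i t (y : 'rV[R]_n) k : ins i t y 0 (lift i k) = y 0 k.
Proof. by rewrite mxE liftK. Qed.

Lemma col'_ins i t (y : 'rV[R]_n) : col' i (ins i t y) = y.
Proof. by apply/rowP => k; rewrite mxE ins_lift. Qed.

Lemma ins_col' i (x : 'rV[R]_n.+1) : ins i (x 0 i) (col' i x) = x.
Proof.
apply/rowP => j; case: (unliftP i j) => [k ->|->]; last by rewrite ins_at.
by rewrite ins_lift mxE.
Qed.

Lemma dotv_ins i (s t : R) (a c : 'rV[R]_n) :
  dotv (ins i s a) (ins i t c) = s * t + dotv a c.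
Proof.
rewrite /dotv (sum_ins i) !ins_at; congr (_ + _).
by apply: eq_bigr => k _; rewrite !ins_lift.
Qed.

Lemma Ck1_col' i (w : 'rV[R]_n -> R) : Ck 1 w ->
  Ck 1 (fun x : 'rV[R]_n.+1 => w (col' i x)) /\
  forall x : 'rV[R]_n.+1, grad (fun x : 'rV[R]_n.+1 => w (col' i x)) x = ins i 0 (grad w (col' i x)).
Proof.
move=> Cw.
have CS k : Ck 1 (fun x : 'rV[R]_n.+1 => (col' i x) 0 k).
  rewrite (_ : (fun x => _) = fun x : 'rV[R]_n.+1 => x 0 (lift i k)); first exact: Ck1_coord.
  by apply/funext => x; rewrite mxE.
split; first exact: (Ck1_comp CS Cw).
move=> x; apply/rowP => j; rewrite mxE.
have [_ ->] := partial_comp j x CS Cw.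
have P l : partial j (fun y : 'rV[R]_n.+1 => (col' i y) 0 l) x = (lift i l == j)%:R.
  rewrite (_ : (fun y => _) = fun x : 'rV[R]_n.+1 => x 0 (lift i l)).
    by have [] := partial_coord (lift i l) j x.
  by apply/funext => y; rewrite mxE.
under eq_bigr do rewrite P.
case: (unliftP i j) => [k ->|->].
  rewrite ins_lift mxE (bigD1 k) //= eqxx mul1r big1 ?addr0 // => l lk.
  by rewrite (inj_eq lift_inj) (negbTE lk) mul0r.
by rewrite ins_at big1 // => l _; rewrite eq_sym (negbTE (neq_lift _ _)) mul0r.
Qed.

(** The defining function of a chart, whose sign tells the inside of the domain
    and whose normalized gradient is the outward normal. *)
Definition defun i b gam (x : 'rV[R]_n.+1) : R := (-1) ^+ b * (x 0 i - gam (col' i x)).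

Lemma grad_coord i (x : 'rV[R]_n.+1) : grad (fun y : 'rV[R]_n.+1 => y 0 i) x = ins i 1 0.
Proof.
apply/rowP => j; rewrite !mxE; have [_] := partial_coord i j x; rewrite /partial => ->.
by case: unliftP => [k ->|->]; rewrite ?mxE ?eqxx // (negbTE (neq_lift _ _)).
Qed.

Lemma Ck1_defun i b gam : Ck 1 gam -> Ck 1 (defun i b gam) /\
  forall x, grad (defun i b gam) x = (-1) ^+ b *: ins i 1 (- grad gam (col' i x)).
Proof.
move=> Cg; have [Cw gw] := Ck1_col' i Cg.
have C1 : Ck 1 (fun x : 'rV[R]_n.+1 => x 0 i - gam (col' i x)).
  by apply: Ck1_sub => //; exact: Ck1_coord.
split=> [|x]; first by apply: Ck1_mul => //; exact: Ck1_cst.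
apply/rowP => j; rewrite mxE.
rewrite (partialM _ _ (Ck1_cst _ _) C1) partial_cst mulr0 addr0.
rewrite (partialD _ _ (@Ck1_coord R _ _) (Ck1_opp Cw)) partialN //.
have -> : partial j (fun x : 'rV[R]_n.+1 => gam (col' i x)) x = ins i 0 (grad gam (col' i x)) 0 j.
  by rewrite -(gw x) [RHS]mxE.
have -> : partial j (fun x : 'rV[R]_n.+1 => x 0 i) x = ins i 1 0 0 j.
  by rewrite -(grad_coord i x) [RHS]mxE.
rewrite [in RHS]mxE; congr (_ * _).
by case: (unliftP i j) => [k ->|->]; rewrite ?ins_at ?ins_lift ?subr0 // !mxE sub0r.
Qed.

Lemma area_density_gt0 gam (y : 'rV[R]_n) : 0 < 1 + dotv (grad gam y) (grad gam y).
Proof. by have := dotv_ge0 (grad gam y); lra. Qed.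

Lemma area_density_sqr gam (y : 'rV[R]_n) :
  @area_density R n.+1 gam y ^+ 2 = 1 + dotv (grad gam y) (grad gam y).
Proof. by rewrite sqr_sqrtr // ltW // area_density_gt0. Qed.

Lemma area_density_pos gam (y : 'rV[R]_n) : 0 < @area_density R n.+1 gam y.
Proof. by rewrite sqrtr_gt0 area_density_gt0. Qed.

Lemma graph_normalE i b gam x : Ck 1 gam ->
  graph_normal i b gam x = (@area_density R n.+1 gam (col' i x))^-1 *: grad (defun i b gam) x.
Proof.
move=> Cg; have [_ ->] := Ck1_defun i b Cg.
by rewrite scalerA mulrC.
Qed.

Lemma dotv_graph_normal i b gam x : 
  dotv (graph_normal i b gam x) (graph_normal i b gam x) = 1.
Proof.
rewrite /graph_normal dotvZl dotvZr dotv_ins mulr1 dotvNl dotvNr opprK.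
rewrite -(area_density_sqr gam) mulrA -expr2 expr_div_n sqrr_sign mul1r mulVf //.
by rewrite sqrf_eq0 gt_eqF // area_density_pos.
Qed.

Lemma at_right_dnbhs (a : R) : a^'+ `=>` a^'.
Proof.
move=> P; apply: (@filterS _ (nbhs a) _ (fun t => t != a -> P t)) => t H at_.
by apply: H; rewrite gt_eqF.
Qed.

(** One-sided displacement: this is how the position of the domain with respect
    to its boundary is detected. *)
Lemma slope_neg m (u : 'rV[R]_m -> R) (x v : 'rV[R]_m) : Ck 1 u -> dotv v (grad u x) < 0 ->
  \forall t \near (0 : R)^'+, u (x + t *: v) < u x.
Proof.
move=> Cu H; have [du E] := Ck1_diff x Cu.
have dv : derivable u x v by exact: diff_derivable.
have Dv : 'D_v u x = dotv v (grad u x) by rewrite deriveE // E.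
have cv : h^-1 *: (u (h *: v + x) - u x) @[h --> (0 : R)^'+] --> 'D_v u x.
  exact: cvg_trans (cvg_app _ (@at_right_dnbhs 0)) dv.
have : \forall t \near (0 : R)^'+, t^-1 *: (u (t *: v + x) - u x) < 0.
  by apply: (cvgr_lt _ cv); rewrite Dv.
apply: filter_app; near=> t.
have t0 : 0 < t by near: t; exact: nbhs_right_gt.
by rewrite [_ *: _]mulrC pmulr_llt0 ?invr_gt0 // subr_lt0 addrC.
Unshelve. all: by end_near. Qed.

Lemma near_line m (x v : 'rV[R]_m) (U : set 'rV[R]_m) : open U -> U x ->
  \forall t \near (0 : R)^'+, U (x + t *: v).
Proof.
move=> oU Ux.
have : continuous (fun t : R => x + t *: v).
  apply: continuous_rV => j.
  rewrite (_ : (fun t => _) = fun t : R => x 0 j + t * v 0 j).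
    apply: continuous_add; first exact: continuous_cst.
    by apply: continuous_mul; [move=> t; exact: cvg_id|exact: continuous_cst].
  by apply/funext => t; rewrite !mxE.
move=> /(_ 0) /(_ U); rewrite /= scale0r addr0.
have nU : nbhs x U by move: oU; rewrite openE => /(_ _ Ux).
by move=> /(_ nU) H; apply: cvg_at_right_filter; [exact: cvg_id|exact: H].
Qed.

Lemma chart_Ck1 Omega U i b gam : graph_chart Omega U i b gam -> Ck 1 gam.
Proof. by case=> _ + _; exact. Qed.

Lemma chartE Omega U i b gam x : graph_chart Omega U i b gam -> U x ->
  Omega x <-> defun i b gam x < 0.
Proof. by case=> _ _ /(_ x); exact. Qed.

Lemma grad_defun_sqr i b gam x : Ck 1 gam ->
  0 < dotv (grad (defun i b gam) x) (grad (defun i b gam) x).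
Proof.
move=> Cg; have [_ ->] := Ck1_defun i b Cg.
rewrite dotvZl dotvZr mulrA -expr2 sqrr_sign mul1r dotv_ins mulr1 dotvNl dotvNr opprK.
exact: area_density_gt0.
Qed.

(** On the zero set, the gradient of the defining function does not vanish, so
    moving against it enters the domain: every zero is a boundary point. *)
Lemma chart_bdry Omega U i b gam x : graph_chart Omega U i b gam -> U x ->
  bdry Omega x <-> defun i b gam x = 0.
Proof.
move=> ch Ux; have Cg := chart_Ck1 ch; have [Cd _] := Ck1_defun i b Cg.
have [oU _ _] := ch.
have cd : continuous (defun i b gam) by case: Cd.
have nU : nbhs x U by move: oU; rewrite openE => /(_ _ Ux).
split.
  move=> [cl ni]; apply/eqP; rewrite eq_le !leNgt; apply/andP; split; apply/negP => H.
    have : nbhs x (fun y => 0 < defun i b gam y) by exact: (cvgr_gt _ (cd x)).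
    move=> /(filterI nU) /cl[y [Oy [Uy]]].
    by move/(chartE ch Uy) : Oy => /lt_trans/[apply]; rewrite ltxx.
  apply: ni; have : nbhs x (fun y => defun i b gam y < 0) by exact: (cvgr_lt _ (cd x)).
  by move=> /(filterI nU); apply: filterS => y [Uy]; rewrite -(chartE ch Uy).
move=> r0; split; last first.
  by move=> /nbhs_singleton/(chartE ch Ux); rewrite r0 ltxx.
move=> B nB.
have H := @slope_neg _ (defun i b gam) x (- grad (defun i b gam) x) Cd.
rewrite dotvNl oppr_lt0 in H; have {}H := H (grad_defun_sqr i b x Cg).
have nBU : nbhs x (B `&` U) by exact: filterI.
have HB := near_line (- grad (defun i b gam) x) (open_interior (B `&` U)) nBU.
have [t [lt /interior_subset[By Uy]]] := @filter_ex _ _ (at_right_proper_filter (0 : R)) _ (filterI H HB).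
exists (x + t *: - grad (defun i b gam) x); split => //.
by apply/(chartE ch Uy); rewrite -r0.
Unshelve. all: by end_near. Qed.

End Charts.

(** * Outward normal and tangential gradient in a chart *)

Section BoundaryGeometry.
Variables (R : realType) (n : nat).
Implicit Types (Omega U : set 'rV[R]_n.+1) (i : 'I_n.+1) (b : bool)
  (gam : 'rV[R]_n -> R).

Lemma chart_side Omega U i b gam x v : graph_chart Omega U i b gam -> U x ->
  bdry Omega x -> dotv v (graph_normal i b gam x) < 0 ->
  \forall t \near (0 : R)^'+, Omega (x + t *: v) /\ U (x + t *: v).
Proof.
move=> ch Ux bx vn; have Cg := chart_Ck1 ch; have [Cd _] := Ck1_defun i b Cg.
have r0 := (chart_bdry ch Ux).1 bx.
have [oU _ _] := ch.
move: vn; rewrite graph_normalE // dotvZr pmulr_rlt0 ?invr_gt0 ?area_density_pos // => vn.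
apply: filterS2 (slope_neg Cd vn) (near_line v oU Ux) => t.
by rewrite r0 => H Ut; split => //; exact/(chartE ch Ut).
Qed.

Lemma chart_outside Omega U i b gam x v : graph_chart Omega U i b gam -> U x ->
  bdry Omega x -> 0 < dotv v (graph_normal i b gam x) ->
  \forall t \near (0 : R)^'+, ~ Omega (x + t *: v).
Proof.
move=> ch Ux bx vn; have Cg := chart_Ck1 ch; have [Cd gd] := Ck1_defun i b Cg.
have r0 := (chart_bdry ch Ux).1 bx.
have [oU _ _] := ch.
move: vn; rewrite graph_normalE // dotvZr pmulr_rgt0 ?invr_gt0 ?area_density_pos // => vn.
have CN := Ck1_opp Cd.
have vN : dotv v (grad (fun x => - defun i b gam x) x) < 0.
  rewrite (_ : grad _ x = - grad (defun i b gam) x) ?dotvNr ?oppr_lt0 //.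
  by apply/rowP => j; rewrite !mxE partialN.
apply: filterS2 (slope_neg CN vN) (near_line v oU Ux) => t.
by rewrite r0 oppr0 oppr_lt0 => H Ut /(chartE ch Ut) /(lt_trans H); rewrite ltxx.
Qed.

(** If [a] and [c] differ, the vector [c - a] has negative product with [a] and
    positive product with [c]; for two normals this would point both into and out
    of the domain. *)
Lemma unit_vector_eq m (a c : 'rV[R]_m) : dotv a a = 1 -> dotv c c = 1 ->
  (dotv (c - a) a < 0 -> 0 < dotv (c - a) c -> False) -> a = c.
Proof.
move=> a1 c1; rewrite !dotvBl a1 c1 (dotvC c a).
have E : dotv (a - c) (a - c) = 2 - 2 * dotv a c.
  by rewrite dotvBl !dotvBr a1 c1 (dotvC c a); move: (dotv a c) => s; ring.
move: (dotv a c) E => s E H.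
apply/eqP; rewrite -subr_eq0; apply/eqP/dotv_eq0; rewrite E.
have [s1|s1] := ltP s 1; last by move: s1; clear; lra.
by exfalso; apply: H; move: s1; clear; lra.
Qed.

(** The normal is intrinsic: a direction cannot be strictly inward for one chart
    and strictly outward for the other. *)
Lemma graph_normal_unique Omega U1 i1 b1 gam1 U2 i2 b2 gam2 x :
  graph_chart Omega U1 i1 b1 gam1 -> U1 x ->
  graph_chart Omega U2 i2 b2 gam2 -> U2 x -> bdry Omega x ->
  graph_normal i1 b1 gam1 x = graph_normal i2 b2 gam2 x.
Proof.
move=> ch1 U1x ch2 U2x bx.
set nu1 := graph_normal i1 b1 gam1 x; set nu2 := graph_normal i2 b2 gam2 x.
have n1 : dotv nu1 nu1 = 1 by exact: dotv_graph_normal.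
have n2 : dotv nu2 nu2 = 1 by exact: dotv_graph_normal.
apply: (unit_vector_eq n1 n2) => v1 v2.
have [t [[Ot _] nOt]] := @filter_ex _ _ (at_right_proper_filter (0 : R)) _
  (filterI (chart_side ch1 U1x bx v1) (chart_outside ch2 U2x bx v2)).
exact: nOt.
Qed.

Lemma outward_normalE Omega U i b gam x : graph_chart Omega U i b gam -> U x ->
  bdry Omega x -> outward_normal Omega x = graph_normal i b gam x.
Proof.
move=> ch Ux bx; rewrite /outward_normal; apply: xget_unique.
  by exists U, i, b, gam.
by move=> v [U' [i' [b' [gam' [ch' Ux' ->]]]]]; exact: graph_normal_unique ch' Ux' ch Ux bx.
Qed.

(** Points [x - t *: nu] lie in the domain for small [t > 0], where [u] is equal to
    its extension [v]; hence the one-sided quotient converges to an ordinary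
    directional derivative. *)
Lemma dnormalE Omega U i b gam x (u v : 'rV[R]_n.+1 -> R) :
  graph_chart Omega U i b gam -> U x -> bdry Omega x ->
  Ck 1 v -> (forall y, closure Omega y -> u y = v y) ->
  dnormal Omega u x = dotv (graph_normal i b gam x) (grad v x).
Proof.
move=> ch Ux bx Cv uv; rewrite /dnormal (outward_normalE ch Ux bx).
set nu := graph_normal i b gam x.
have [dv E] := Ck1_diff x Cv.
have dvn : derivable v x (- nu) by exact: diff_derivable.
have cv : h^-1 *: (v (h *: (- nu) + x) - v x) @[h --> (0 : R)^'+] --> 'D_(- nu) v x.
  exact: cvg_trans (cvg_app _ (@at_right_dnbhs R 0)) dvn.
have Dn : - 'D_(- nu) v x = dotv nu (grad v x).
  by rewrite deriveE // E dotvNl opprK.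
rewrite -Dn; apply/cvg_lim => //.
have H : {near (0 : R)^'+, (fun h : R => - (h^-1 *: (v (h *: (- nu) + x) - v x))) =1
   (fun t : R => (u x - u (x - t *: nu)) / t)}.
  have nn : dotv (- nu) nu < 0 by rewrite dotvNl dotv_graph_normal oppr_lt0.
  have := chart_side ch Ux bx nn; apply: filterS => t [Ot _].
  have xt : x - t *: nu = t *: (- nu) + x by rewrite scalerN addrC.
  rewrite xt uv; last by case: bx.
  rewrite uv; last by apply: subset_closure; rewrite addrC.
  by rewrite -[in RHS]opprB mulNr mulrC.
apply: cvg_trans (near_eq_cvg H) _.
exact: cvgN.
Qed.

(** The parametrization of the boundary in a chart. *)
Definition gpar i gam (y : 'rV[R]_n) : 'rV[R]_n.+1 := ins i (gam y) y.

Lemma Ck1_gpar i gam j : Ck 1 gam -> Ck 1 (fun y => gpar i gam y 0 j).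
Proof.
move=> Cg; case: (unliftP i j) => [k ->|->].
  rewrite (_ : (fun y => _) = fun y : 'rV[R]_n => y 0 k); first exact: Ck1_coord.
  by apply/funext => y; rewrite /gpar ins_lift.
rewrite (_ : (fun y => _) = gam) //.
by apply/funext => y; rewrite /gpar ins_at.
Qed.

(** The rows are the coordinate tangent vectors of the graph. *)
Lemma partial_gpar i gam k y : Ck 1 gam ->
  (\row_j partial k (fun y => gpar i gam y 0 j) y) =
  ins i (partial k gam y) (delta_mx 0 k).
Proof.
move=> Cg; apply/rowP => j; rewrite mxE; case: (unliftP i j) => [l ->|->].
  rewrite ins_lift mxE eqxx /=.
  rewrite (_ : (fun y => _) = fun y : 'rV[R]_n => y 0 l); last first.
    by apply/funext => z; rewrite /gpar ins_lift.
  by have [_] := partial_coord l k y; rewrite /partial => ->.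
rewrite ins_at; congr (partial k _ y).
by apply/funext => z; rewrite /gpar ins_at.
Qed.

Lemma continuous_gpar i gam : Ck 1 gam -> continuous (gpar i gam).
Proof. by move=> Cg; apply: continuous_rV => j; case: (Ck1_gpar i j Cg). Qed.

Lemma Ck1_comp_gpar i gam (w : 'rV[R]_n.+1 -> R) : Ck 1 gam -> Ck 1 w ->
  Ck 1 (fun y => w (gpar i gam y)) /\
  forall k y, partial k (fun y => w (gpar i gam y)) y =
    partial (lift i k) w (gpar i gam y) + partial k gam y * partial i w (gpar i gam y).
Proof.
move=> Cg Cw; have CS j := Ck1_gpar i j Cg.
split=> [|k y]; first exact: (Ck1_comp CS Cw).
have [_ ->] := partial_comp k y CS Cw.
have E j : partial k (fun y => gpar i gam y 0 j) y = ins i (partial k gam y) (delta_mx 0 k) 0 j.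
  by rewrite -partial_gpar // mxE.
under eq_bigr do rewrite E.
rewrite (sum_ins i) ins_at addrC; congr (_ + _).
rewrite (bigD1 k) //= ins_lift mxE !eqxx mul1r big1 ?addr0 // => l lk.
by rewrite ins_lift mxE (negbTE lk) andbF mul0r.
Qed.

Lemma gpar_bdry Omega U i b gam y : graph_chart Omega U i b gam -> U (gpar i gam y) ->
  bdry Omega (gpar i gam y).
Proof.
move=> ch Uy; apply/(chart_bdry ch Uy).
by rewrite /defun /gpar ins_at col'_ins subrr mulr0.
Qed.

Lemma bdry_gpar Omega U i b gam x : graph_chart Omega U i b gam -> U x ->
  bdry Omega x -> x = gpar i gam (col' i x).
Proof.
move=> ch Ux /(chart_bdry ch Ux)/eqP.
rewrite /defun mulf_eq0 signr_eq0 /= subr_eq0 => /eqP E.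
by rewrite /gpar -E ins_col'.
Qed.

Lemma diff_dotv m (Z : 'rV[R]_m -> R) (x v : 'rV[R]_m) : differentiable Z x ->
  'd Z x v = dotv v (grad Z x).
Proof.
move=> dZ; rewrite {1}(row_sum_delta v) linear_sum /dotv; apply: eq_bigr => j _.
by rewrite linearZ mxE /partial deriveE.
Qed.

(** With [g] the gradient of the graph function and [a] the gradient of a function
    of the parameters, the formula inverts the metric [1 + g^T g]
    (Sherman-Morrison), giving the tangential gradient in the ambient space. *)
Definition tvec i (g a : 'rV[R]_n) : 'rV[R]_n.+1 :=
  ins i (dotv a g / (1 + dotv g g)) (a - (dotv a g / (1 + dotv g g)) *: g).

Lemma ins_add i s t (a c : 'rV[R]_n) : ins i s a + ins i t c = ins i (s + t) (a + c).
Proof.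
by apply/rowP => j; case: (unliftP i j) => [k ->|->]; rewrite !mxE ?liftK ?unlift_none ?mxE.
Qed.

Lemma ins_scale i c t (a : 'rV[R]_n) : c *: ins i t a = ins i (c * t) (c *: a).
Proof.
by apply/rowP => j; case: (unliftP i j) => [k ->|->]; rewrite !mxE ?liftK ?unlift_none ?mxE.
Qed.

(** Extending a function of the parameters constantly along the [i]-th axis
    gives an ambient extension with gradient [ins i 0 a]. *)
Lemma tangential_projection i b gam x (a : 'rV[R]_n) :
  ins i 0 a - dotv (ins i 0 a) (graph_normal i b gam x) *: graph_normal i b gam x =
  tvec i (grad gam (col' i x)) a.
Proof.
rewrite /graph_normal dotvZr scalerA dotv_ins mul0r add0r dotvNr.
set g := grad gam _; set A := area_density _ _.
have A2 : A ^+ 2 = 1 + dotv g g by exact: area_density_sqr.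
have A0 : A != 0 by rewrite gt_eqF // area_density_pos.
have -> : (-1) ^+ b / A * - dotv a g * ((-1) ^+ b / A) = - (dotv a g / (1 + dotv g g)).
  have s2 : ((-1) ^+ b : R) * (-1) ^+ b = 1 by rewrite -expr2 sqrr_sign.
  rewrite -A2 mulrAC mulrACA s2 mul1r -invfM -expr2 mulrC; ring.
rewrite scaleNr opprK ins_scale ins_add add0r mulr1.
by congr (ins _ _ (_ + _)); rewrite scalerN.
Qed.

(** Independence of the extension: the difference of two extensions vanishes on
    the graph, so its gradient kills the coordinate tangent vectors and is normal. *)
Lemma tgrad_chart Omega U i b gam x (w : 'rV[R]_n.+1 -> R) (wh : 'rV[R]_n -> R) :
  graph_chart Omega U i b gam -> U x -> bdry Omega x -> Ck 1 wh ->
  (forall y, U y -> bdry Omega y -> w y = wh (col' i y)) ->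
  tgrad Omega w x = tvec i (grad gam (col' i x)) (grad wh (col' i x)).
Proof.
move=> ch Ux bx Cwh wE; have Cg := chart_Ck1 ch; have [oU _ _] := ch.
have [C0 g0] := Ck1_col' i Cwh.
rewrite /tgrad (outward_normalE ch Ux bx).
set P := [set W | _]; set W0 := fun x : 'rV[R]_n.+1 => wh (col' i x).
have [dW0 _] := Ck1_diff x C0.
have nU : nbhs x U by move: oU; rewrite openE => /(_ _ Ux).
have PW0 : P W0.
  by split=> //; apply: filterS nU => y Uy bY; rewrite wE.
have [dW nW] := xgetI (fun=> 0) PW0.
set W := xget _ _ in dW nW *.
rewrite -(tangential_projection _ b) -g0 -/W0.
set nu := graph_normal i b gam x.
pose Z : 'rV[R]_n.+1 -> R := W \- W0.
have dZ : differentiable Z x by exact: differentiableB.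
have gZ : grad W x = grad W0 x + grad Z x.
  apply/rowP => j; rewrite !mxE /partial deriveB ?subrKC //; exact: diff_derivable.
suff [c cE] : exists c : R, grad Z x = c *: nu.
  rewrite gZ cE dotvDl dotvZl dotv_graph_normal mulr1 scalerDl opprD addrACA.
  by rewrite subrr addr0.
have xE := bdry_gpar ch Ux bx.
set y0 := col' i x in xE *.
have H k : dotv (ins i (partial k gam y0) (delta_mx 0 k)) (grad Z x) = 0.
  have dS j : derivable (fun y => gpar i gam y 0 j) y0 (delta_mx 0 k).
    by have [_ /(_ k)[+ _]] := Ck1_gpar i j Cg; exact.
  have dZ' : differentiable Z (gpar i gam y0) by rewrite -xE.
  have [_] := is_derive_comp_rV dS dZ'.
  rewrite -xE diff_dotv // -[X in dotv X _]/(\row_j partial k (fun y => gpar i gam y 0 j) y0).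
  rewrite partial_gpar // => <-.
  have -> : 'D_(delta_mx 0 k) (Z \o gpar i gam) y0 = 'D_(delta_mx 0 k) (fun=> 0) y0.
    apply: near_eq_derive.
    have cg : gpar i gam @ y0 --> x by rewrite [X in _ --> X]xE; exact: continuous_gpar.
    have N0 : nbhs x (fun z => U z /\ (bdry Omega z -> W z = w z)) by exact: filterI.
    have N : \forall y \near y0, U (gpar i gam y) /\
        (bdry Omega (gpar i gam y) -> W (gpar i gam y) = w (gpar i gam y)) := cg _ N0.
    apply: (filterS _ N) => y [Uy Wy] /=.
    have bY := gpar_bdry ch Uy.
    by rewrite /Z /= Wy // wE // /W0 subrr.
  exact: derive_cst.
pose c := grad Z x 0 i * ((-1) ^+ b * @area_density R n.+1 gam y0).
exists c; rewrite /nu /graph_normal scalerA.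
have -> : c * ((-1) ^+ b / @area_density R n.+1 gam (col' i x)) = grad Z x 0 i.
  rewrite /c -/y0 -mulrA mulrACA -expr2 sqrr_sign mul1r mulfV ?mulr1 //.
  by rewrite gt_eqF // area_density_pos.
apply/rowP => j; rewrite [RHS]mxE; case: (unliftP i j) => [k ->|->]; last first.
  by rewrite ins_at mulr1.
rewrite ins_lift; transitivity (grad Z x 0 i * - partial k gam y0); last by rewrite !mxE.
rewrite mulrN; apply/eqP; rewrite -addr_eq0; apply/eqP.
rewrite -[RHS](H k) /dotv (sum_ins i) ins_at mulrC addrC; congr (_ + _).
rewrite (bigD1 k) //= ins_lift [delta_mx _ _ _ _]mxE !eqxx mul1r big1 ?addr0 // => l lk.
by rewrite ins_lift [delta_mx _ _ _ _]mxE (negbTE lk) andbF mul0r.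
Qed.

End BoundaryGeometry.

(** * Area formula for functions *)

Section SurfaceMeasure.
Variables (R : realType) (n : nat).
Variable Omega : set 'rV[R]_n.+1.
Variable sigma : {measure set (Rtuple R n.+1) -> \bar R}.
Hypothesis hsigma : is_surface_measure Omega sigma.

Local Notation vecd := (@vec R n.+1).
Local Notation dens gam := (@area_density R n.+1 gam).

Lemma continuous_density gam : Ck 2 gam -> Ck 1 (dens gam) /\
  forall k y, partial k (dens gam) y =
    (\sum_l partial l gam y * partial k (partial l gam) y) / dens gam y.
Proof.
move=> [_ Cg].
have Cp l : Ck 1 (partial l gam) by case: (Cg l).
have E : dens gam = fun y => Num.sqrt (1 + \sum_l partial l gam y * partial l gam y).
  apply/funext => y; rewrite /area_density; congr (Num.sqrt (1 + _)).
  by apply: eq_bigr => l _; rewrite mxE.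
have Cs : Ck 1 (fun y => \sum_l partial l gam y * partial l gam y).
  by apply: Ck1_sum => l; exact: Ck1_mul.
have Cu := Ck1_add (Ck1_cst n (1 : R)) Cs.
have u0 y : 0 < 1 + \sum_l partial l gam y * partial l gam y.
  by rewrite ltr_pwDl // sumr_ge0 // => l _; rewrite -expr2 sqr_ge0.
have [C P] := Ck1_sqrt u0 Cu.
split=> [|k y]; first by rewrite E.
rewrite E P (partialD _ _ (Ck1_cst _ _) Cs) partial_cst add0r partial_sum; last first.
  by move=> l; exact: Ck1_mul.
rewrite [X in _ * X](eq_bigr (fun l => 2 * (partial l gam y * partial k (partial l gam) y))); last first.
  by move=> l _; rewrite (partialM k y (Cp l) (Cp l)) -mulr2n mulr_natl.
rewrite -mulr_sumr; set s := Num.sqrt _.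
have s0 : s != 0 by rewrite gt_eqF // sqrtr_gt0.
by field.
Qed.

(** The area formula is known for sets. The measure of a patch is the
    push-forward of Lebesgue measure on the region [S] under the graph of the area
    density, so integrating a function amounts to a change of variables followed
    by Tonelli, with no approximation by simple functions. *)
Lemma surface_integral_chart_ge0 U i b gam (B : set 'rV[R]_n.+1)
    (f : Rtuple R n.+1 -> \bar R) :
  graph_chart Omega U i b gam -> B `<=` U -> measurable (vecd @^-1` B) ->
  (exists x, ~ B x) -> measurable (vecd @^-1` bdry Omega) ->
  measurable_fun setT f -> (forall t, 0 <= f t)%E ->
  (\int[sigma]_(t in vecd @^-1` bdry Omega `&` vecd @^-1` B) f t =
   \int[leb R n]_y (if (gpar i gam (@vec R n y)) \in B then
       f (unvec (gpar i gam (@vec R n y))) * (dens gam (@vec R n y))%:E else 0))%E.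
Proof.
move=> ch BU mB [x0 Bx0] mG mf f0.
have [_ Cg3 _] := ch; have Cg : Ck 1 gam by exact: Cg3.
have [[cA _] _] := continuous_density (Cg3 2%N).
pose G (y : Rtuple R n) : Rtuple R n.+1 := unvec (gpar i gam (@vec R n y)).
have vG y : vecd (G y) = gpar i gam (@vec R n y) by rewrite /G unvecK.
have mGf : measurable_fun setT G.
  apply/measurable_fun_tnthP => j.
  rewrite (_ : _ \o _ = (fun y => gpar i gam y 0 j) \o @vec R n).
    by apply: continuous_measurable; case: (Ck1_gpar i j Cg).
  by apply/funext => y; rewrite /= /G tnth_mktuple.
have mA : measurable_fun setT (dens gam \o @vec R n) by exact: continuous_measurable.
(* [S] is the region under the graph of the area density; [H] maps it onto the
   patch and sends the rest to a point [x0] outside [B]. *)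
pose S : set (Rtuple R n * measurableTypeR R) :=
  [set p | 0 <= p.2 < dens gam (@vec R n p.1)].
have mS : measurable S.
  pose h1 (p : Rtuple R n * measurableTypeR R) : R := p.2.
  pose h2 (p : Rtuple R n * measurableTypeR R) : R := dens gam (@vec R n p.1) - p.2.
  have m1 : measurable_fun setT h1 by exact: measurable_snd.
  have m2 : measurable_fun setT h2.
    apply: measurable_funB => //; apply: (measurableT_comp mA); exact: measurable_fst.
  rewrite (_ : S = (setT `&` h1 @^-1` `[0, +oo[) `&` (setT `&` h2 @^-1` `]0, +oo[)).
    by apply: measurableI; [exact: m1|exact: m2].
  apply/seteqP; split=> [[y s] /= /andP[h0 hA]|[y s] /= [[_ +] [_ +]]].
    by rewrite /h1 /h2 /= !in_itv /= !andbT h0 subr_gt0 hA.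
  by rewrite /h1 /h2 /= !in_itv /= !andbT subr_gt0 => h0 hA; apply/andP.
set D := _ `&` _.
have mD : measurable D by exact: measurableI.
have Dt0 : ~ D (unvec x0) by move=> [_]; rewrite /= unvecK.
pose H (p : Rtuple R n * measurableTypeR R) : Rtuple R n.+1 :=
  if p \in S then G p.1 else unvec x0.
have mH : measurable_fun setT H.
  apply: measurable_fun_ifT => //=.
  - by apply: (measurable_fun_bool true); rewrite setTI (_ : _ @^-1` _ = S) //;
      apply/seteqP; split=> p; [move=> /set_mem|move=> /mem_set].
  - by apply: (measurableT_comp mGf); exact: measurable_fst.
have GD y : (D (G y)) = ((gpar i gam (@vec R n y)) \in B) :> Prop.
  apply/propext; rewrite /D /= vG; split => [[_ By]|/set_mem By]; first exact/mem_set.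
  by split=> //; apply: (gpar_bdry ch); exact: BU.
pose mfH := isMeasurableFun.Build _ _ _ _ H mH.
pose Hm : {mfun _ >-> _} := HB.pack H mfH.
pose mu2 := (leb R n \x @lebesgue_measure R)%E.
transitivity (\int[pushforward mu2 Hm]_(t in D) f t)%E.
  apply: eq_measure_integral => A mA' AD.
  have [_ /(_ U i b gam ch A mA')] := hsigma.
  rewrite (_ : A `&` _ = A); last first.
    by apply/seteqP; split=> [t []//|t At]; split=> //; have [] := AD t At.
  move=> ->; last by move=> t /AD[_ /BU].
  rewrite integral_mkcond /pushforward /mu2 /product_measure1.
  apply: eq_integral => y _; rewrite patchE /=.
  have -> : xsection (H @^-1` A) y =
      if y \in [set y | A (unvec (ins i (gam (@vec R n y)) (@vec R n y)))]
      then `[0, dens gam (@vec R n y)[%classic else set0.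
    apply/seteqP; split=> s; rewrite /xsection /=.
      rewrite in_setE /= /H; case: ifPn => [|_ /AD//].
      rewrite in_setE /S /= => sI Ay; rewrite ifT ?in_itv //; exact/mem_set.
    case: ifPn => //; rewrite in_setE /= in_itv /= => Ay sI.
    by rewrite /H ifT; [exact: (set_mem Ay)|apply: mem_set; exact: sI].
  case: ifPn => _; last by rewrite measure0.
  by rewrite lebesgue_measure_itv /= lte_fin area_density_pos oppr0 adde0.
rewrite ge0_integral_pushforward //; last exact: measurable_funTS.
rewrite integral_mkcond fubini_tonelli1; last 2 first.
- apply/(measurable_restrictT _ _).1.
    by rewrite -[X in measurable X]setTI; exact: (mH measurableT D mD).
  by apply: measurable_funTS; exact: measurableT_comp.
- by move=> p; rewrite patchE; case: ifP => _ //; exact: f0.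
apply: eq_integral => y _; rewrite /fubini_F.
transitivity (\int[@lebesgue_measure R]_(s in `[0%R, dens gam (@vec R n y)[)
   (if gpar i gam (@vec R n y) \in B then f (G y) else 0))%E.
  rewrite [RHS]integral_mkcond; apply: eq_integral => s _; rewrite !patchE.
  have -> : (s \in `[0, dens gam (@vec R n y)[%classic) = ((y, s) \in S).
    by rewrite mem_setE in_itv /=; apply/idP/idP; [move=> h; exact: mem_set|exact: set_mem].
  have [sS|sS] := boolP ((y, s) \in S); last first.
    rewrite ifF //; apply/negbTE/negP; rewrite in_setE /= /H (negbTE sS).
    exact: Dt0.
  have -> : ((y, s) \in H @^-1` D) = (gpar i gam (@vec R n y) \in B).
    by apply/idP/idP => [/set_mem|h]; [|apply: mem_set]; rewrite /= /H sS GD.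
  by rewrite /= /H sS.
case: ifP => _; rewrite integral_cst //= lebesgue_measure_itv /= lte_fin area_density_pos.
  by rewrite oppr0 adde0.
by rewrite mul0e.
Qed.

End SurfaceMeasure.

(** * Integration over the boundary *)

Section SurfaceIntegrals.
Variables (R : realType) (n : nat).
Variable Omega : set 'rV[R]_n.+1.
Variable sigma : {measure set (Rtuple R n.+1) -> \bar R}.
Hypothesis hsigma : is_surface_measure Omega sigma.
Hypothesis hOmega : smooth_bounded_domain Omega.

Local Notation vecd := (@vec R n.+1).
Local Notation dens gam := (@area_density R n.+1 gam).

Lemma closed_bdry : closed (bdry Omega).
Proof.
rewrite /bdry setDE; apply: closedI; first exact: closed_closure.
by apply: open_closedC; exact: open_interior.
Qed.

Lemma domain_norm_bound : exists M : R, forall x, closure Omega x -> `|x| <= M.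
Proof.
have [M [_ HM]] := domain_bounded hOmega.
exists (M + 1) => x cl.
have C : closed [set y : 'rV[R]_n.+1 | `|y| <= M + 1].
  rewrite (_ : [set y | _] = (fun y : 'rV[R]_n.+1 => `|y|) @^-1` [set t | t <= M + 1]) //.
  by apply: preimage_closed => [y _|]; [exact: norm_continuous|exact: closed_le].
apply: (C x); move=> B nB; have [y [Oy By]] := cl B nB.
by exists y; split => //; apply: (HM (M + 1)) => //; rewrite ltrDl.
Qed.

Lemma compact_subset_closure (K : set 'rV[R]_n.+1) : closed K ->
  K `<=` closure Omega -> compact K.
Proof.
move=> cK KO; apply: bounded_closed_compact => //.
have [M HM] := domain_norm_bound.
by exists M; split; [exact: num_real|move=> N MN x /KO /HM xM; exact: le_trans xM (ltW MN)].
Qed.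

Lemma compact_bdry : compact (bdry Omega).
Proof. by apply: compact_subset_closure; [exact: closed_bdry|move=> x []]. Qed.

Lemma compact_closure : compact (closure Omega).
Proof. by apply: compact_subset_closure; [exact: closed_closure|]. Qed.

Lemma measurable_bdry : measurable (vecd @^-1` bdry Omega).
Proof. by apply: closed_measurable_vec; exact: closed_bdry. Qed.

(** On the patch, [u] is given by a function [uh] of the parameters; signed
    functions are reduced to their positive and negative parts. *)
Lemma surface_integral_chart U i b gam (B : set 'rV[R]_n.+1)
    (u : 'rV[R]_n.+1 -> R) (uh : 'rV[R]_n -> R) :
  graph_chart Omega U i b gam -> B `<=` U -> measurable (vecd @^-1` B) ->
  (exists x, ~ B x) -> measurable_fun setT (uh \o @vec R n) ->
  (forall x, bdry Omega x -> B x -> u x = uh (col' i x)) ->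
  (forall x, bdry Omega x -> ~ B x -> u x = 0) ->
  intg sigma (bdry Omega) u =
  Int (fun y => (if gpar i gam y \in B then uh y else 0) * dens gam y).
Proof.
move=> ch BU mB nB muh uE u0; rewrite /intg /Int /intg /Rintegral; congr fine.
have mG := measurable_bdry.
pose F (t : Rtuple R n.+1) : \bar R := (uh (col' i (vecd t)))%:E.
have mF : measurable_fun setT F.
  apply/measurable_EFinP.
  rewrite (_ : (fun t => _) = (uh \o @vec R n) \o
     (fun t : Rtuple R n.+1 => [tuple tnth t (lift i k) | k < n])).
    apply: (measurableT_comp muh); apply/measurable_fun_tnthP => k.
    rewrite (_ : _ \o _ = fun t : Rtuple R n.+1 => tnth t (lift i k)).
      exact: measurable_tnth.
    by apply/funext => t; rewrite /= tnth_mktuple.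
  apply/funext => t; rewrite /=; congr (uh _); apply/rowP => k.
  by rewrite !mxE tnth_mktuple.
transitivity (\int[sigma]_(t in vecd @^-1` bdry Omega `&` vecd @^-1` B) F t)%E.
  rewrite [RHS]integral_mkcondr; apply: eq_integral => t /set_mem bt.
  rewrite patchE; case: ifPn => [/set_mem Bt|]; first by rewrite /F -uE.
  by rewrite notin_setE => nBt; rewrite /= u0.
rewrite [LHS]integralE.
rewrite (surface_integral_chart_ge0 hsigma ch BU mB nB mG (measurable_funepos mF)) //.
rewrite (surface_integral_chart_ge0 hsigma ch BU mB nB mG (measurable_funeneg mF)) //.
rewrite preimage_setT [RHS]integralE; congr (_ - _)%E. apply: eq_integral => y _.
  rewrite !funeposE /= /F unvecK /gpar col'_ins.
  case: ifP => _; last by rewrite mul0r maxxx.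
  rewrite -[0%E]/(0%:E)%E -!EFin_max -EFinM; congr EFin.
  by rewrite maxr_pMl ?mul0r // ltW // area_density_pos.
apply: eq_integral => y _; rewrite !funenegE /= /F unvecK /gpar col'_ins.
case: ifP => _; last by rewrite mul0r oppr0 maxxx.
rewrite -[0%E]/(0%:E)%E -!EFin_max -EFinM; congr EFin.
by rewrite maxr_pMl ?mul0r ?mulNr // ltW // area_density_pos.
Qed.

Lemma chart_ball U i b gam x : graph_chart Omega U i b gam -> U x ->
  exists2 r : R, 0 < r & forall y, `|x - y| <= r -> U y.
Proof.
move=> [oU _ _] Ux; have : nbhs x U by move: oU; rewrite openE => /(_ _ Ux).
move=> /nbhs_ballP[e /= e0 He]; exists (e / 2); first by rewrite divr_gt0.
move=> y xy; apply: He; rewrite -ball_normE /=; apply: le_lt_trans xy _.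
by rewrite ltr_pdivrMr // ltr_pMr // ltr1n.
Qed.

Lemma measurable_vec_closed_ball (x : 'rV[R]_n.+1) (r : R) :
  measurable (vecd @^-1` [set y | `|x - y| <= r]).
Proof.
apply: closed_measurable_vec; apply: compact_closed; first exact: norm_hausdorff.
exact: compact_closed_ball_rV.
Qed.

Lemma closed_ball_proper (x : 'rV[R]_n.+1) (r : R) :
  exists z, ~ [set y | `|x - y| <= r] z.
Proof.
exists (x - (`|r| + 1) *: delta_mx 0 ord0) => /=; rewrite opprB addrC subrK.
apply/negP; rewrite -ltNge; apply: (@lt_le_trans _ _ (`|r| + 1)).
  by rewrite ltr_pwDr // ler_norm.
apply: le_trans (coord_le_norm _ ord0); rewrite !mxE !eqxx mulr1.
exact: ler_norm.
Qed.

Lemma nice_patch_indic U i b gam x r : graph_chart Omega U i b gam ->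
  nice (fun y => if gpar i gam y \in [set z : 'rV[R]_n.+1 | `|x - z| <= r] then 1 else 0 : R).
Proof.
move=> ch; have Cg := chart_Ck1 ch.
set B := [set z | _].
have E : (fun y => if gpar i gam y \in B then 1 else 0 : R) = \1_(gpar i gam @^-1` B).
  by apply/funext => y; rewrite indicE -[y \in _]/(gpar i gam y \in B); case: (_ \in B).
split.
  rewrite E (_ : _ \o _ = \1_(@vec R n @^-1` (gpar i gam @^-1` B))) //.
  apply: measurable_indic; apply: closed_measurable_vec.
  apply: preimage_closed => [y _|]; first exact: continuous_gpar.
  by apply: compact_closed; [exact: norm_hausdorff|exact: compact_closed_ball_rV].
exists (Num.max 1 (`|x| + r)) => y; split.
  by case: ifP => _; rewrite ?normr1 ?normr0 le_max ?lexx ?ler01.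
rewrite gt_max => /andP[_ H]; case: ifP => // /set_mem; rewrite /B /= => xy.
have [_ yg] := norm_ins i (gam y) y.
have : `|gpar i gam y| <= `|x| + r.
  rewrite -[gpar i gam y](subKr x) (le_trans (ler_normB _ _)) // lerD2l; exact: xy.
by move=> /(le_trans yg)/(lt_le_trans H); rewrite ltxx.
Qed.

Lemma sigma_patch_lty U i b gam x r : graph_chart Omega U i b gam ->
  (forall y, `|x - y| <= r -> U y) ->
  (sigma (vecd @^-1` bdry Omega `&` vecd @^-1` [set y | (`|x - y| <= r)%R]) < +oo)%E.
Proof.
move=> ch BU.
have [_ Cg3 _] := ch; have [[cA _] _] := continuous_density (Cg3 2%N).
have mB := measurable_vec_closed_ball x r.
have mD := measurableI _ _ measurable_bdry mB.
rewrite -[X in (X < _)%E]mul1e -integral_cst //.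
rewrite (@surface_integral_chart_ge0 _ _ _ _ hsigma _ _ _ _ _ (cst 1%E) ch BU mB
  (closed_ball_proper x r) measurable_bdry) //.
have := nice_integrable (nice_mul_continuous (nice_patch_indic x r ch) cA).
move=> /integrable_fin_num-/(_ measurableT).
rewrite fin_num_abs => /(le_lt_trans (lee_abs _)); apply: le_lt_trans.
rewrite le_eqVlt; apply/orP; left; apply/eqP; apply: eq_integral => y _ /=.
by case: ifP => _; rewrite ?mul1e ?mul0r ?mul1r.
Qed.

(** Finitely many closed balls contained in charts cover the compact boundary, and
    on each of them the area density is bounded. *)
Lemma sigma_bdry_lty : (sigma (vecd @^-1` bdry Omega) < +oo)%E.
Proof.
have /choice[r Hr] : forall x, exists r : R, bdry Omega x -> 0 < r /\
    (sigma (vecd @^-1` bdry Omega `&` vecd @^-1` [set y | (`|x - y| <= r)%R]) < +oo)%E.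
  move=> x; have [bx|nbx] := pselect (bdry Omega x); last by exists 0.
  have [U [i [b [gam [ch Ux]]]]] := domain_bdry_smooth hOmega bx.
  have [r r0 HU] := chart_ball ch Ux; exists r => _; split => //.
  exact: (sigma_patch_lty ch).
have [D DK Dcov] : finite_subset_cover (bdry Omega) (fun x => ball x (r x)) (bdry Omega).
  have := compact_bdry; rewrite compact_cover; apply => [x _|x Kx]; first exact: ball_open.
  by exists x => //; apply: ballxx; have [r0 _] := Hr x Kx.
pose B x := vecd @^-1` bdry Omega `&` vecd @^-1` [set y | `|x - y| <= r x].
have mB x : measurable (B x).
  by apply: measurableI; [exact: measurable_bdry|exact: measurable_vec_closed_ball].
suff P (e : seq 'rV[R]_n.+1) : {subset e <= bdry Omega} ->
    measurable (\big[setU/set0]_(c <- e) B c) /\ (sigma (\big[setU/set0]_(c <- e) B c) < +oo)%E.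
  have [mU Ufin] := P (finmap.enum_fset D) DK.
  apply: le_lt_trans Ufin; apply: le_measure; rewrite ?inE //; first exact: measurable_bdry.
  move=> t bt; have [c Dc Hc] := Dcov _ bt.
  rewrite -bigcup_seq; exists c => //; split => //=.
  by move: Hc; rewrite -ball_normE /= => /ltW.
elim: e => [|c e IH] eK; first by rewrite big_nil measure0.
have [mU Uf] : measurable (\big[setU/set0]_(c <- e) B c) /\
    (sigma (\big[setU/set0]_(c <- e) B c) < +oo)%E.
  by apply: IH => x xe; apply: eK; rewrite inE xe orbT.
rewrite big_cons; split; first exact: measurableU.
apply: (le_lt_trans (measureU2 sigma (mB c) mU)); apply: lte_add_pinfty => //.
by have /set_mem Kc := eK c (mem_head _ _); have [_] := Hr c Kc.
Qed.

Lemma surface_integrable u : {within bdry Omega, continuous u} ->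
  sigma.-integrable (vecd @^-1` bdry Omega) (EFin \o (u \o vecd)).
Proof.
move=> cu; apply: measurable_bounded_integrable.
- exact: measurable_bdry.
- exact: sigma_bdry_lty.
- by apply: within_continuous_measurable => //; exact: measurable_bdry.
- have [M HM] := compact_norm_bound compact_bdry cu.
  exists M; split; first exact: num_real.
  by move=> N MN t bt /=; rewrite (le_trans (HM _ bt)) ?ltW.
Qed.

(** Continuity along the boundary is local and may be checked in the parameters. *)
Lemma within_bdry_continuous (u : 'rV[R]_n.+1 -> R) :
  (forall U i b gam, graph_chart Omega U i b gam -> exists2 uh : 'rV[R]_n -> R,
     continuous uh & forall x, U x -> bdry Omega x -> u x = uh (col' i x)) ->
  {within bdry Omega, continuous u}.
Proof.
move=> H; apply/subspace_continuousP => x bx.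
have [U [i [b [gam [ch Ux]]]]] := domain_bdry_smooth hOmega bx.
have [uh cuh E] := H _ _ _ _ ch.
rewrite /from_subspace (E x) //.
have cc : continuous (fun z : 'rV[R]_n.+1 => uh (col' i z)).
  move=> z; apply: (@continuous_comp _ _ _ (fun z : 'rV[R]_n.+1 => col' i z) uh); last exact: cuh.
  move: z; apply: continuous_rV => j.
  rewrite (_ : (fun z => _) = fun z : 'rV[R]_n.+1 => z 0 (lift i j)); first exact: continuous_coord.
  by apply/funext => z; rewrite mxE.
have [oU _ _] := ch.
have nU : nbhs x U by move: oU; rewrite openE => /(_ _ Ux).
apply: cvg_trans (cvg_within_filter _ (cc x)).
apply: near_eq_cvg; rewrite near_withinE.
by apply: filterS nU => y Uy bY; rewrite E.
Qed.

End SurfaceIntegrals.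

(** * Symmetry of second derivatives *)

Section SymmetricDerivatives.
Variable R : realType.

Lemma derive_translate n (u : 'rV[R]_n -> R) (c y v : 'rV[R]_n) :
  derivable u (y + c) v ->
  derivable (fun z => u (z + c)) y v /\
  'D_v (fun z => u (z + c)) y = 'D_v u (y + c).
Proof.
have E : (fun h : R => h^-1 *: (((fun z => u (z + c)) \o shift y) (h *: v) - u (y + c))) =
    (fun h : R => h^-1 *: ((u \o shift (y + c)) (h *: v) - u (y + c))).
  by apply/funext => h /=; rewrite addrA.
by rewrite /derivable /derive E.
Qed.

(** Two applications of the mean value theorem, first in direction [k], then in
    direction [l]. *)
Lemma second_difference n (u : 'rV[R]_n -> R) (k l : 'I_n) (x : 'rV[R]_n) (h : R) :
  Ck 2 u -> exists2 a : 'rV[R]_n, `|x - a| <= 2 * `|h| &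
    u (x + h *: delta_mx 0 k + h *: delta_mx 0 l) - u (x + h *: delta_mx 0 k)
    - (u (x + h *: delta_mx 0 l) - u x) = h * (h * partial l (partial k u) a).
Proof.
move=> [_ C2].
have du y : derivable u y (delta_mx 0 k) by case: (C2 k).
have ddu y : derivable (partial k u) y (delta_mx 0 l) by case: (C2 k) => _ [_ /(_ l)[]].
set e := delta_mx 0 k; set f := delta_mx 0 l.
pose w z := u (z + h *: f) - u z.
have dw y : derivable w y e.
  apply: derivableB; last exact: du.
  exact: (proj1 (derive_translate (du _))).
have [s sh Es] := MVT_line x h dw.
have Ew y : 'D_e w y = partial k u (y + h *: f) - partial k u y.
  have [d1 d2] := derive_translate (du (y + h *: f)).
  by rewrite /w (deriveB d1 (du y)) d2.
have [t th Et] := MVT_line (x + s *: e) h ddu.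
exists (x + s *: e + t *: f).
  rewrite -addrA opprD addrA subrr add0r normrN mulr2n mulrDl mul1r.
  apply: (le_trans (ler_normD _ _)); apply: lerD.
    apply: norm_le_coord => // j; rewrite !mxE eqxx /= normrM.
    rewrite (le_trans _ sh) // ler_piMr //.
    by case: (j == k); rewrite ?normr1 ?normr0.
  apply: norm_le_coord => // j; rewrite !mxE eqxx /= normrM.
  rewrite (le_trans _ th) // ler_piMr //.
  by case: (j == l); rewrite ?normr1 ?normr0.
by rewrite -Et -Ew -Es.
Qed.

(** By the previous lemma both mixed derivatives, taken at points close to [x],
    equal the same second difference quotient. *)
Lemma partial_comm n (u : 'rV[R]_n -> R) (k l : 'I_n) (x : 'rV[R]_n) : Ck 2 u ->
  partial l (partial k u) x = partial k (partial l u) x.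
Proof.
move=> Cu.
have c a b : continuous (partial b (partial a u)) by case: Cu => _ /(_ a)[_ [_ /(_ b)[_ ]]].
apply/eqP; rewrite -subr_eq0 -normr_le0; apply/ler_addgt0Pr => e e0; rewrite add0r.
have e2 : 0 < e / 2 by rewrite divr_gt0.
have N1 : \forall y \near x, `|partial l (partial k u) x - partial l (partial k u) y| < e / 2.
  by move/cvgrPdist_lt : (c k l x); apply.
have N2 : \forall y \near x, `|partial k (partial l u) x - partial k (partial l u) y| < e / 2.
  by move/cvgrPdist_lt : (c l k x); apply.
have [r /= r0 Hr] := (nbhs_ballP _ _).1 (filterI N1 N2).
(* The intermediate points are at distance at most [2 * h] from [x]. *)
pose h : R := r / 4.
have h0 : 0 < h by rewrite divr_gt0.
have hr : 2 * `|h| < r by rewrite gtr0_norm // /h; move: r0; clear; lra.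
have [a xa Ea] := second_difference k l x h Cu.
have [b xb Eb] := second_difference l k x h Cu.
have ab : partial l (partial k u) a = partial k (partial l u) b.
  have h1 : h != 0 by rewrite gt_eqF.
  suff E : h * (h * partial l (partial k u) a) = h * (h * partial k (partial l u) b).
    by have := mulfI h1 E => /(mulfI h1).
  have sw (p q s t : R) : p - q - (s - t) = p - s - (q - t) by ring.
  refine (etrans (esym Ea) (etrans _ Eb)).
  have -> : x + h *: delta_mx 0 l + h *: delta_mx 0 k =
      x + h *: delta_mx 0 k + h *: delta_mx 0 l by rewrite addrAC.
  exact: sw.
have Ba : ball x r a by rewrite -ball_normE /=; exact: le_lt_trans hr.
have Bb : ball x r b by rewrite -ball_normE /=; exact: le_lt_trans hr.
have [Ha _] := Hr a Ba; have [_ Hb] := Hr b Bb.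
have sw (p q t : R) : p - q = (p - t) - (q - t) by ring.
rewrite (sw _ _ (partial l (partial k u) a)) [in X in _ - X]ab.
apply: (le_trans (ler_normB _ _)); rewrite [leRHS](splitr e).
exact: lerD (ltW Ha) (ltW Hb).
Qed.

End SymmetricDerivatives.

(** * Tangential divergence on a graph *)

Section GraphDivergence.
Variables (R : realType) (n : nat).
Implicit Types (i : 'I_n.+1) (gam : 'rV[R]_n -> R) (W : 'rV[R]_n.+1 -> R).
Local Notation dens gam := (@area_density R n.+1 gam).

(** The components of the tangential gradient of [W], as functions of the
    parameters; the entries off [i] are the contravariant components. *)
Definition tX i gam W (j : 'I_n.+1) (y : 'rV[R]_n) : R :=
  tvec i (grad gam y) (grad (fun z => W (gpar i gam z)) y) 0 j.

Lemma Ck2_Ck1 m (u : 'rV[R]_m -> R) : Ck 2 u -> Ck 1 u.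
Proof.
move=> [cu H]; split=> // k; have [d C] := H k.
by split => //; case: C.
Qed.

Lemma Ck2_partial m (u : 'rV[R]_m -> R) k : Ck 2 u -> Ck 1 (partial k u).
Proof. by move=> [_ /(_ k)[_]]. Qed.

(** The explicit first derivatives only involve C^1 ingredients. *)
Lemma Ck2_comp_gpar i gam W k : Ck 2 gam -> Ck 2 W ->
  Ck 1 (partial k (fun z => W (gpar i gam z))).
Proof.
move=> Cg CW; have Cg1 := Ck2_Ck1 Cg; have CW1 := Ck2_Ck1 CW.
have [_ E] := Ck1_comp_gpar i Cg1 CW1.
rewrite (_ : partial k _ = fun y =>
   partial (lift i k) W (gpar i gam y) + partial k gam y * partial i W (gpar i gam y)).
  apply: Ck1_add.
    by have [] := Ck1_comp_gpar i Cg1 (Ck2_partial (lift i k) CW).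
  apply: Ck1_mul; first exact: Ck2_partial.
  by have [] := Ck1_comp_gpar i Cg1 (Ck2_partial i CW).
by apply/funext => y; rewrite E.
Qed.

Lemma tvec_lift i (g a : 'rV[R]_n) k :
  tvec i g a 0 (lift i k) = a 0 k - dotv a g / (1 + dotv g g) * g 0 k.
Proof. by rewrite /tvec ins_lift !mxE. Qed.

Lemma tvec_at i (g a : 'rV[R]_n) : tvec i g a 0 i = dotv a g / (1 + dotv g g).
Proof. by rewrite /tvec ins_at. Qed.

Lemma Ck1_tvec i gam (a : 'I_n -> 'rV[R]_n -> R) j : Ck 2 gam ->
  (forall k, Ck 1 (a k)) ->
  Ck 1 (fun y => tvec i (grad gam y) (\row_k a k y) 0 j).
Proof.
move=> Cg Ca; have Cp k : Ck 1 (partial k gam) by exact: Ck2_partial.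
pose s y := \sum_k partial k gam y * partial k gam y.
have s0 y : 0 < 1 + s y.
  by rewrite ltr_pwDl // sumr_ge0 // => l _; rewrite -expr2 sqr_ge0.
have Cs : Ck 1 (fun y => 1 + s y).
  apply: Ck1_add; first exact: Ck1_cst.
  by apply: Ck1_sum => k; exact: Ck1_mul.
pose q y := (\sum_k a k y * partial k gam y) * (1 + s y)^-1.
have Cq : Ck 1 q.
  apply: Ck1_mul; last by have [] := Ck1_inv s0 Cs.
  by apply: Ck1_sum => k; exact: Ck1_mul.
have qE y : dotv (\row_k a k y) (grad gam y) / (1 + dotv (grad gam y) (grad gam y)) = q y.
  rewrite /q /s /dotv; congr (_ / (1 + _)); apply: eq_bigr => k _; by rewrite !mxE.
case: (unliftP i j) => [k ->|->].
  rewrite (_ : (fun y => _) = fun y => a k y - q y * partial k gam y).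
    by apply: Ck1_sub => //; exact: Ck1_mul.
  by apply/funext => y; rewrite /tvec ins_lift qE !mxE.
rewrite (_ : (fun y => _) = q) //.
by apply/funext => y; rewrite /tvec ins_at qE.
Qed.

Lemma Ck1_tX i gam W j : Ck 2 gam -> Ck 2 W -> Ck 1 (tX i gam W j).
Proof.
move=> Cg CW; apply: (@Ck1_tvec i gam (fun k => partial k (fun z => W (gpar i gam z)))) => //.
by move=> k; exact: Ck2_comp_gpar.
Qed.

Lemma tvec_ins i (g a : 'rV[R]_n) :
  tvec i g a = ins i (dotv (col' i (tvec i g a)) g) (col' i (tvec i g a)).
Proof.
rewrite /tvec col'_ins dotvBl dotvZl.
set q := _ / _; congr (ins _ _ _).
have d0 : 0 < 1 + dotv g g by have := dotv_ge0 g; lra.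
have -> : dotv a g = q * (1 + dotv g g) by rewrite /q divfK // gt_eqF.
by ring.
Qed.

(** The scalar product of a tangent vector with a tangential gradient is the
    derivative along that vector. *)
Lemma dotv_tvec i (g X c : 'rV[R]_n) :
  dotv (ins i (dotv X g) X) (tvec i g c) = dotv X c.
Proof. by rewrite /tvec dotv_ins dotvBr dotvZr; ring. Qed.

(** Tangency: the [i]-th component is determined by the others. *)
Lemma tX_normal i gam W y :
  tX i gam W i y = \sum_k partial k gam y * tX i gam W (lift i k) y.
Proof.
rewrite {1}/tX tvec_ins ins_at /dotv; apply: eq_bigr => k _.
by rewrite mulrC /tX; congr (_ * _); rewrite mxE.
Qed.

(** Differentiating the tangency relation expresses the divergence through the
    contravariant components; by symmetry of the second derivatives of [gam], the
    remaining terms assemble into the logarithmic derivative of the area density. *)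
Lemma graph_divergence i gam W y : Ck 2 gam -> Ck 2 W ->
  \sum_j tvec i (grad gam y) (grad (tX i gam W j) y) 0 j =
  \sum_k partial k (tX i gam W (lift i k)) y +
  (\sum_k tX i gam W (lift i k) y * (partial k (dens gam) y * dens gam y)) / dens gam y ^+ 2.
Proof.
move=> Cg CW; have CX j := Ck1_tX i j Cg CW.
have Cp k : Ck 1 (partial k gam) by exact: Ck2_partial.
have [_ dd] := continuous_density Cg.
set g := grad gam y; set A := dens gam y.
have A0 : A != 0 by rewrite gt_eqF // area_density_pos.
have A2 : A ^+ 2 = 1 + dotv g g by exact: area_density_sqr.
rewrite (sum_ins i) tvec_at -A2.
rewrite (eq_bigr (fun k => partial k (tX i gam W (lift i k)) y -
    dotv (grad (tX i gam W (lift i k)) y) g / A ^+ 2 * partial k gam y)); last first.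
  by move=> k _; rewrite tvec_lift -A2 [grad _ _ 0 k]mxE [g 0 k]mxE.
rewrite sumrB addrCA; congr (_ + _).
under [X in _ - X]eq_bigr => k _ do rewrite mulrAC.
rewrite -mulr_suml -mulrBl; congr (_ / _).
have -> : dotv (grad (tX i gam W i) y) g = \sum_l (\sum_k
    (partial k gam y * partial l (tX i gam W (lift i k)) y +
     tX i gam W (lift i k) y * partial l (partial k gam) y)) * partial l gam y.
  rewrite /dotv; apply: eq_bigr => l _; rewrite [g 0 l]mxE [grad _ _ 0 l]mxE; congr (_ * _).
  rewrite (_ : tX i gam W i = fun z => \sum_k partial k gam z * tX i gam W (lift i k) z); last first.
    by apply/funext => z; exact: tX_normal.
  rewrite partial_sum; last by move=> k; exact: Ck1_mul.
  by apply: eq_bigr => k _; rewrite (partialM _ _ (Cp k) (CX (lift i k))).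
have -> : \sum_k dotv (grad (tX i gam W (lift i k)) y) g * partial k gam y =
    \sum_l (\sum_k partial k gam y * partial l (tX i gam W (lift i k)) y) * partial l gam y.
  rewrite /dotv; under eq_bigr do rewrite mulr_suml.
  rewrite exchange_big; apply: eq_bigr => l _; rewrite mulr_suml; apply: eq_bigr => k _.
  by rewrite [grad _ _ 0 l]mxE [g 0 l]mxE; ring.
rewrite -sumrB.
under eq_bigr => l _ do rewrite -mulrBl -sumrB.
transitivity (\sum_l \sum_k tX i gam W (lift i k) y *
    (partial l gam y * partial k (partial l gam) y)).
  apply: eq_bigr => l _; rewrite mulr_suml; apply: eq_bigr => k _.
  by rewrite (partial_comm k l y Cg); ring.
rewrite exchange_big; apply: eq_bigr => k _; rewrite dd divfK // mulr_sumr.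
by apply: eq_bigr.
Qed.

(** The classical formula for the divergence in local coordinates: times the area
    density, the integrand of the surface Green identity is a sum of coordinate
    derivatives, hence integrates to zero. *)
Lemma graph_divergence_product i gam W (vh : 'rV[R]_n -> R) y :
  Ck 2 gam -> Ck 2 W -> Ck 1 vh ->
  (dotv (tvec i (grad gam y) (grad (fun z => W (gpar i gam z)) y))
        (tvec i (grad gam y) (grad vh y)) +
   (\sum_j tvec i (grad gam y) (grad (tX i gam W j) y) 0 j) * vh y) * dens gam y =
  \sum_k partial k (fun z => dens gam z * (tX i gam W (lift i k) z * vh z)) y.
Proof.
move=> Cg CW Cv; have CX j := Ck1_tX i j Cg CW.
have [Cd dd] := continuous_density Cg.
rewrite graph_divergence // tvec_ins dotv_tvec.
have A0 : dens gam y != 0 by rewrite gt_eqF // area_density_pos.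
have E k : partial k (fun z => dens gam z * (tX i gam W (lift i k) z * vh z)) y =
   dens gam y * (tX i gam W (lift i k) y * partial k vh y) +
   dens gam y * (vh y * partial k (tX i gam W (lift i k)) y) +
   tX i gam W (lift i k) y * vh y * partial k (dens gam) y.
  rewrite (partialM _ _ Cd (Ck1_mul (CX _) Cv)) (partialM _ _ (CX _) Cv).
  by ring.
under [RHS]eq_bigr do rewrite E.
rewrite !big_split /= -!mulr_sumr.
have -> : dotv (col' i (tvec i (grad gam y) (grad (fun z => W (gpar i gam z)) y))) (grad vh y)
   = \sum_k tX i gam W (lift i k) y * partial k vh y.
  by rewrite /dotv; apply: eq_bigr => k _; rewrite /tX; congr (_ * _); rewrite mxE.
have -> : \sum_k tX i gam W (lift i k) y * vh y * partial k (dens gam) y =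
   (\sum_k tX i gam W (lift i k) y * (partial k (dens gam) y * dens gam y)) / dens gam y * vh y.
  rewrite !mulr_suml; apply: eq_bigr => k _; field => //.
by field.
Qed.

End GraphDivergence.

(** * Surface Green identity in one chart *)

Section LocalGreen.
Variables (R : realType) (n : nat).
Variable Omega : set 'rV[R]_n.+1.
Variable sigma : {measure set (Rtuple R n.+1) -> \bar R}.
Hypothesis hsigma : is_surface_measure Omega sigma.
Hypothesis hOmega : smooth_bounded_domain Omega.

Local Notation dens gam := (@area_density R n.+1 gam).

Lemma chart_Ck2 U i b gam : graph_chart Omega U i b gam -> Ck 2 gam.
Proof. by case=> _ + _; exact. Qed.

Lemma tgrad_gpar U i b gam (w W : 'rV[R]_n.+1 -> R) z :
  graph_chart Omega U i b gam -> Ck 1 W -> (forall z, bdry Omega z -> w z = W z) ->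
  U z -> bdry Omega z ->
  tgrad Omega w z = tvec i (grad gam (col' i z)) (grad (fun y => W (gpar i gam y)) (col' i z)).
Proof.
move=> ch CW wW Uz bz; have Cg := chart_Ck1 ch.
apply: (tgrad_chart ch Uz bz); first by have [] := Ck1_comp_gpar i Cg CW.
by move=> y Uy bY; rewrite wW // -(bdry_gpar ch Uy bY).
Qed.

Lemma lapB_gpar U i b gam (w W : 'rV[R]_n.+1 -> R) z :
  graph_chart Omega U i b gam -> Ck 2 W -> (forall z, bdry Omega z -> w z = W z) ->
  U z -> bdry Omega z ->
  lapB Omega w z =
    \sum_j tvec i (grad gam (col' i z)) (grad (tX i gam W j) (col' i z)) 0 j.
Proof.
move=> ch CW wW Uz bz; rewrite /lapB; apply: eq_bigr => j _.
rewrite (@tgrad_chart _ _ _ U i b gam z _ (tX i gam W j)) //.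
  by apply: Ck1_tX => //; exact: chart_Ck2 ch.
by move=> y Uy bY; rewrite (tgrad_gpar ch (Ck2_Ck1 CW) wW).
Qed.

(** The tangential gradient depends only on the germ of the function; this is used
    for test functions that vanish near a point. *)
Lemma near_eq_tgrad (w w' : 'rV[R]_n.+1 -> R) z :
  (\forall y \near z, w y = w' y) -> tgrad Omega w z = tgrad Omega w' z.
Proof.
move=> ww'; rewrite /tgrad.
rewrite (_ : [set W | differentiable W z /\ (\forall y \near z, bdry Omega y -> W y = w y)] =
  [set W | differentiable W z /\ (\forall y \near z, bdry Omega y -> W y = w' y)]) //.
apply/seteqP; split=> W [dW H]; split=> //.
  by apply: filterS2 ww' H => y E H bY; rewrite H.
by apply: filterS2 ww' H => y E H bY; rewrite E H.
Qed.

Lemma tvec0 i (g : 'rV[R]_n) : tvec i g 0 = 0.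
Proof.
have d0 : dotv 0 g = 0 by rewrite -(scale0r g) dotvZl mul0r.
rewrite /tvec d0 mul0r scale0r subr0; apply/rowP => j.
by case: (unliftP i j) => [k ->|->]; rewrite ?ins_at ?ins_lift !mxE.
Qed.

Lemma tgrad_near0 (w : 'rV[R]_n.+1 -> R) z : bdry Omega z ->
  (\forall y \near z, w y = 0) -> tgrad Omega w z = 0.
Proof.
move=> bz /near_eq_tgrad ->.
have [U [i [b [gam [ch Uz]]]]] := domain_bdry_smooth hOmega bz.
rewrite (tgrad_gpar (W := fun=> 0) ch (Ck1_cst _ _)) //.
have -> : grad (fun y : 'rV[R]_n => 0 : R) (col' i z) = 0.
  by apply/rowP => k; rewrite !mxE partial_cst.
exact: tvec0.
Qed.

Lemma nice_sum m p (F : 'I_p -> 'rV[R]_m -> R) : (forall k, nice (F k)) ->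
  nice (fun y => \sum_k F k y) /\ Int (fun y => \sum_k F k y) = \sum_k Int (F k).
Proof.
elim: p F => [|p IH] F nF.
  rewrite (_ : (fun y => _) = fun=> 0); last by apply/funext => y; rewrite big_ord0.
  rewrite Int0 big_ord0; split => //.
  by apply: (@nice_continuous _ _ _ 0) => //; exact: continuous_cst.
have [ns Is] := IH (fun k => F (lift ord0 k)) (fun k => nF _).
rewrite (_ : (fun y => _) = fun y => F ord0 y + \sum_k F (lift ord0 k) y); last first.
  by apply/funext => y; rewrite big_ord_recl.
by rewrite big_ord_recl Int_add // -Is; split => //; exact: nice_add.
Qed.

Lemma far_near (x z : 'rV[R]_n.+1) (r : R) : r < `|x - z| ->
  \forall y \near z, r < `|x - y|.
Proof.
move=> rz; have C : continuous (fun y : 'rV[R]_n.+1 => `|x - y|).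
  move=> y; apply: (@continuous_comp _ _ _ (fun y : 'rV[R]_n.+1 => x - y) (fun z => `|z|)).
    move: y; apply: continuous_rV => j.
    rewrite (_ : (fun y => _) = fun y : 'rV[R]_n.+1 => x 0 j + - y 0 j).
      apply: continuous_add; first exact: continuous_cst.
      by apply: continuous_opp; exact: continuous_coord.
    by apply/funext => y; rewrite !mxE.
  exact: norm_continuous.
exact: (cvgr_gt _ (C z)).
Qed.

Lemma gpar_far i gam (x : 'rV[R]_n.+1) (r : R) y : `|x| + r < `|y| -> r < `|x - gpar i gam y|.
Proof.
move=> H; have [_ yg] := norm_ins i (gam y) y.
have H2 : `|gpar i gam y| <= `|x| + `|x - gpar i gam y|.
  by rewrite -{1}[gpar i gam y](subKr x); exact: ler_normB.
by have := le_trans yg H2; move: H; move: `|x - _| => t; lra.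
Qed.

(** In the chart around the support of [v], the integral becomes that of a
    sum of partial derivatives of compactly supported functions. *)
Lemma surface_green_local U i b gam (x : 'rV[R]_n.+1) r (w W v : 'rV[R]_n.+1 -> R) :
  graph_chart Omega U i b gam -> (forall y, `|x - y| <= r -> U y) ->
  Ck 2 W -> (forall z, bdry Omega z -> w z = W z) ->
  Ck 1 v -> (forall y, r <= `|x - y| -> v y = 0) ->
  intg sigma (bdry Omega)
    (fun z => dotv (tgrad Omega w z) (tgrad Omega v z) + lapB Omega w z * v z) = 0.
Proof.
move=> ch BU CW wW Cv v0; have Cg1 := chart_Ck1 ch; have Cg := chart_Ck2 ch.
have [Cvh Evh] := Ck1_comp_gpar i Cg1 Cv.
set vh := fun y => v (gpar i gam y) in Cvh.
have [Cd _] := continuous_density Cg.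
pose Y k y := dens gam y * (tX i gam W (lift i k) y * vh y).
have CY k : Ck 1 (Y k) by apply: Ck1_mul => //; apply: Ck1_mul => //; exact: Ck1_tX.
have Y0 k y : `|x| + r < `|y| -> Y k y = 0.
  by move=> H; rewrite /Y /vh v0 ?mulr0 // ltW // gpar_far.
(* [uh] is the integrand in the parameters, [Y] the field of which it is the
   divergence. *)
pose uh y := dotv (tvec i (grad gam y) (grad (fun z => W (gpar i gam z)) y))
                  (tvec i (grad gam y) (grad vh y)) +
   (\sum_j tvec i (grad gam y) (grad (tX i gam W j) y) 0 j) * vh y.
have uhE y : uh y = (\sum_k partial k (Y k) y) / dens gam y.
  by rewrite -graph_divergence_product // mulfK // gt_eqF // area_density_pos.
have muh : measurable_fun setT (uh \o @vec R n).
  apply: continuous_measurable; rewrite (_ : uh = fun y => (\sum_k partial k (Y k) y) / dens gam y).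
    apply: continuous_mul.
      by apply: continuous_sum_ord => k; case: (CY k) => _ /(_ k)[].
    by have [[]] := Ck1_inv (@area_density_pos R n gam) Cd.
  by apply/funext => y; rewrite uhE.
set B := [set y : 'rV[R]_n.+1 | `|x - y| <= r].
rewrite (@surface_integral_chart _ _ _ _ hsigma U i b gam B _ uh ch BU
  (measurable_vec_closed_ball x r) (closed_ball_proper x r) muh); first last.
- move=> z bz /negP; rewrite -ltNge => rz.
  rewrite v0 ?mulr0 ?addr0 ?ltW // (tgrad_near0 (w := v) bz); last first.
    by apply: (filterS _ (far_near rz)) => y H; apply: v0; exact: ltW.
  by rewrite -(scale0r (tgrad Omega w z)) dotvZr mul0r.
- move=> z bz Bz; have Uz := BU z Bz.
  rewrite (tgrad_gpar ch (Ck2_Ck1 CW) wW Uz bz) (tgrad_gpar ch Cv _ Uz bz) //.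
  rewrite (lapB_gpar ch CW wW Uz bz) /uh /vh -(bdry_gpar ch Uz bz).
  by [].
have nY k : nice (partial k (Y k)) := nice_partial k (CY k) (Y0 k).
have [_ IY] := nice_sum nY.
transitivity (Int (fun y => \sum_k partial k (Y k) y)); last first.
  by rewrite IY big1 // => k _; exact: Int_partial (CY k) (Y0 k).
congr Int; apply/funext => y; case: ifPn => [_|].
  by rewrite uhE divfK // gt_eqF // area_density_pos.
rewrite notin_setE /B /= => /negP; rewrite -ltNge => rz.
rewrite mul0r big1 // => k _.
have -> : 0 = partial k (fun=> 0) y by rewrite partial_cst.
apply/esym/near_eq_partial.
have cg : gpar i gam @ y --> gpar i gam y by exact: continuous_gpar.
have N : \forall z \near y, r < `|x - gpar i gam z| := cg _ (far_near rz).
by apply: (filterS _ N) => z H; rewrite /Y /vh v0 ?mulr0 // ltW.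
Qed.

End LocalGreen.

(** * Divergence theorem in one chart *)

Section LocalDivergence.
Variables (R : realType) (n : nat).
Variable Omega : set 'rV[R]_n.+1.
Variable sigma : {measure set (Rtuple R n.+1) -> \bar R}.
Hypothesis hsigma : is_surface_measure Omega sigma.
Hypothesis hOmega : smooth_bounded_domain Omega.

Local Notation vecd := (@vec R n.+1).
Local Notation dens gam := (@area_density R n.+1 gam).

(** The slope for which the field [partial j + gslope j * partial i] is tangent to
    all translates of the graph, that is, kills the defining function. The value
    -1 for [j = i] makes the field zero. *)
Definition gslope (i : 'I_n.+1) (gam : 'rV[R]_n -> R) (j : 'I_n.+1) (y : 'rV[R]_n) : R :=
  if unlift i j is Some k then partial k gam y else -1.

Lemma gslope_normal (i : 'I_n.+1) (gam : 'rV[R]_n -> R) j y :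
  ins i 1 (- grad gam y) 0 j = - gslope i gam j y.
Proof.
rewrite /gslope; case: (unliftP i j) => [k ->|->]; last by rewrite ins_at opprK.
by rewrite ins_lift !mxE.
Qed.

Lemma Ck1_gslope (i : 'I_n.+1) (gam : 'rV[R]_n -> R) j : Ck 2 gam -> Ck 1 (gslope i gam j).
Proof.
move=> Cg; rewrite /gslope; case: (unlift i j) => [k|]; last exact: Ck1_cst.
exact: Ck2_partial.
Qed.

(** Only the existence of the factor matters: the derivatives of the cut-off are
    proportional to those of [rho]. *)
Lemma smoothstep_chain m (rho : 'rV[R]_m -> R) (c : R) : Ck 1 rho ->
  exists kap : 'rV[R]_m -> R, forall j z,
    partial j (fun z => smoothstep (1 + c * rho z)) z = kap z * partial j rho z.
Proof.
move=> Cr; have [d cd] := sqpos_C1 R.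
have Cu : Ck 1 (fun z => 1 + c * rho z).
  by apply: Ck1_add; [exact: Ck1_cst|apply: Ck1_mul => //; exact: Ck1_cst].
have [C1 E1] := Ck1_comp1 (fun z => d _) (fun z => cd _) Cu.
have C2 := Ck1_sub (Ck1_cst m (1 : R)) C1.
have [_ E2] := Ck1_comp1 (fun z => d _) (fun z => cd _) C2.
exists (fun z => derive1 (@sqpos R) (1 - sqpos (1 + c * rho z)) *
   - (derive1 (@sqpos R) (1 + c * rho z) * c)) => j z.
rewrite [LHS]E2 (partialD _ _ (Ck1_cst _ _) (Ck1_opp C1)) partial_cst add0r partialN // E1.
rewrite (partialD _ _ (Ck1_cst _ _) (Ck1_mul (Ck1_cst _ _) Cr)) partial_cst add0r.
rewrite (partialM _ _ (Ck1_cst _ _) Cr) partial_cst mulr0 addr0.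
by rewrite -mulrA mulNr mulrA.
Qed.

(** The slope does not depend on the [i]-th coordinate. *)
Lemma partial_normal_cyl (i : 'I_n.+1) (w : 'rV[R]_n -> R) (z : 'rV[R]_n.+1) : Ck 1 w ->
  partial i (fun x : 'rV[R]_n.+1 => w (col' i x)) z = 0.
Proof.
move=> Cw; have [_ /(_ z)] := Ck1_col' i Cw.
by move=> /rowP/(_ i); rewrite mxE ins_at.
Qed.

(** The tangent field kills any function of the defining function, and it is
    divergence free; so the smoothed indicator can be moved under the derivative
    and the integral vanishes. *)
Lemma Int_tangential (i : 'I_n.+1) b (gam : 'rV[R]_n -> R) (h : 'rV[R]_n.+1 -> R) j (M c : R) :
  Ck 2 gam -> Ck 1 h -> (forall x, M < `|x| -> h x = 0) ->
  Int (fun z => smoothstep (1 + c * defun i b gam z) *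
    (partial j h z + gslope i gam j (col' i z) * partial i h z)) = 0.
Proof.
move=> Cg Ch h0; have [Cr gr] := Ck1_defun i b (Ck2_Ck1 Cg).
have CG := Ck1_gslope i j Cg.
have [CGc _] := Ck1_col' i CG.
have [kap kE] := smoothstep_chain c Cr.
pose chi z := smoothstep (1 + c * defun i b gam z).
have Cchi : Ck 1 chi.
  apply: Ck1_smoothstep; apply: Ck1_add; first exact: Ck1_cst.
  by apply: Ck1_mul => //; exact: Ck1_cst.
pose u z := chi z * h z.
have Cu : Ck 1 u by exact: Ck1_mul.
have u0 x : M < `|x| -> u x = 0 by move=> Mx; rewrite /u h0 // mulr0.
pose Gu (z : 'rV[R]_n.+1) := gslope i gam j (col' i z) * u z.
have CGu : Ck 1 Gu by exact: Ck1_mul.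
have Gu0 x : M < `|x| -> Gu x = 0 by move=> Mx; rewrite /Gu u0 // mulr0.
have rE k z : partial k (defun i b gam) z = (-1) ^+ b * - gslope i gam k (col' i z).
  by have /rowP/(_ k) := gr z; rewrite mxE => ->; rewrite mxE gslope_normal.
rewrite (_ : (fun z => _) = fun z => partial j u z + partial i Gu z).
  rewrite Int_add ?(Int_partial j Cu u0) ?(Int_partial i CGu Gu0) ?addr0 //.
    exact: nice_partial Cu u0.
  exact: nice_partial CGu Gu0.
apply/funext => z.
rewrite /Gu (partialM _ _ CGc Cu) (partial_normal_cyl _ _ CG) mulr0 addr0.
rewrite /u !(partialM _ _ Cchi Ch) /chi !kE !rE.
have -> : gslope i gam i (col' i z) = -1 by rewrite /gslope unlift_none.
by ring.
Qed.

Lemma nice_below (i : 'I_n.+1) b (gam : 'rV[R]_n -> R) (f : 'rV[R]_n.+1 -> R) :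
  Ck 1 gam -> nice f -> nice (fun z => (if defun i b gam z < 0 then 1 else 0) * f z).
Proof.
move=> Cg nf; have [[cr _] _] := Ck1_defun i b Cg.
have mA : measurable (vecd @^-1` (defun i b gam @^-1` [set t : R | t < 0])).
  by apply: open_measurable_vec; apply: open_comp => [z _|]; [exact: cr|exact: open_lt].
rewrite (_ : (fun z => _) =
  fun z => f z * \1_(defun i b gam @^-1` [set t : R | t < 0]) z).
  exact: nice_mul_indic.
apply/funext => z; rewrite mulrC indicE; congr (_ * _).
have -> : (z \in defun i b gam @^-1` [set t : R | t < 0]) = (defun i b gam z < 0).
  by apply/idP/idP => [/set_mem|H]; [|exact: mem_set].
by case: ifP.
Qed.

(** Along the [i]-th axis the domain is a half-line ending on the graph. *)
Lemma Int_below (i : 'I_n.+1) b (gam : 'rV[R]_n -> R) (h : 'rV[R]_n.+1 -> R) (M : R) :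
  Ck 1 gam -> Ck 1 h -> (forall x, M < `|x| -> h x = 0) ->
  Int (fun z => (if defun i b gam z < 0 then 1 else 0) * partial i h z) =
  Int (fun y => (-1) ^+ b * h (gpar i gam y)).
Proof.
move=> Cg Ch h0; have [[cr _] _] := Ck1_defun i b Cg.
have nh := nice_partial i Ch h0.
have nf : nice (fun z => (if defun i b gam z < 0 then 1 else 0) * partial i h z).
  exact: nice_below.
rewrite (Int_ins i nf); congr Int; apply/funext => y.
have rE t : defun i b gam (ins i t y) = (-1) ^+ b * (t - gam y).
  by rewrite /defun ins_at col'_ins.
case: b rE {nf cr} => rE.
  rewrite expr1 mulN1r -(integral_slice_gt i _ y Ch h0).
  apply: eq_Rintegral => t _; rewrite rE expr1 mulN1r opprB subr_lt0.
  by case: ifP; rewrite ?mul1r ?mul0r.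
rewrite expr0 mul1r -(integral_slice_lt i _ y Ch h0).
apply: eq_Rintegral => t _; rewrite rE expr0 mul1r subr_lt0.
by case: ifP; rewrite ?mul1r ?mul0r.
Qed.

(** Letting the cut-off converge to the indicator of the domain, the previous
    lemmas trade [partial j h] for the derivative of [- gslope j * h] along the
    [i]-th axis. This is integrated explicitly and gives the value on the graph;
    up to sign, the ratio of [gslope] to the area density is the normal component. *)
Lemma divergence_local U i b gam (x : 'rV[R]_n.+1) r (h : 'rV[R]_n.+1 -> R) j :
  graph_chart Omega U i b gam -> (forall y, `|x - y| <= r -> U y) ->
  Ck 1 h -> (forall y, r <= `|x - y| -> h y = 0) ->
  intg (leb R n.+1) Omega (partial j h) =
  intg sigma (bdry Omega) (fun z => outward_normal Omega z 0 j * h z).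
Proof.
move=> ch BU Ch h0; have Cg1 := chart_Ck1 ch; have Cg := chart_Ck2 ch.
have [[cr _] _] := Ck1_defun i b Cg1.
have M0 y : `|x| + r < `|y| -> h y = 0.
  move=> H; apply: h0; have := ler_normB x (x - y); rewrite subKr.
  by move: H; move: `|x - y| => t; lra.
have nj := nice_partial j Ch M0.
have CG := Ck1_gslope i j Cg.
have [CGc _] := Ck1_col' i CG.
pose Gh (z : 'rV[R]_n.+1) := gslope i gam j (col' i z) * h z.
have CGh : Ck 1 Gh by exact: Ck1_mul.
have Gh0 y : `|x| + r < `|y| -> Gh y = 0 by move=> H; rewrite /Gh M0 // mulr0.
have nG := nice_partial i CGh Gh0.
have pG z : partial i Gh z = gslope i gam j (col' i z) * partial i h z.
  by rewrite /Gh (partialM _ _ CGc Ch) (partial_normal_cyl _ _ CG) mulr0 addr0.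
(* On the support of [h], the domain is the set where the defining function is
   negative. *)
have E1 : intg (leb R n.+1) Omega (partial j h) =
    Int (fun z => (if defun i b gam z < 0 then 1 else 0) * partial j h z).
  rewrite /Int /intg preimage_setT Rintegral_mkcond; apply: eq_Rintegral => t _.
  rewrite patchE /=; set z := vecd t.
  have -> : (t \in vecd @^-1` Omega) = (z \in Omega) by [].
  have [xz|xz] := leP `|x - z| r.
    have Uz := BU z xz.
    have -> : (z \in Omega) = (defun i b gam z < 0).
      apply/idP/idP => [/set_mem/(chartE ch Uz)//|H].
      by apply/mem_set/(chartE ch Uz).
    by case: ifP; rewrite ?mul1r ?mul0r.
  have -> : partial j h z = 0.
    have -> : 0 = partial j (fun=> 0) z by rewrite partial_cst.
    apply: near_eq_partial; apply: (filterS _ (far_near xz)) => y H.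
    by apply: h0; exact: ltW.
  by rewrite mulr0; case: ifP.
have E2 : Int (fun z => (if defun i b gam z < 0 then 1 else 0) * partial j h z) =
    - Int (fun z => (if defun i b gam z < 0 then 1 else 0) * partial i Gh z).
  have := @Int_heaviside R n.+1 (defun i b gam) (fun z => partial j h z + partial i Gh z)
     cr (nice_add nj nG) _.
  rewrite (_ : (fun z => _ * (_ + _)) = fun z =>
      (if defun i b gam z < 0 then 1 else 0) * partial j h z +
      (if defun i b gam z < 0 then 1 else 0) * partial i Gh z); last first.
    by apply/funext => z; rewrite mulrDr.
  rewrite Int_add; [|exact: nice_below|exact: nice_below].
  move=> H; apply/eqP; rewrite -addr_eq0; apply/eqP/H => k.
  rewrite -[RHS](@Int_tangential i b gam h j (`|x| + r) k%:R Cg Ch M0); congr Int.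
  by apply/funext => z; rewrite pG.
rewrite E1 E2 (Int_below _ _ Cg1 CGh Gh0) /Gh.
pose uh y := (-1) ^+ b / dens gam y * - gslope i gam j y * h (gpar i gam y).
have [Cd _] := continuous_density Cg.
have muh : measurable_fun setT (uh \o @vec R n).
  apply: continuous_measurable; apply: continuous_mul; last first.
    by have [[]] := Ck1_comp_gpar i Cg1 Ch.
  apply: continuous_mul; last by apply: continuous_opp; case: CG.
  apply: continuous_mul; first exact: continuous_cst.
  by have [[]] := Ck1_inv (@area_density_pos R n gam) Cd.
set B := [set y : 'rV[R]_n.+1 | `|x - y| <= r].
rewrite (@surface_integral_chart _ _ _ _ hsigma U i b gam B _ uh ch BU
  (measurable_vec_closed_ball x r) (closed_ball_proper x r) muh); first last.
- by move=> z bz /negP; rewrite -ltNge => rz; rewrite h0 ?mulr0 // ltW.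
- move=> z bz Bz; have Uz := BU z Bz.
  rewrite (outward_normalE ch Uz bz) /uh -(bdry_gpar ch Uz bz).
  by rewrite /graph_normal mxE gslope_normal.
have nn : nice (fun y => (-1) ^+ b * (gslope i gam j y * h (gpar i gam y))).
  apply: (@nice_continuous _ _ _ (`|x| + r)).
    apply: continuous_mul; first exact: continuous_cst.
    apply: continuous_mul; first by case: CG.
    by have [[]] := Ck1_comp_gpar i Cg1 Ch.
  by move=> y H; rewrite h0 ?mulr0 // ltW // gpar_far.
have -> : (fun y => (-1) ^+ b * (gslope i gam j (col' i (gpar i gam y)) * h (gpar i gam y))) =
  fun y => (-1) ^+ b * (gslope i gam j y * h (gpar i gam y)).
  by apply/funext => y; rewrite /gpar col'_ins.
rewrite -[LHS]mulN1r -(Int_cst_mul (-1) nn); congr Int; apply/funext => y.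
case: ifPn => [_|].
  rewrite /uh mulrAC (mulrAC _ (- gslope _ _ _ _)) divfK; last by rewrite gt_eqF // area_density_pos.
  by ring.
rewrite notin_setE /B /= => /negP; rewrite -ltNge => rz.
by rewrite h0 ?mulr0 ?mul0r // ltW.
Qed.

End LocalDivergence.

(** * Divergence theorem on the domain *)

Section Green.
Variables (R : realType) (n : nat).
Variable Omega : set 'rV[R]_n.+1.
Variable sigma : {measure set (Rtuple R n.+1) -> \bar R}.
Hypothesis hsigma : is_surface_measure Omega sigma.
Hypothesis hOmega : smooth_bounded_domain Omega.

Local Notation vecd := (@vec R n.+1).
Local Notation dens gam := (@area_density R n.+1 gam).

Lemma closure_cases x : closure Omega x -> Omega x \/ bdry Omega x.
Proof.
move=> cx; have [Ox|nOx] := pselect (Omega x); [by left|right].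
by split=> // /interior_subset.
Qed.

Lemma open_near x : Omega x -> \forall y \near x, Omega y.
Proof. by move=> Ox; have := domain_open hOmega; rewrite openE => /(_ _ Ox). Qed.

Lemma within_mul (A : set 'rV[R]_n.+1) (f g : 'rV[R]_n.+1 -> R) :
  {within A, continuous f} -> {within A, continuous g} ->
  {within A, continuous (fun x => f x * g x)}.
Proof. by move=> cf cg; exact: (@continuous_mul R (subspace A) f g). Qed.

Lemma within_add (A : set 'rV[R]_n.+1) (f g : 'rV[R]_n.+1 -> R) :
  {within A, continuous f} -> {within A, continuous g} ->
  {within A, continuous (fun x => f x + g x)}.
Proof. by move=> cf cg; exact: (@continuous_add R (subspace A) f g). Qed.

Lemma within_sum (A : set 'rV[R]_n.+1) m (f : 'I_m -> 'rV[R]_n.+1 -> R) :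
  (forall j, {within A, continuous (f j)}) ->
  {within A, continuous (fun x => \sum_j f j x)}.
Proof. by move=> cf; exact: (@continuous_sum_ord R (subspace A) m f). Qed.

Lemma within_eq (A : set 'rV[R]_n.+1) (f g : 'rV[R]_n.+1 -> R) :
  (forall x, A x -> f x = g x) -> {within A, continuous f} -> {within A, continuous g}.
Proof. by move=> fg; apply: subspace_eq_continuous => x /set_mem Ax; exact: fg. Qed.

(** For the bulk, continuity on the closure is what makes integrands bounded;
    prescribing a continuous extension avoids any extension theorem. *)
Definition cont_on (A : set 'rV[R]_n.+1) (f : 'rV[R]_n.+1 -> R) : Prop :=
  exists2 V : 'rV[R]_n.+1 -> R, continuous V & forall x, A x -> f x = V x.

Lemma domain_integrable f : cont_on Omega f ->
  (leb R n.+1).-integrable (vecd @^-1` Omega) (EFin \o (f \o vecd)).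
Proof.
move=> [V cV fV].
have mO : measurable (vecd @^-1` Omega) by apply: open_measurable_vec; exact: domain_open hOmega.
have [M HM] := domain_norm_bound hOmega.
apply: (@eq_integrable _ _ _ _ _ mO (EFin \o (V \o vecd))).
  by move=> t /set_mem Ot /=; rewrite fV.
apply: measurable_bounded_integrable => //.
- apply: (@le_lt_trans _ _ (leb R n.+1 (vecd @^-1` [set x | `|x| <= M]))); last exact: leb_ball_lty.
  apply: le_measure; rewrite ?inE //.
    exact: measurable_vec_ball.
  by move=> t Ot /=; apply: HM; exact: subset_closure.
- by apply: measurable_funTS; exact: continuous_measurable.
- have [C HC] := continuous_bounded_ball M cV.
  exists C; split; first exact: num_real.
  move=> N CN t Ot /=; apply: le_trans (ltW CN); apply: HC; apply: HM.
  exact: subset_closure.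
Qed.

Lemma measurable_domain : measurable (vecd @^-1` Omega).
Proof. by apply: open_measurable_vec; exact: domain_open hOmega. Qed.

Lemma eq_intg (m : {measure set (Rtuple R n.+1) -> \bar R}) A f g :
  (forall x, A x -> f x = g x) -> intg m A f = intg m A g.
Proof. by move=> fg; apply: eq_Rintegral => t /set_mem At /=; exact: fg. Qed.

Lemma intg_eq0 (m : {measure set (Rtuple R n.+1) -> \bar R}) A f :
  (forall x, A x -> f x = 0) -> intg m A f = 0.
Proof.
move=> f0; rewrite (@eq_intg m A f (fun=> 0)) //.
by rewrite /intg /Rintegral integral0_eq.
Qed.

Lemma domain_intgD f g : cont_on Omega f -> cont_on Omega g ->
  intg (leb R n.+1) Omega (fun x => f x + g x) =
  intg (leb R n.+1) Omega f + intg (leb R n.+1) Omega g.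
Proof.
by move=> cf cg; apply: RintegralD; [exact: measurable_domain|exact: domain_integrable|exact: domain_integrable].
Qed.

Lemma domain_intgZ c f : cont_on Omega f ->
  intg (leb R n.+1) Omega (fun x => c * f x) = c * intg (leb R n.+1) Omega f.
Proof.
by move=> cf; apply: RintegralZl; [exact: measurable_domain|exact: domain_integrable].
Qed.

Lemma domain_intg_le f g : cont_on Omega f -> cont_on Omega g ->
  (forall x, Omega x -> f x <= g x) ->
  intg (leb R n.+1) Omega f <= intg (leb R n.+1) Omega g.
Proof.
move=> cf cg fg; apply: le_Rintegral.
- exact: measurable_domain.
- exact: domain_integrable.
- exact: domain_integrable.
- by move=> t Ot; exact: fg.
Qed.

Lemma surface_intgD (f g : 'rV[R]_n.+1 -> R) : {within bdry Omega, continuous f} ->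
  {within bdry Omega, continuous g} ->
  intg sigma (bdry Omega) (fun x => f x + g x) =
  intg sigma (bdry Omega) f + intg sigma (bdry Omega) g.
Proof.
move=> cf cg; apply: RintegralD; [exact: measurable_bdry| |].
  exact: (surface_integrable hsigma hOmega cf).
exact: (surface_integrable hsigma hOmega cg).
Qed.

Lemma surface_intgZ (c : R) (f : 'rV[R]_n.+1 -> R) : {within bdry Omega, continuous f} ->
  intg sigma (bdry Omega) (fun x => c * f x) = c * intg sigma (bdry Omega) f.
Proof.
move=> cf; apply: RintegralZl; first exact: measurable_bdry.
exact: (surface_integrable hsigma hOmega cf).
Qed.

Lemma surface_intg_le (f g : 'rV[R]_n.+1 -> R) : {within bdry Omega, continuous f} ->
  {within bdry Omega, continuous g} -> (forall x, bdry Omega x -> f x <= g x) ->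
  intg sigma (bdry Omega) f <= intg sigma (bdry Omega) g.
Proof.
move=> cf cg fg; apply: le_Rintegral.
- exact: measurable_bdry.
- exact: (surface_integrable hsigma hOmega cf).
- exact: (surface_integrable hsigma hOmega cg).
- by move=> t bt; exact: fg.
Qed.

Lemma within_normal j : {within bdry Omega, continuous (fun z => outward_normal Omega z 0 j)}.
Proof.
apply: (within_bdry_continuous hOmega) => U i b gam ch.
have Cg := chart_Ck2 ch; have [Cd _] := continuous_density Cg.
exists (fun y => (-1) ^+ b / dens gam y * - gslope i gam j y).
  apply: continuous_mul.
    apply: continuous_mul; first exact: continuous_cst.
    by have [[]] := Ck1_inv (@area_density_pos R n gam) Cd.
  by apply: continuous_opp; case: (Ck1_gslope i j Cg).
move=> x Ux bx; rewrite (outward_normalE ch Ux bx).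
by rewrite /graph_normal mxE gslope_normal.
Qed.

(** By localization it is enough to treat [h] supported near a point of the
    closure: in a chart at a boundary point, and inside the domain otherwise, where
    both sides vanish. *)
Lemma divergence_theorem (h : 'rV[R]_n.+1 -> R) j : Ck 1 h ->
  intg (leb R n.+1) Omega (partial j h) =
  intg sigma (bdry Omega) (fun z => outward_normal Omega z 0 j * h z).
Proof.
move: h; apply: (localization (compact_closure hOmega)).
- move=> g h Cg Ch Lg Lh.
  rewrite (@eq_intg _ _ _ (fun z => partial j g z + partial j h z)); last first.
    by move=> x _; rewrite partialD.
  rewrite [RHS](@eq_intg _ _ _ (fun z => outward_normal Omega z 0 j * g z +
    outward_normal Omega z 0 j * h z)); last by move=> x _; rewrite mulrDr.
  rewrite domain_intgD; last 2 first.
  - by exists (partial j g) => //; case: Cg => _ /(_ j)[].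
  - by exists (partial j h) => //; case: Ch => _ /(_ j)[].
  rewrite surface_intgD ?Lg ?Lh //; apply: within_mul; try exact: within_normal.
  - by apply: continuous_subspaceT; case: Cg.
  - by apply: continuous_subspaceT; case: Ch.
- move=> h Ch h0; rewrite !intg_eq0 //.
    move=> x [cx _]; have /nbhs_singleton -> := h0 x cx; exact: mulr0.
  move=> x /subset_closure cx; rewrite (near_eq_partial j (h0 x cx)).
  exact: partial_cst.
move=> x /closure_cases[Ox|bx].
  have [r /= r0 Hr] := (nbhs_ballP _ _).1 (open_near Ox).
  have r2 : r / 2 < r by rewrite ltr_pdivrMr // ltr_pMr // ltr1n.
  exists (r / 2) => [|h Ch h0]; first by rewrite divr_gt0.
  have far z : ~ Omega z -> r / 2 < `|x - z|.
    move=> nOz; apply: (lt_le_trans r2); rewrite leNgt; apply/negP => xz.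
    by apply: nOz; apply: Hr; rewrite -ball_normE.
  have hb z : ~ Omega z -> h z = 0 by move=> /far/ltW/h0.
  rewrite [RHS]intg_eq0; last first.
    by move=> z [_ nOz]; rewrite hb ?mulr0 // => /open_near.
  have M0 y : `|x| + r / 2 < `|y| -> h y = 0.
    move=> H; apply: h0; have := ler_normB x (x - y); rewrite subKr.
    by move: H; move: `|x - y| => t; lra.
  rewrite -(Int_partial j Ch M0) /Int /intg preimage_setT Rintegral_mkcond.
  apply: eq_Rintegral => t _; rewrite patchE /=; case: ifPn => //.
  rewrite notin_setE /= => nO.
  have -> : partial j h (vecd t) = partial j (fun=> 0) (vecd t).
    apply: near_eq_partial; apply: (filterS _ (far_near (far _ nO))) => y H.
    by apply: h0; exact: ltW.
  by rewrite partial_cst.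
have [U [i [b [gam [ch Ux]]]]] := domain_bdry_smooth hOmega bx.
have [r r0 HU] := chart_ball ch Ux.
by exists r => // h Ch h0; exact: (divergence_local hsigma j ch HU Ch h0).
Qed.

End Green.

(** * Green identities *)

Section GreenIdentities.
Variables (R : realType) (n : nat).
Variable Omega : set 'rV[R]_n.+1.
Variable sigma : {measure set (Rtuple R n.+1) -> \bar R}.
Hypothesis hsigma : is_surface_measure Omega sigma.
Hypothesis hOmega : smooth_bounded_domain Omega.

Lemma domain_grad (u U : 'rV[R]_n.+1 -> R) x : (forall x, closure Omega x -> u x = U x) ->
  Omega x -> grad u x = grad U x.
Proof.
move=> uU Ox; apply/rowP => j; rewrite !mxE; apply: near_eq_partial.
by apply: (filterS _ (open_near hOmega Ox)) => y /subset_closure/uU.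
Qed.

Lemma domain_lap (u U : 'rV[R]_n.+1 -> R) x : (forall x, closure Omega x -> u x = U x) ->
  Omega x -> lap u x = lap U x.
Proof.
move=> uU Ox; apply: eq_bigr => j _; apply: near_eq_partial.
apply: (filterS _ (open_near hOmega Ox)) => y Oy.
by have /rowP/(_ j) := domain_grad uU Oy; rewrite !mxE.
Qed.

(** Expresses the normal derivative through the coordinates that appear in the
    divergence theorem. *)
Lemma bdry_dnormal (u U : 'rV[R]_n.+1 -> R) x : Ck 1 U ->
  (forall x, closure Omega x -> u x = U x) -> bdry Omega x ->
  dnormal Omega u x = \sum_j outward_normal Omega x 0 j * partial j U x.
Proof.
move=> CU uU bx; have [V [i [b [gam [ch Vx]]]]] := domain_bdry_smooth hOmega bx.
rewrite (dnormalE ch Vx bx CU uU) (outward_normalE ch Vx bx).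
by apply: eq_bigr => j _; rewrite [grad _ _ _ _]mxE.
Qed.

Lemma within_dnormal (u U : 'rV[R]_n.+1 -> R) : Ck 1 U ->
  (forall x, closure Omega x -> u x = U x) ->
  {within bdry Omega, continuous (dnormal Omega u)}.
Proof.
move=> CU uU.
apply: (@within_eq _ _ _ (fun x => \sum_j outward_normal Omega x 0 j * partial j U x)).
  by move=> x bx; rewrite (bdry_dnormal CU uU bx).
apply: within_sum => j; apply: within_mul; first exact: within_normal.
by apply: continuous_subspaceT; case: CU => _ /(_ j)[].
Qed.

Lemma cont_on_grad (u v U V : 'rV[R]_n.+1 -> R) : Ck 1 U -> Ck 1 V ->
  (forall x, closure Omega x -> u x = U x) -> (forall x, closure Omega x -> v x = V x) ->
  cont_on Omega (fun x => dotv (grad u x) (grad v x)).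
Proof.
move=> CU CV uU vV; exists (fun x => \sum_j partial j U x * partial j V x).
  apply: continuous_sum_ord => j; apply: continuous_mul.
    by case: CU => _ /(_ j)[].
  by case: CV => _ /(_ j)[].
move=> x Ox; rewrite (domain_grad uU Ox) (domain_grad vV Ox) /dotv.
by apply: eq_bigr => j _; rewrite !mxE.
Qed.

Lemma cont_on_lap (u U : 'rV[R]_n.+1 -> R) : Ck 2 U ->
  (forall x, closure Omega x -> u x = U x) -> cont_on Omega (lap u).
Proof.
move=> CU uU; exists (lap U); last by move=> x Ox; exact: domain_lap.
by apply: continuous_sum_ord => j; case: (Ck2_partial j CU) => _ /(_ j)[].
Qed.

Lemma cont_on_mul (A : set 'rV[R]_n.+1) (f g : 'rV[R]_n.+1 -> R) :
  cont_on A f -> cont_on A g -> cont_on A (fun x => f x * g x).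
Proof.
move=> [F cF fF] [G cG gG]; exists (fun x => F x * G x); first exact: continuous_mul.
by move=> x Ax; rewrite fF // gG.
Qed.

Lemma cont_on_add (A : set 'rV[R]_n.+1) (f g : 'rV[R]_n.+1 -> R) :
  cont_on A f -> cont_on A g -> cont_on A (fun x => f x + g x).
Proof.
move=> [F cF fF] [G cG gG]; exists (fun x => F x + G x); first exact: continuous_add.
by move=> x Ax; rewrite fF // gG.
Qed.

Lemma cont_on_closure (u U : 'rV[R]_n.+1 -> R) : Ck 1 U ->
  (forall x, closure Omega x -> u x = U x) -> cont_on Omega u.
Proof.
move=> [cU _] uU; exists U => // x Ox; apply: uU; exact: subset_closure.
Qed.

Lemma cont_on_sum (A : set 'rV[R]_n.+1) m (F : 'I_m -> 'rV[R]_n.+1 -> R) :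
  (forall j, cont_on A (F j)) -> cont_on A (fun x => \sum_j F j x).
Proof.
elim: m F => [|m IH] F cF.
  exists (fun=> 0); first exact: continuous_cst.
  by move=> x _; rewrite big_ord0.
have [V cV E] := cont_on_add (cF ord0) (IH _ (fun j => cF (lift ord0 j))).
by exists V => // x Ox; rewrite -E // big_ord_recl.
Qed.

Lemma domain_intg_sum m (F : 'I_m -> 'rV[R]_n.+1 -> R) :
  (forall j, cont_on Omega (F j)) ->
  intg (leb R n.+1) Omega (fun x => \sum_j F j x) = \sum_j intg (leb R n.+1) Omega (F j).
Proof.
elim: m F => [|m IH] F cF.
  by rewrite big_ord0 intg_eq0 // => x _; rewrite big_ord0.
rewrite big_ord_recl -IH // -domain_intgD //.
  by apply: eq_intg => x _; rewrite big_ord_recl.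
by apply: cont_on_sum => j; exact: cF.
Qed.

Lemma surface_intg_sum m (F : 'I_m -> 'rV[R]_n.+1 -> R) :
  (forall j, {within bdry Omega, continuous (F j)}) ->
  intg sigma (bdry Omega) (fun x => \sum_j F j x) = \sum_j intg sigma (bdry Omega) (F j).
Proof.
elim: m F => [|m IH] F cF.
  by rewrite big_ord0 intg_eq0 // => x _; rewrite big_ord0.
rewrite big_ord_recl -IH // -(surface_intgD hsigma hOmega) //.
  by apply: eq_intg => x _; rewrite big_ord_recl.
exact: within_sum.
Qed.

(** The divergence theorem for the field [V *: grad U]. *)
Lemma green_domain (u v U V : 'rV[R]_n.+1 -> R) : Ck 2 U -> Ck 1 V ->
  (forall x, closure Omega x -> u x = U x) -> (forall x, closure Omega x -> v x = V x) ->
  intg (leb R n.+1) Omega (fun x => dotv (grad u x) (grad v x)) +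
  intg (leb R n.+1) Omega (fun x => lap u x * v x) =
  intg sigma (bdry Omega) (fun x => dnormal Omega u x * v x).
Proof.
move=> CU CV uU vV; have CU1 := Ck2_Ck1 CU.
have CP j : Ck 1 (partial j U) by exact: Ck2_partial.
have Ch j : Ck 1 (fun x => V x * partial j U x) by exact: Ck1_mul.
rewrite -domain_intgD //; last 2 first.
- exact: cont_on_grad CU1 CV uU vV.
- by apply: cont_on_mul; [exact: cont_on_lap CU uU|exact: cont_on_closure CV vV].
transitivity (\sum_j intg (leb R n.+1) Omega (partial j (fun x => V x * partial j U x))).
  rewrite -domain_intg_sum; last first.
    by move=> j; exists (partial j (fun x => V x * partial j U x)) => //; case: (Ch j) => _ /(_ j)[].
  apply: eq_intg => x Ox.
  rewrite (domain_grad uU Ox) (domain_grad vV Ox) (domain_lap uU Ox) /lap /dotv.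
  rewrite (vV x (subset_closure Ox)) mulr_suml -big_split /=; apply: eq_bigr => j _.
  by rewrite (partialM _ _ CV (CP j)) !mxE; ring.
under eq_bigr do rewrite (divergence_theorem hsigma hOmega) //.
rewrite -surface_intg_sum; last first.
  move=> j; apply: within_mul; first exact: within_normal.
  by apply: continuous_subspaceT; case: (Ch j).
apply: eq_intg => x bx; rewrite (bdry_dnormal CU1 uU bx) vV; last by case: bx.
by rewrite mulr_suml; apply: eq_bigr => j _; ring.
Qed.

(** Same formula as for the C^1 version, with merely continuous components. *)
Lemma continuous_tvec i gam (a : 'I_n -> 'rV[R]_n -> R) j : Ck 2 gam ->
  (forall k, continuous (a k)) ->
  continuous (fun y => tvec i (grad gam y) (\row_k a k y) 0 j).
Proof.
move=> Cg Ca.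
have Cp k : continuous (partial k gam) by case: (Ck2_partial k Cg).
have Ci : continuous (fun y => (1 + \sum_k partial k gam y * partial k gam y)^-1).
  have s0 y : 0 < 1 + \sum_k partial k gam y * partial k gam y.
    by rewrite ltr_pwDl // sumr_ge0 // => l _; rewrite -expr2 sqr_ge0.
  have Cs : Ck 1 (fun y => 1 + \sum_k partial k gam y * partial k gam y).
    apply: Ck1_add; first exact: Ck1_cst.
    by apply: Ck1_sum => k; apply: Ck1_mul; exact: Ck2_partial.
  by have [[]] := Ck1_inv s0 Cs.
pose q y := (\sum_k a k y * partial k gam y) *
  (1 + \sum_k partial k gam y * partial k gam y)^-1.
have Cq : continuous q.
  apply: continuous_mul => //.
  by apply: continuous_sum_ord => k; exact: continuous_mul.
have qE y : dotv (\row_k a k y) (grad gam y) / (1 + dotv (grad gam y) (grad gam y)) = q y.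
  rewrite /q /dotv; congr (_ / (1 + _)); apply: eq_bigr => k _; by rewrite !mxE.
case: (unliftP i j) => [k ->|->].
  rewrite (_ : (fun y => _) = fun y => a k y + - (q y * partial k gam y)).
    by apply: continuous_add => //; apply: continuous_opp; exact: continuous_mul.
  by apply/funext => y; rewrite tvec_lift qE !mxE.
rewrite (_ : (fun y => _) = q) //.
by apply/funext => y; rewrite tvec_at qE.
Qed.

Lemma within_tgrad (w W : 'rV[R]_n.+1 -> R) j : Ck 1 W ->
  (forall z, bdry Omega z -> w z = W z) ->
  {within bdry Omega, continuous (fun z => tgrad Omega w z 0 j)}.
Proof.
move=> CW wW; apply: (within_bdry_continuous hOmega) => U i b gam ch.
have Cg := chart_Ck2 ch; have Cg1 := chart_Ck1 ch.
have [[_ Cw] _] := Ck1_comp_gpar i Cg1 CW.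
exists (fun y => tvec i (grad gam y) (\row_k partial k (fun z => W (gpar i gam z)) y) 0 j).
  by apply: continuous_tvec => // k; case: (Cw k).
by move=> x Ux bx; rewrite (tgrad_gpar ch CW wW Ux bx).
Qed.

Lemma within_dotv_tgrad (w v W V : 'rV[R]_n.+1 -> R) : Ck 1 W -> Ck 1 V ->
  (forall z, bdry Omega z -> w z = W z) -> (forall z, bdry Omega z -> v z = V z) ->
  {within bdry Omega, continuous (fun z => dotv (tgrad Omega w z) (tgrad Omega v z))}.
Proof.
move=> CW CV wW vV; apply: within_sum => j; apply: within_mul.
  exact: within_tgrad CW wW.
exact: within_tgrad CV vV.
Qed.

Lemma within_lapB (w W : 'rV[R]_n.+1 -> R) : Ck 2 W ->
  (forall z, bdry Omega z -> w z = W z) ->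
  {within bdry Omega, continuous (lapB Omega w)}.
Proof.
move=> CW wW; apply: (within_bdry_continuous hOmega) => U i b gam ch.
have Cg := chart_Ck2 ch.
exists (fun y => \sum_j tvec i (grad gam y) (\row_k partial k (tX i gam W j) y) 0 j).
  apply: continuous_sum_ord => j; apply: continuous_tvec => // k.
  by case: (Ck1_tX i j Cg CW) => _ /(_ k)[].
by move=> x Ux bx; rewrite (lapB_gpar ch CW wW Ux bx).
Qed.

Lemma tvecD i (g a c : 'rV[R]_n) : tvec i g (a + c) = tvec i g a + tvec i g c.
Proof.
apply/rowP => j; rewrite [RHS]mxE; case: (unliftP i j) => [k ->|->].
  by rewrite !tvec_lift dotvDl [(a + c) 0 k]mxE; ring.
by rewrite !tvec_at dotvDl; ring.
Qed.

Lemma tgradD (v1 v2 : 'rV[R]_n.+1 -> R) z : Ck 1 v1 -> Ck 1 v2 -> bdry Omega z ->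
  tgrad Omega (fun x => v1 x + v2 x) z = tgrad Omega v1 z + tgrad Omega v2 z.
Proof.
move=> C1 C2 bz; have [U [i [b [gam [ch Uz]]]]] := domain_bdry_smooth hOmega bz.
have Cg1 := chart_Ck1 ch.
rewrite (tgrad_gpar ch (Ck1_add C1 C2) _ Uz bz) //.
rewrite (tgrad_gpar ch C1 _ Uz bz) // (tgrad_gpar ch C2 _ Uz bz) // -tvecD.
congr (tvec _ _ _); apply/rowP => k; rewrite !mxE partialD //.
  by have [] := Ck1_comp_gpar i Cg1 C1.
by have [] := Ck1_comp_gpar i Cg1 C2.
Qed.

(** The boundary is compact and has no boundary of its own: localize and use one
    chart at a time. *)
Lemma green_boundary_Ck1 (w W v : 'rV[R]_n.+1 -> R) : Ck 2 W ->
  (forall z, bdry Omega z -> w z = W z) -> Ck 1 v ->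
  intg sigma (bdry Omega)
    (fun z => dotv (tgrad Omega w z) (tgrad Omega v z) + lapB Omega w z * v z) = 0.
Proof.
move=> CW wW; have CW1 := Ck2_Ck1 CW; move: v; apply: (localization (compact_bdry hOmega)).
- move=> g h Cg Ch Lg Lh.
  have cw u : Ck 1 u -> {within bdry Omega, continuous
      (fun z => dotv (tgrad Omega w z) (tgrad Omega u z) + lapB Omega w z * u z)}.
    move=> Cu; apply: within_add; first exact: within_dotv_tgrad CW1 Cu wW _.
    apply: within_mul; first exact: within_lapB CW wW.
    by apply: continuous_subspaceT; case: Cu.
  rewrite -[RHS]addr0 -{1}Lg -Lh -(surface_intgD hsigma hOmega (cw _ Cg) (cw _ Ch)).
  by apply: eq_intg => z bz; rewrite tgradD // dotvDr mulrDr addrACA.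
- move=> h Ch h0; apply: intg_eq0 => z bz.
  have nz := h0 z bz; rewrite (tgrad_near0 hOmega (w := h) bz nz) (nbhs_singleton nz).
  by rewrite mulr0 addr0 -(scale0r (tgrad Omega w z)) dotvZr mul0r.
move=> x bx; have [U [i [b [gam [ch Ux]]]]] := domain_bdry_smooth hOmega bx.
have [r r0 HU] := chart_ball ch Ux.
exists r => // h Ch h0; exact: (surface_green_local hsigma hOmega ch HU CW wW Ch h0).
Qed.

Lemma eq_tgrad (v V : 'rV[R]_n.+1 -> R) z : (forall z, bdry Omega z -> v z = V z) ->
  tgrad Omega v z = tgrad Omega V z.
Proof.
move=> vV; rewrite /tgrad.
rewrite (_ : [set W | differentiable W z /\ (\forall y \near z, bdry Omega y -> W y = v y)] =
  [set W | differentiable W z /\ (\forall y \near z, bdry Omega y -> W y = V y)]) //.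
apply/seteqP; split=> W [dW H]; split=> //; apply: filterS H => y H bY; rewrite H //.
  exact: vV.
by rewrite vV.
Qed.

Lemma green_boundary (w v W V : 'rV[R]_n.+1 -> R) : Ck 2 W -> Ck 1 V ->
  (forall z, bdry Omega z -> w z = W z) -> (forall z, bdry Omega z -> v z = V z) ->
  intg sigma (bdry Omega) (fun z => dotv (tgrad Omega w z) (tgrad Omega v z)) +
  intg sigma (bdry Omega) (fun z => lapB Omega w z * v z) = 0.
Proof.
move=> CW CV wW vV; have CW1 := Ck2_Ck1 CW.
rewrite -(surface_intgD hsigma hOmega); last 2 first.
- exact: within_dotv_tgrad CW1 CV wW vV.
- apply: within_mul; first exact: within_lapB CW wW.
  apply: (@within_eq _ _ _ V); first by move=> x /vV.
  by apply: continuous_subspaceT; case: CV.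
rewrite -(green_boundary_Ck1 CW wW CV); apply: eq_intg => z bz.
by rewrite (eq_tgrad z vV) vV.
Qed.

End GreenIdentities.

(** * Taylor bound for the potential *)

Section Potential.
Variable R : realType.

(** Stated along the segment from [s] to [t] so that both orders of the endpoints
    are covered; only the sign of [th] is needed below. *)
Lemma mean_value (f : R -> R) (s t : R) : (forall x, derivable f x 1) ->
  exists2 th : R, 0 <= th & f t - f s = derive1 f (s + th * (t - s)) * (t - s).
Proof.
move=> df.
pose c (x : R) : R := s + x * (t - s).
have dc (x : R) : is_derive x (1 : R) c (t - s).
  have := is_deriveD (is_derive_cst s x (1 : R))
    (is_deriveM (is_derive_id x (1 : R)) (is_derive_cst (t - s) x (1 : R))).
  by rewrite scaler0 add0r add0r [_ *: 1]mulr1.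
have D (x : R) : is_derive x (1 : R) (f \o c) (derive1 f (c x) * (t - s)).
  have [d1 d2] := dc x.
  split.
    have fd : derivable f (c x) 1 by exact: df.
    have d1' : differentiable c x by exact/derivable1_diffP.
    have fd' : differentiable f (c x) by exact/derivable1_diffP.
    by apply/derivable1_diffP; exact: differentiable_comp d1' fd'.
  by rewrite -derive1E (derive1_comp d1 (df _)) (derive1E c) d2.
have C : {within `[0, 1], continuous (f \o c)}.
  apply: continuous_subspaceT => x.
  by apply/differentiable_continuous/derivable1_diffP; case: (D x).
have [th thI E] := @MVT_segment _ _ _ 0 1 ler01 (fun x _ => D x) C.
exists th; first by move: thI; rewrite in_itv /= => /andP[].
move: E; rewrite /= /c mul1r mul0r addr0 subr0 mulr1 => <-.
by rewrite subrKC.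
Qed.

(** Second-order Taylor bound, the place where the size of the stabilization
    constant enters: [F''] is at most [2 * s], so the derivative of the difference
    of the two sides has the sign of [a - t]. *)
Lemma potential_increment (F : R -> R) (s a b : R) : admissible_potential F ->
  2^-1 * sup (range (derive1 (derive1 F))) <= s ->
  F b - F a <= derive1 F a * (b - a) + s * (b - a) ^+ 2.
Proof.
move=> [dF ddF _ ub] hs.
have key (r p e D : R) : (r + p * e - (r + s * (2 * e))) * D = (p - 2 * s) * (e * D).
  by ring.
have S x : derive1 (derive1 F) x <= 2 * s.
  apply: (@le_trans _ _ (sup (range (derive1 (derive1 F))))); last by lra.
  by apply: ub_le_sup => //; exists x.
pose g (t : R) : R := F t - (derive1 F a * t + s * ((t - a) * (t - a))).
have dg (t : R) : is_derive t (1 : R) g (derive1 F t - (derive1 F a + s * (2 * (t - a)))).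
  have h0 : is_derive t (1 : R) F (derive1 F t).
    by rewrite derive1E; exact: derivableP.
  have h1 := is_deriveB (is_derive_id t (1 : R)) (is_derive_cst a t (1 : R)).
  have h2 := is_deriveM (is_derive_cst (derive1 F a) t (1 : R)) (is_derive_id t (1 : R)).
  have h3 := is_deriveM (is_derive_cst s t (1 : R)) (is_deriveM h1 h1).
  have h4 := is_deriveB h0 (is_deriveD h2 h3).
  apply: (is_derive_eq h4).
  rewrite /GRing.scale /= -[(id - cst a) t]/(t - a) -[((id - cst a) * (id - cst a)) t]/((t - a) * (t - a)).
  by ring.
have dg1 t : derivable g t 1 by case: (dg t).
(* The derivative of [g] at the intermediate point is computed by a second mean
   value, for [derive1 F]. *)
have [th th0 E] := mean_value a b dg1.
have [xi _ E2] := mean_value a (a + th * (b - a)) ddF.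
have yE : a + th * (b - a) - a = th * (b - a) by rewrite addrC addKr.
have [p pS Fy] : exists2 p : R, p <= 2 * s &
    derive1 F (a + th * (b - a)) = derive1 F a + p * (th * (b - a)).
  exists (derive1 (derive1 F) (a + xi * (a + th * (b - a) - a))); first exact: S.
  by move: E2; rewrite yE => <-; rewrite [RHS]addrC subrK.
have G : g b - g a <= 0.
  have [_ dgE] := dg (a + th * (b - a)).
  rewrite E derive1E dgE Fy yE key; apply: mulr_le0_ge0; first by rewrite subr_le0.
  by rewrite -mulrA -expr2; apply: mulr_ge0 => //; exact: sqr_ge0.
move: G; rewrite /g subrr mul0r mulr0 addr0 expr2.
move: (s * _) (derive1 F a) (F a) (F b) => e f' f0 f1; lra.
Qed.

Lemma cross_le_half_sum (u v w : R) :
  0 <= u - w - (w - v) -> w <= 2^-1 * v + 2^-1 * u.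
Proof. by lra. Qed.

(** The bookkeeping of [energy_step] in terms of the values of the integrals:
    [a b c] stand for gradients, [l k lm lp l0 l1] for the products with Laplacians
    or with the flux, and [h01 h00 h11 hh] for gradients of the inverse
    operators. *)
Lemma energy_algebra (M beta tau N a b c l k f1 f0 hh lm lp l0 l1 h01 h00 h11 : R) :
  0 < M -> 0 <= beta -> 0 < tau ->
  c + l = N -> hh + lm = 0 -> hh + lp = 0 -> h01 + l0 = 0 -> h11 + l1 = 0 ->
  M * lp = (beta / tau * l1 + - (beta / tau) * l0) + l1 ->
  h01 <= 2^-1 * h00 + 2^-1 * h11 ->
  2^-1 * a + - 2^-1 * b + (f1 + -1 * f0) <= (c + l) + (tau * lm + -1 * k) ->
  (a / 2 + f1 + beta / (2 * M) * h11) - (b / 2 + f0 + beta / (2 * M) * h00)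
  <= N - k - tau * (M^-1 * h11).
Proof.
move=> M0 b0 t0 GN Gmu Gm G0 G1 step3 step4 step1.
have E0 : l0 = - h01 by lra.
have E1 : l1 = - h11 by lra.
have Em : lm = lp by lra.
have E : tau * lm = M^-1 * (beta * (h01 - h11) - tau * h11).
  have M1 : M != 0 by rewrite gt_eqF.
  have t1 : tau != 0 by rewrite gt_eqF.
  rewrite Em -[lp](mulKf M1) step3 E0 E1; field; by rewrite M1 t1.
have P : beta / M * (h01 - 2^-1 * h11 - 2^-1 * h00) <= 0.
  by apply: mulr_ge0_le0; [exact: divr_ge0 b0 (ltW M0)|lra].
have -> : beta / (2 * M) * h11 = 2^-1 * (beta / M * h11) by rewrite invfM; ring.
have -> : beta / (2 * M) * h00 = 2^-1 * (beta / M * h00) by rewrite invfM; ring.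
have E2 : M^-1 * (beta * (h01 - h11) - tau * h11) =
   beta / M * h01 - beta / M * h11 - tau * (M^-1 * h11) by ring.
have P2 : beta / M * h01 - 2^-1 * (beta / M * h11) - 2^-1 * (beta / M * h00) <= 0.
  by apply: le_trans P; rewrite le_eqVlt; apply/orP; left; apply/eqP; ring.
rewrite E2 in E.
move: (beta / M * h01) (beta / M * h11) (beta / M * h00) (tau * (M^-1 * h11)) (tau * lm)
  E P2 step1 GN; clear => u v w z y E P2 step1 GN.
by lra.
Qed.

End Potential.

(** * The discrete energy estimate *)

Section EnergyStep.
Variables (R : realType) (T : Type) (m : nat) (A : set T).
Variables (Cl : (T -> R) -> Prop) (I : (T -> R) -> R).
Hypothesis Cl_add : forall f g, Cl f -> Cl g -> Cl (fun x => f x + g x).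
Hypothesis Cl_mul : forall f g, Cl f -> Cl g -> Cl (fun x => f x * g x).
Hypothesis Cl_cst : forall c, Cl (fun=> c).
Hypothesis I_add : forall f g, Cl f -> Cl g -> I (fun x => f x + g x) = I f + I g.
Hypothesis I_scale : forall c f, Cl f -> I (fun x => c * f x) = c * I f.
Hypothesis I_le : forall f g, Cl f -> Cl g -> (forall x, A x -> f x <= g x) -> I f <= I g.

(** The estimate common to the domain and its boundary, which differ only in the
    integral [I], its class [Cl] of admissible integrands, the gradients
    ([g0 g1] for the phase, [hm] for the chemical potential, [h0 h1] for the
    inverse operators), the Laplacians ([L1 Lm Lp0 Lp1]), the flux [kap] and the
    boundary term [N]. Convexity bounds the increment of the gradient and potential
    energies by the integral of [mu] times the increment of the phase. This equals
    [tau] times the pairing of [Lp1] with [mu]; integrating by parts twice moves it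
    to the pairing of [p1] with [Lm], which the evolution equation turns into the
    dissipation and the increment of the inertial energy. *)
Lemma energy_step (F : R -> R) (M beta s tau N : R)
  (phi0 phi1 mu p1 L1 Lm Lp0 Lp1 kap : T -> R) (g0 g1 hm h0 h1 : T -> 'rV[R]_m) :
  0 < M -> 0 <= beta -> 0 < tau -> admissible_potential F ->
  2^-1 * sup (range (derive1 (derive1 F))) <= s ->
  Cl phi0 -> Cl phi1 -> Cl mu -> Cl p1 -> Cl L1 -> Cl Lm -> Cl Lp0 -> Cl Lp1 -> Cl kap ->
  Cl (F \o phi0) -> Cl (F \o phi1) ->
  Cl (fun x => dotv (g0 x) (g0 x)) -> Cl (fun x => dotv (g1 x) (g1 x)) ->
  Cl (fun x => dotv (g1 x) (g1 x - g0 x)) ->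
  Cl (fun x => dotv (h0 x) (h0 x)) -> Cl (fun x => dotv (h1 x) (h1 x)) ->
  Cl (fun x => dotv (h0 x) (h1 x)) ->
  (forall x, A x -> mu x = - L1 x + derive1 F (phi0 x) + kap x + s * (phi1 x - phi0 x)) ->
  (forall x, A x -> Lp1 x = (phi1 x - phi0 x) / tau) ->
  (forall x, A x -> beta * ((Lp1 x - Lp0 x) / tau) + Lp1 x = M * Lm x) ->
  I (fun x => dotv (g1 x) (g1 x - g0 x)) + I (fun x => L1 x * (phi1 x - phi0 x)) = N ->
  I (fun x => dotv (h1 x) (hm x)) + I (fun x => Lp1 x * mu x) = 0 ->
  I (fun x => dotv (hm x) (h1 x)) + I (fun x => Lm x * p1 x) = 0 ->
  I (fun x => dotv (h0 x) (h1 x)) + I (fun x => Lp0 x * p1 x) = 0 ->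
  I (fun x => dotv (h1 x) (h1 x)) + I (fun x => Lp1 x * p1 x) = 0 ->
  (I (fun x => dotv (g1 x) (g1 x)) / 2 + I (F \o phi1) +
    beta / (2 * M) * I (fun x => dotv (h1 x) (h1 x))) -
  (I (fun x => dotv (g0 x) (g0 x)) / 2 + I (F \o phi0) +
    beta / (2 * M) * I (fun x => dotv (h0 x) (h0 x)))
  <= N - I (fun x => kap x * (phi1 x - phi0 x))
     - tau * (M^-1 * I (fun x => dotv (h1 x) (h1 x))).
Proof.
move=> M0 b0 t0 aF hs Cp0 Cp1 Cmu Cp CL1 CLm CLp0 CLp1 Ck CF0 CF1 Cg0 Cg1 Cg10 Ch0 Ch1 Ch01
  Emu ELp EM GN Gmu Gm G0 G1.
have I_eq f g : Cl f -> Cl g -> (forall x, A x -> f x = g x) -> I f = I g.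
  by move=> Cf Cg fg; apply/eqP; rewrite eq_le !I_le // => x Ax; rewrite fg.
have Cl_scale c f : Cl f -> Cl (fun x => c * f x) by move=> Cf; exact: Cl_mul.
pose dl x := phi1 x - phi0 x.
have Cdl : Cl dl.
  have := Cl_add Cp1 (Cl_scale (-1) _ Cp0).
  by rewrite (_ : (fun x => _ + _) = dl) //; apply/funext => x; rewrite mulN1r.
(* Convexity of the squared norm and the Taylor bound, integrated. *)
have step1 : 2^-1 * I (fun x => dotv (g1 x) (g1 x)) +
   - 2^-1 * I (fun x => dotv (g0 x) (g0 x)) + (I (F \o phi1) + -1 * I (F \o phi0)) <=
   (I (fun x => dotv (g1 x) (g1 x - g0 x)) + I (fun x => L1 x * dl x)) +
   (I (fun x => mu x * dl x) + -1 * I (fun x => kap x * dl x)).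
  have C1 := Cl_scale 2^-1 _ Cg1; have C2 := Cl_scale (- 2^-1) _ Cg0.
  have C3 := Cl_scale (-1) _ CF0.
  have C4 := Cl_mul CL1 Cdl; have C5 := Cl_mul Cmu Cdl; have C6 := Cl_mul Ck Cdl.
  have C7 := Cl_scale (-1) _ C6.
  rewrite -(I_scale 2^-1 Cg1) -(I_scale (- 2^-1) Cg0) -(I_scale (-1) CF0) -(I_scale (-1) C6).
  rewrite -(I_add C1 C2) -(I_add CF1 C3) -(I_add Cg10 C4) -(I_add C5 C7).
  rewrite -(I_add (Cl_add C1 C2) (Cl_add CF1 C3)) -(I_add (Cl_add Cg10 C4) (Cl_add C5 C7)).
  apply: I_le => [||x Ax].
  - exact: Cl_add (Cl_add C1 C2) (Cl_add CF1 C3).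
  - exact: Cl_add (Cl_add Cg10 C4) (Cl_add C5 C7).
  have PF := potential_increment (phi0 x) (phi1 x) aF hs.
  rewrite (Emu x Ax) /dl /= !dotvBr.
  have := dotv_ge0 (g1 x - g0 x); rewrite dotvBl !dotvBr (dotvC (g0 x) (g1 x)).
  move: PF; set D := phi1 x - phi0 x.
  move: (F _) (F _) (derive1 F _) (L1 x) (kap x) D.
  move: (dotv (g1 x) (g1 x)) (dotv (g0 x) (g0 x)) (dotv (g1 x) (g0 x)).
  clear; move=> a b c f1 f0 f' l k D; rewrite expr2; lra.
have Gsym : I (fun x => dotv (hm x) (h1 x)) = I (fun x => dotv (h1 x) (hm x)).
  by congr I; apply/funext => x; rewrite dotvC.
(* The increment of the phase is [tau] times the first Laplacian; the evolution
   equation is then tested with [p1]. *)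
have step2 : I (fun x => mu x * dl x) = tau * I (fun x => Lp1 x * mu x).
  have C5 := Cl_mul CLp1 Cmu.
  rewrite -(I_scale tau C5); apply: I_eq; [exact: Cl_mul|exact: Cl_scale|].
  by move=> x Ax; rewrite (ELp x Ax) -/(dl x) mulrA [tau * _]mulrC divfK ?gt_eqF // mulrC.
have step3 : M * I (fun x => Lm x * p1 x) =
   (beta / tau * I (fun x => Lp1 x * p1 x) + - (beta / tau) * I (fun x => Lp0 x * p1 x)) +
   I (fun x => Lp1 x * p1 x).
  have D1 := Cl_mul CLm Cp; have D2 := Cl_mul CLp1 Cp; have D3 := Cl_mul CLp0 Cp.
  have D4 := Cl_scale (beta / tau) _ D2.
  have D5 := Cl_scale (- (beta / tau)) _ D3.
  rewrite -(I_scale M D1) -(I_scale (beta / tau) D2) -(I_scale (- (beta / tau)) D3).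
  rewrite -(I_add D4 D5) -(I_add (Cl_add D4 D5) D2).
  apply: I_eq; [exact: Cl_scale|exact: Cl_add (Cl_add D4 D5) D2|].
  by move=> x Ax; rewrite mulrA -(EM x Ax); ring.
(* Young inequality for the inertial energy. *)
have step4 : I (fun x => dotv (h0 x) (h1 x)) <=
    2^-1 * I (fun x => dotv (h0 x) (h0 x)) + 2^-1 * I (fun x => dotv (h1 x) (h1 x)).
  have C0 := Cl_scale 2^-1 _ Ch0; have C1 := Cl_scale 2^-1 _ Ch1.
  rewrite -(I_scale 2^-1 Ch0) -(I_scale 2^-1 Ch1) -(I_add C0 C1).
  apply: I_le => [//||x _]; first exact: Cl_add C0 C1.
  have := dotv_ge0 (h1 x - h0 x); rewrite dotvBl !dotvBr (dotvC (h1 x) (h0 x)).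
  move: (dotv (h1 x) (h1 x)) (dotv (h0 x) (h0 x)) (dotv (h0 x) (h1 x)).
  exact: cross_le_half_sum.
rewrite Gsym in Gm; rewrite step2 in step1.
exact: (energy_algebra M0 b0 t0 GN Gmu Gm G0 G1 step3 step4 step1).
Qed.

End EnergyStep.

(** * Energy balance in the bulk and on the boundary *)

Section Scheme.
Variables (R : realType) (m : nat).
Variable Omega : set 'rV[R]_m.+1.
Variable sigma : {measure set (Rtuple R m.+1) -> \bar R}.
Hypothesis hsigma : is_surface_measure Omega sigma.
Hypothesis hOmega : smooth_bounded_domain Omega.

Lemma potential_continuous (F : R -> R) : admissible_potential F ->
  continuous F /\ continuous (derive1 F).
Proof.
by move=> [dF ddF _ _]; split=> t; apply/differentiable_continuous/derivable1_diffP.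
Qed.

Lemma cont_on_comp (A : set 'rV[R]_m.+1) (F : R -> R) (f : 'rV[R]_m.+1 -> R) :
  continuous F -> cont_on A f -> cont_on A (F \o f).
Proof.
move=> cF [V cV fV]; exists (F \o V); last by move=> x Ax /=; rewrite fV.
by move=> x; apply: continuous_comp; [exact: cV|exact: cF].
Qed.

Lemma within_comp (A : set 'rV[R]_m.+1) (F : R -> R) (f : 'rV[R]_m.+1 -> R) :
  continuous F -> {within A, continuous f} -> {within A, continuous (F \o f)}.
Proof.
move=> cF cf x; apply: (@continuous_comp _ _ _ (f : subspace A -> R) F); first exact: cf.
exact: cF.
Qed.

Lemma within_ext (f V : 'rV[R]_m.+1 -> R) : Ck 1 V ->
  (forall x, bdry Omega x -> f x = V x) -> {within bdry Omega, continuous f}.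
Proof.
move=> [cV _] fV; apply: (@within_eq _ _ _ V); first by move=> x /fV.
exact: continuous_subspaceT.
Qed.

Lemma domain_gradB (u v U V : 'rV[R]_m.+1 -> R) x : Ck 1 U -> Ck 1 V ->
  (forall x, closure Omega x -> u x = U x) -> (forall x, closure Omega x -> v x = V x) ->
  Omega x -> grad (fun y => u y - v y) x = grad u x - grad v x.
Proof.
move=> CU CV uU vV Ox.
have E : forall x, closure Omega x -> u x - v x = U x - V x.
  by move=> y cy; rewrite uU // vV.
rewrite (domain_grad hOmega E Ox) (domain_grad hOmega uU Ox) (domain_grad hOmega vV Ox).
apply/rowP => j; rewrite !mxE (partialD _ _ CU (Ck1_opp CV)).
by rewrite partialN.
Qed.

(** Follows from additivity, since the tangential gradient only sees boundary
    values. *)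
Lemma boundary_tgradB (u v U V : 'rV[R]_m.+1 -> R) x : Ck 1 U -> Ck 1 V ->
  (forall x, bdry Omega x -> u x = U x) -> (forall x, bdry Omega x -> v x = V x) ->
  bdry Omega x ->
  tgrad Omega (fun y => u y - v y) x = tgrad Omega u x - tgrad Omega v x.
Proof.
move=> CU CV uU vV bx.
have E : forall x, bdry Omega x -> u x - v x = U x - V x.
  by move=> y cy; rewrite uU // vV.
rewrite (eq_tgrad x E) (eq_tgrad x uU) (eq_tgrad x vV).
have := tgradD hOmega (Ck1_sub CU CV) CV bx.
rewrite (_ : (fun y => U y - V y + V y) = U) => [->|]; first by rewrite addrK.
by apply/funext => y; rewrite subrK.
Qed.

(** The bulk balance. The Neumann conditions remove all boundary terms except the
    flux of the phase. *)
Lemma domain_estimate (F : R -> R) (M beta s tau : R)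
  (phi0 phi1 mu p0 p1 Phi0 Phi1 : 'rV[R]_m.+1 -> R) :
  0 < M -> 0 <= beta -> 0 < tau -> admissible_potential F ->
  2^-1 * sup (range (derive1 (derive1 F))) <= s ->
  Ck_on 2 (closure Omega) phi0 -> Ck_on 2 (closure Omega) phi1 ->
  Ck_on 2 (closure Omega) mu -> inv_lap Omega Phi0 p0 -> inv_lap Omega Phi1 p1 ->
  (forall x, Omega x -> beta * ((Phi1 x - Phi0 x) / tau) + Phi1 x = M * lap mu x) ->
  (forall x, Omega x -> mu x = - lap phi1 x + derive1 F (phi0 x) + s * (phi1 x - phi0 x)) ->
  (forall x, Omega x -> Phi1 x = (phi1 x - phi0 x) / tau) ->
  (forall x, bdry Omega x -> dnormal Omega mu x = 0) ->
  (sqnorm_grad Omega phi1 / 2 + intg (leb R m.+1) Omega (F \o phi1) +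
    beta / (2 * M) * sqnorm_grad Omega p1) -
  (sqnorm_grad Omega phi0 / 2 + intg (leb R m.+1) Omega (F \o phi0) +
    beta / (2 * M) * sqnorm_grad Omega p0) <=
  intg sigma (bdry Omega) (fun x => dnormal Omega phi1 x * (phi1 x - phi0 x)) -
  tau * (M^-1 * sqnorm_grad Omega p1).
Proof.
move=> M0 b0 t0 aF hs [f0 Cf0 E0] [f1 Cf1 E1] [mu' Cmu Emu]
  [[P0 CP0 EP0] Lp0 np0] [[P1 CP1 EP1] Lp1 np1] e1 e2 e3 e4.
have C1 (u : 'rV[R]_m.+1 -> R) : Ck 2 u -> Ck 1 u by exact: Ck2_Ck1.
have [cF cF'] := potential_continuous aF.
have cphi0 := cont_on_closure (C1 _ Cf0) E0.
have cphi1 := cont_on_closure (C1 _ Cf1) E1.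
have cg11 := cont_on_grad hOmega (C1 _ Cf1) (C1 _ Cf1) E1 E1.
have Cd := Ck1_sub (C1 _ Cf1) (C1 _ Cf0).
have Ed x : closure Omega x -> phi1 x - phi0 x = f1 x - f0 x by move=> cx; rewrite E1 // E0.
have gB x : Omega x -> grad (fun y => phi1 y - phi0 y) x = grad phi1 x - grad phi0 x.
  exact: (domain_gradB (C1 _ Cf1) (C1 _ Cf0) E1 E0).
have flux0 (u v : 'rV[R]_m.+1 -> R) : (forall x, bdry Omega x -> dnormal Omega u x = 0) ->
    intg sigma (bdry Omega) (fun x => dnormal Omega u x * v x) = 0.
  by move=> nu; apply: intg_eq0 => x bx; rewrite nu // mul0r.
have ccst c : cont_on Omega (fun=> c : R) by exists (fun=> c) => //; exact: continuous_cst.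
have H := @energy_step R 'rV[R]_m.+1 m.+1 Omega (cont_on Omega) (intg (leb R m.+1) Omega)
  (@cont_on_add _ _ Omega) (@cont_on_mul _ _ Omega) ccst
  (fun f g => @domain_intgD _ _ _ hOmega f g) (fun c f => @domain_intgZ _ _ _ hOmega c f)
  (fun f g => @domain_intg_le _ _ _ hOmega f g) F M beta s tau
  (intg sigma (bdry Omega) (fun x => dnormal Omega phi1 x * (phi1 x - phi0 x)))
  phi0 phi1 mu p1 (lap phi1) (lap mu) (lap p0) (lap p1) (fun=> 0)
  (grad phi0) (grad phi1) (grad mu) (grad p0) (grad p1).
have kap0 : intg (leb R m.+1) Omega (fun x => 0 * (phi1 x - phi0 x)) = 0.
  by apply: intg_eq0 => x _; rewrite mul0r.
rewrite kap0 subr0 in H; apply: (H M0 b0 t0 aF hs cphi0 cphi1); clear H.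
- exact: (cont_on_closure (C1 _ Cmu) Emu).
- exact: (cont_on_closure (C1 _ CP1) EP1).
- exact: (cont_on_lap hOmega Cf1 E1).
- exact: (cont_on_lap hOmega Cmu Emu).
- exact: (cont_on_lap hOmega CP0 EP0).
- exact: (cont_on_lap hOmega CP1 EP1).
- exact: (ccst 0).
- exact: (cont_on_comp cF cphi0).
- exact: (cont_on_comp cF cphi1).
- exact: (cont_on_grad hOmega (C1 _ Cf0) (C1 _ Cf0) E0 E0).
- exact: cg11.
- have [V cV EV] := cont_on_grad hOmega (C1 _ Cf1) Cd E1 Ed.
  by exists V => // x Ox; rewrite -EV // gB.
- exact: (cont_on_grad hOmega (C1 _ CP0) (C1 _ CP0) EP0 EP0).
- exact: (cont_on_grad hOmega (C1 _ CP1) (C1 _ CP1) EP1 EP1).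
- exact: (cont_on_grad hOmega (C1 _ CP0) (C1 _ CP1) EP0 EP1).
- by move=> x Ox; rewrite addr0; exact: e2.
- by move=> x Ox; rewrite Lp1 // e3.
- by move=> x Ox; rewrite Lp1 // Lp0 // e1.
- rewrite -(green_domain hsigma hOmega Cf1 Cd E1 Ed); congr (_ + _).
  by apply: eq_intg => x Ox; rewrite gB.
- by rewrite (green_domain hsigma hOmega CP1 (C1 _ Cmu) EP1 Emu) flux0.
- by rewrite (green_domain hsigma hOmega Cmu (C1 _ CP1) Emu EP1) flux0.
- by rewrite (green_domain hsigma hOmega CP0 (C1 _ CP1) EP0 EP1) flux0.
- by rewrite (green_domain hsigma hOmega CP1 (C1 _ CP1) EP1 EP1) flux0.
Qed.

(** The boundary balance. The same flux enters the surface chemical potential, so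
    that it appears with the opposite sign. *)
Lemma boundary_estimate (G : R -> R) (M beta s tau : R)
  (phi1 psi0 psi1 mu q0 q1 Psi0 Psi1 : 'rV[R]_m.+1 -> R) :
  0 < M -> 0 <= beta -> 0 < tau -> admissible_potential G ->
  2^-1 * sup (range (derive1 (derive1 G))) <= s ->
  Ck_on 2 (closure Omega) phi1 ->
  Ck_on 2 (bdry Omega) psi0 -> Ck_on 2 (bdry Omega) psi1 ->
  Ck_on 2 (bdry Omega) mu -> inv_lapB Omega Psi0 q0 -> inv_lapB Omega Psi1 q1 ->
  (forall x, bdry Omega x -> beta * ((Psi1 x - Psi0 x) / tau) + Psi1 x = M * lapB Omega mu x) ->
  (forall x, bdry Omega x -> mu x = - lapB Omega psi1 x + derive1 G (psi0 x) +
     dnormal Omega phi1 x + s * (psi1 x - psi0 x)) ->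
  (forall x, bdry Omega x -> Psi1 x = (psi1 x - psi0 x) / tau) ->
  (sqnorm_tgrad Omega sigma psi1 / 2 + intg sigma (bdry Omega) (G \o psi1) +
    beta / (2 * M) * sqnorm_tgrad Omega sigma q1) -
  (sqnorm_tgrad Omega sigma psi0 / 2 + intg sigma (bdry Omega) (G \o psi0) +
    beta / (2 * M) * sqnorm_tgrad Omega sigma q0) <=
  - intg sigma (bdry Omega) (fun x => dnormal Omega phi1 x * (psi1 x - psi0 x)) -
  tau * (M^-1 * sqnorm_tgrad Omega sigma q1).
Proof.
move=> M0 b0 t0 aG hs [f1 Cf1 E1] [g0 Cg0 F0] [g1 Cg1 F1] [mu' Cmu Emu]
  [[Q0 CQ0 EQ0] Lq0] [[Q1 CQ1 EQ1] Lq1] e1 e2 e3.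
have C1 (u : 'rV[R]_m.+1 -> R) : Ck 2 u -> Ck 1 u by exact: Ck2_Ck1.
have [cG _] := potential_continuous aG.
have cpsi0 := within_ext (C1 _ Cg0) F0.
have cpsi1 := within_ext (C1 _ Cg1) F1.
have Cd := Ck1_sub (C1 _ Cg1) (C1 _ Cg0).
have Ed x : bdry Omega x -> psi1 x - psi0 x = g1 x - g0 x by move=> bx; rewrite F1 // F0.
have gB x : bdry Omega x ->
    tgrad Omega (fun y => psi1 y - psi0 y) x = tgrad Omega psi1 x - tgrad Omega psi0 x.
  exact: (boundary_tgradB (C1 _ Cg1) (C1 _ Cg0) F1 F0).
have ccst (c : R) : {within bdry Omega, continuous (fun=> c : R)}.
  by apply: continuous_subspaceT; exact: continuous_cst.
have H := @energy_step R 'rV[R]_m.+1 m.+1 (bdry Omega)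
  (fun f => {within bdry Omega, continuous f}) (intg sigma (bdry Omega))
  (@within_add _ _ (bdry Omega)) (@within_mul _ _ (bdry Omega)) ccst
  (fun f g => @surface_intgD _ _ _ _ hsigma hOmega f g)
  (fun c f => @surface_intgZ _ _ _ _ hsigma hOmega c f)
  (fun f g => @surface_intg_le _ _ _ _ hsigma hOmega f g) G M beta s tau 0
  psi0 psi1 mu q1 (lapB Omega psi1) (lapB Omega mu) (lapB Omega q0) (lapB Omega q1)
  (dnormal Omega phi1)
  (tgrad Omega psi0) (tgrad Omega psi1) (tgrad Omega mu) (tgrad Omega q0) (tgrad Omega q1).
rewrite sub0r in H; apply: (H M0 b0 t0 aG hs cpsi0 cpsi1); clear H.
- exact: (within_ext (C1 _ Cmu) Emu).
- exact: (within_ext (C1 _ CQ1) EQ1).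
- exact: (within_lapB hOmega Cg1 F1).
- exact: (within_lapB hOmega Cmu Emu).
- exact: (within_lapB hOmega CQ0 EQ0).
- exact: (within_lapB hOmega CQ1 EQ1).
- exact: (within_dnormal hOmega (C1 _ Cf1) E1).
- exact: (within_comp cG cpsi0).
- exact: (within_comp cG cpsi1).
- exact: (within_dotv_tgrad hOmega (C1 _ Cg0) (C1 _ Cg0) F0 F0).
- exact: (within_dotv_tgrad hOmega (C1 _ Cg1) (C1 _ Cg1) F1 F1).
- apply: (@within_eq _ _ _ (fun x => dotv (tgrad Omega psi1 x)
     (tgrad Omega (fun y => psi1 y - psi0 y) x))); first by move=> x bx; rewrite gB.
  exact: (within_dotv_tgrad hOmega (C1 _ Cg1) Cd F1 Ed).
- exact: (within_dotv_tgrad hOmega (C1 _ CQ0) (C1 _ CQ0) EQ0 EQ0).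
- exact: (within_dotv_tgrad hOmega (C1 _ CQ1) (C1 _ CQ1) EQ1 EQ1).
- exact: (within_dotv_tgrad hOmega (C1 _ CQ0) (C1 _ CQ1) EQ0 EQ1).
- exact: e2.
- by move=> x bx; rewrite Lq1 // e3.
- by move=> x bx; rewrite Lq1 // Lq0 // e1.
- rewrite -[RHS](green_boundary hsigma hOmega Cg1 Cd F1 Ed); congr (_ + _).
  by apply: eq_intg => x bx; rewrite gB.
- exact: (green_boundary hsigma hOmega CQ1 (C1 _ Cmu) EQ1 Emu).
- exact: (green_boundary hsigma hOmega Cmu (C1 _ CQ1) Emu EQ1).
- exact: (green_boundary hsigma hOmega CQ0 (C1 _ CQ1) EQ0 EQ1).
- exact: (green_boundary hsigma hOmega CQ1 (C1 _ CQ1) EQ1 EQ1).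
Qed.

End Scheme.
Lemma energy_sum (R : realFieldType) (tau X k1 k2 a1 a1' a2 a2' f f' g g' h1 h1' h2 h2' : R)
  (b1 b2 : R) :
  (a1 / 2 + f + b1 * h1) - (a1' / 2 + f' + b1 * h1') <= X - tau * (k1 * h1) ->
  (a2 / 2 + g + b2 * h2) - (a2' / 2 + g' + b2 * h2') <= - X - tau * (k2 * h2) ->
  (a1 / 2 + f + b1 * h1 + a2 / 2 + g + b2 * h2) -
  (a1' / 2 + f' + b1 * h1' + a2' / 2 + g' + b2 * h2') <= (- (k1 * h1) - k2 * h2) * tau.
Proof.
rewrite mulrBl mulNr ![_ * tau]mulrC.
move: (b1 * h1) (b1 * h1') (b2 * h2) (b2 * h2') (tau * (k1 * h1)) (tau * (k2 * h2)).
by move=> *; lra.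
Qed.

Theorem theorem3p1 (R : realType) (d : nat) (hd : d = 2%N \/ d = 3%N)
  (Omega : set 'rV[R]_d) (hOmega : smooth_bounded_domain Omega)
  (sigma : {measure set (Rtuple R d) -> \bar R})
  (hsigma : is_surface_measure Omega sigma)
  (T : R) (hT : 0 < T) (N n : nat) (hn : (1 <= n < N)%N)
  (tau : R) (htau : tau = T / N%:R)
  (M1 M2 beta1 beta2 s1 s2 : R) (hM1 : 0 < M1) (hM2 : 0 < M2)
  (hbeta1 : 0 <= beta1) (hbeta2 : 0 <= beta2)
  (F G : R -> R) (hF : admissible_potential F) (hG : admissible_potential G)
  (phi Phi psi Psi p q : nat -> 'rV[R]_d -> R) (mu1 muG1 : 'rV[R]_d -> R)
  (hphi : forall k, (n.-1 <= k <= n.+1)%N -> Ck_on 2 (closure Omega) (phi k))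
  (hpsi : forall k, (n.-1 <= k <= n.+1)%N -> Ck_on 2 (bdry Omega) (psi k))
  (hmu1 : Ck_on 2 (closure Omega) mu1) (hmuG1 : Ck_on 2 (bdry Omega) muG1)
  (htrace : forall x, bdry Omega x -> phi n x = psi n x)
  (hPhi : forall x, Omega x -> Phi n x = (phi n x - phi n.-1 x) / tau)
  (hPsi : forall x, bdry Omega x -> Psi n x = (psi n x - psi n.-1 x) / tau)
  (hPhi0 : intg (leb R d) Omega (Phi n) = 0)
  (hPsi0 : intg sigma (bdry Omega) (Psi n) = 0)
  (hscheme : scheme_step Omega M1 M2 beta1 beta2 s1 s2 tau (derive1 F) (derive1 G)
    (phi n) (Phi n) (psi n) (Psi n)
    (phi n.+1) mu1 (Phi n.+1) (psi n.+1) muG1 (Psi n.+1))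
  (hp : forall k, k = n \/ k = n.+1 -> inv_lap Omega (Phi k) (p k))
  (hq : forall k, k = n \/ k = n.+1 -> inv_lapB Omega (Psi k) (q k))
  (hs1 : 2^-1 * sup (range (derive1 (derive1 F))) <= s1)
  (hs2 : 2^-1 * sup (range (derive1 (derive1 G))) <= s2) :
  let E k :=
    energy Omega sigma M1 M2 beta1 beta2 F G (phi k) (psi k) (p k) (q k) in
  (E n.+1 - E n) / tau <=
    - (M1^-1 * sqnorm_grad Omega (p n.+1))
    - M2^-1 * sqnorm_tgrad Omega sigma (q n.+1).
Proof.
have t0 : 0 < tau.
  rewrite htau divr_gt0 // ltr0n.
  by case/andP: hn => n1 nN; exact: leq_ltn_trans nN.
(* The boundary calculus lives in positive dimension, where a coordinate can be
   split off. *)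
destruct d as [|m]; first by exfalso; case: hd.
cbv zeta.
have kn : (n.-1 <= n <= n.+1)%N by rewrite leq_pred leqnSn.
have kn1 : (n.-1 <= n.+1 <= n.+1)%N by rewrite leqnn andbT (leq_trans (leq_pred n)).
case: hscheme => e1 e2 e3 e4 e5 e6 e7 e8.
have HB := domain_estimate hsigma hOmega hM1 hbeta1 t0 hF hs1 (hphi _ kn) (hphi _ kn1) hmu1
  (hp _ (or_introl erefl)) (hp _ (or_intror erefl)) e1 e2 e3 e8.
have HS := boundary_estimate hsigma hOmega hM2 hbeta2 t0 hG hs2 (hphi _ kn1) (hpsi _ kn)
  (hpsi _ kn1) hmuG1 (hq _ (or_introl erefl)) (hq _ (or_intror erefl)) e5 e6 e7.
(* The traces coincide at both time levels, so the two fluxes cancel. *)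
have flux : intg sigma (bdry Omega)
      (fun x => dnormal Omega (phi n.+1) x * (phi n.+1 x - phi n x)) =
    intg sigma (bdry Omega)
      (fun x => dnormal Omega (phi n.+1) x * (psi n.+1 x - psi n x)).
  by apply: eq_intg => x bx; rewrite e4 // htrace.
rewrite ler_pdivrMr //; move: HB HS; rewrite flux /energy.
set X := intg sigma (bdry Omega) (fun x => _ * _).
exact: energy_sum.
Qed.
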